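(* Let $(\mathfrak h,[\cdot,\cdot]_{\mathfrak h})$ be a symmetric graded Lie algebra, and put $\bar{\mathcal C}^n(\mathfrak h,\mathfrak h)=\mathrm{Hom}^n(S(\mathfrak h),s^{-1}\mathrm{Der}(\mathfrak h))$, $\bar{\mathcal C}^*(\mathfrak h,\mathfrak h)=\oplus_{n\in\mathbb Z}\bar{\mathcal C}^n(\mathfrak h,\mathfrak h)$. Define $\partial:\bar{\mathcal C}^n(\mathfrak h,\mathfrak h)\to\bar{\mathcal C}^{n+1}(\mathfrak h,\mathfrak h)$ by $$(\partial\beta)_p(v_1,\dots,v_p)=\sum_{1\le i<j\le p}(-1)^{n+1+v_i(v_1+\cdots+v_{i-1})+v_j(v_1+\cdots+v_{j-1})+v_iv_j}\beta_{p-1}([v_i,v_j]_{\mathfrak h},v_1,\dots,\hat v_i,\dots,\hat v_j,\dots,v_p)$$ and $[\cdot,\cdot]^c:\bar{\mathcal C}^m(\mathfrak h,\mathfrak h)\times\bar{\mathcal C}^n(\mathfrak h,\mathfrak h)\to\bar{\mathcal C}^{m+n+1}(\mathfrak h,\mathfrak h)$ by $$\begin{aligned}[\alpha,\beta]^c_p(v_1,\dots,v_p)=&-\sum_{k+l=p+1}\sum_{\sigma\in\mathbb S_{(l,1,p-l-1)}}\varepsilon(\sigma)\alpha_{k-1}\Big(s\big(\beta_l(v_{\sigma(1)},\dots,v_{\sigma(l)})\big)v_{\sigma(l+1)},v_{\sigma(l+2)},\dots,v_{\sigma(p)}\Big)\\&+(-1)^{(m+1)(n+1)}\sum_{k+l=p+1}\sum_{\sigma\in\mathbb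 S_{(k-1,1,p-k)}}\varepsilon(\sigma)\beta_l\Big(s\big(\alpha_{k-1}(v_{\sigma(1)},\dots,v_{\sigma(k-1)})\big)v_{\sigma(k)},v_{\sigma(k+1)},\dots,v_{\sigma(p)}\Big)\\&-\sum_{k+l=p+1}\sum_{\sigma\in\mathbb S_{(k-1,l)}}(-1)^{(n+1)(v_{\sigma(1)}+\cdots+v_{\sigma(k-1)})}\varepsilon(\sigma)s^{-1}[s\alpha_{k-1}(v_{\sigma(1)},\dots,v_{\sigma(k-1)}),s\beta_l(v_{\sigma(k)},\dots,v_{\sigma(p)})].\end{aligned}$$ Then $(s\bar{\mathcal C}^*(\mathfrak h,\mathfrak h),[\cdot,\cdot]^c,\partial)$ is a differential graded Lie algebra. Moreover, its Maurer-Cartan elements are precisely the operator homotopy post-Lie algebra structures on the symmetric graded Lie algebra $(\mathfrak h,[\cdot,\cdot]_{\mathfrak h})$, where $L=\sum_{i\ge0}L_i\in\mathrm{Hom}^0(S(\mathfrak h),s^{-1}\mathrm{Der}(\mathfrak h))$ corresponds to the maps $\theta_k(v_1,\dots,v_k)=\big(sL_{k-1}(v_1,\dots,v_{k-1})\big)v_k$, $k\ge1$.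
   Context: All vector spaces are over a field of characteristic zero; graded means $\mathbb Z$-graded. For a homogeneous element $x$, the symbol $x$ in an exponent of $-1$ denotes its degree. For a graded vector space $V$, $S(V)=\oplus_{i\ge0}S^i(V)$ is the (graded-commutative) symmetric algebra with product $\odot$. The Koszul sign $\varepsilon(\sigma)=\varepsilon(\sigma;v_1,\dots,v_n)$ is defined by $v_1\odot\cdots\odot v_n=\varepsilon(\sigma)\,v_{\sigma(1)}\odot\cdots\odot v_{\sigma(n)}$. $\mathbb S_{(i_1,\dots,i_k)}$ is the set of $(i_1,\dots,i_k)$-shuffles, i.e. permutations of $\{1,\dots,i_1+\cdots+i_k\}$ increasing on each of the consecutive blocks of sizes $i_1,\dots,i_k$ (empty if some $i_j<0$). $\mathrm{Hom}^n(S(V),W)$ is the space of degree $n$ linear maps; such $f$ is written $f=\sum_{i\ge0}f_i$ with $f_i:S^i(V)\to W$ ($f_0\in W^n$). In sums over $k+l=p+1$, $k\ge1$ and $l\ge0$. A subscript $p$ denotes the component on $S^p$. A symmetric graded Lie algebra (sgLa) is a graded vector space $\mathfrak g$ with a bilinear bracket of degree $1$ such that $[x,y]_{\mathfrak g}=(-1)^{xy}[y,x]_{\mathfrak g}$ and $[x,[y,z]_{\mathfrak g}]_{\mathfrak g}=(-1)^{x+1}[[x,y]_{\mathfrak g},z]_{\mathfrak g}+(-1)^{(x+1)(y+1)}[y,[x,z]_{\mathfrak g}]_{\mathfrak g}$. A derivation of degree $n$ of a sgLa $\mathfrak h$ is a degree $n$ linear map $D$ with $D[x,y]_{\mathfrak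 h}=(-1)^n[Dx,y]_{\mathfrak h}+(-1)^{n(x+1)}[x,Dy]_{\mathfrak h}$; $\mathrm{Der}(\mathfrak h)=\oplus_n\mathrm{Der}^n(\mathfrak h)$, with the graded commutator $[\cdot,\cdot]$. Suspension: $(sV)^i=V^{i-1}$, $(s^{-1}V)^i=V^{i+1}$, with the identity-on-underlying-spaces maps $s$ (degree $1$), $s^{-1}$ (degree $-1$). Here $s:s^{-1}\mathrm{Der}(\mathfrak h)\to\mathrm{Der}(\mathfrak h)$. The operations $\partial,[\cdot,\cdot]^c$ are transported to $s\bar{\mathcal C}^*(\mathfrak h,\mathfrak h)$ (where $\bar{\mathcal C}^n$ sits in degree $n+1$) by identifying $s\alpha$ with $\alpha$. A Maurer-Cartan element is a degree $1$ element $\theta$ with $d\theta+\frac12[\theta,\theta]=0$; thus it is given by $L\in\bar{\mathcal C}^0(\mathfrak h,\mathfrak h)$. An operator homotopy post-Lie algebra (equivalently, an operator homotopy post-Lie algebra structure on the sgLa $(\mathfrak g,[\cdot,\cdot]_{\mathfrak g})$) is a sgLa $(\mathfrak g,[\cdot,\cdot]_{\mathfrak g})$ with linear maps $\theta_k:\otimes^k\mathfrak g\to\mathfrak g$ ($k\ge1$) of degree $1$ such that for all homogeneous $x_1,\dots,x_{n+1}$ and all $n\ge1$: (i) $\theta_n(x_{\sigma(1)},\dots,x_{\sigma(n-1)},x_n)=\varepsilon(\sigma)\theta_n(x_1,\dots,x_{n-1},x_n)$ for every $\sigma\in\mathbb S_{n-1}$; (ii) $\theta_n(x_1,\dots,x_{n-1},[x_n,x_{n+1}]_{\mathfrak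 g})=(-1)^{x_1+\cdots+x_{n-1}+1}[\theta_n(x_1,\dots,x_{n-1},x_n),x_{n+1}]_{\mathfrak g}+(-1)^{(x_1+\cdots+x_{n-1}+1)(x_n+1)}[x_n,\theta_n(x_1,\dots,x_{n-1},x_{n+1})]_{\mathfrak g}$; (iii) $$\begin{aligned}&\sum_{i+j=n+1,\ i\ge1,\ j\ge2}\ \sum_{\sigma\in\mathbb S_{(i-1,1,j-2)}}\varepsilon(\sigma)\theta_j(\theta_i(x_{\sigma(1)},\dots,x_{\sigma(i-1)},x_{\sigma(i)}),x_{\sigma(i+1)},\dots,x_{\sigma(n-1)},x_n)\\&+\sum_{i+j=n+1,\ i\ge1,\ j\ge1}\ \sum_{\sigma\in\mathbb S_{(j-1,i-1)}}(-1)^{\alpha}\varepsilon(\sigma)\theta_j(x_{\sigma(1)},\dots,x_{\sigma(j-1)},\theta_i(x_{\sigma(j)},\dots,x_{\sigma(n-1)},x_n))\\&=\sum_{1\le i<j\le n-1}(-1)^{\beta}\theta_{n-1}([x_i,x_j]_{\mathfrak g},x_1,\dots,\hat x_i,\dots,\hat x_j,\dots,x_n),\end{aligned}$$ where $\alpha=x_{\sigma(1)}+\cdots+x_{\sigma(j-1)}$ and $\beta=x_i(x_1+\cdots+x_{i-1})+x_j(x_1+\cdots+x_{j-1})+x_ix_j+1$. *)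

(* Defs.v *)
From HB Require Import structures.
From mathcomp Require Import all_boot all_order all_algebra perm.
From mathcomp Require Import boolp functions.
From mathcomp Require Import finmap.
From mathcomp Require Import monalg.

Set Implicit Arguments.
Unset Strict Implicit.
Unset Printing Implicit Defensive.

Import GRing.Theory.
Local Open Scope ring_scope.

Record subfam (K : fieldType) (A : lmodType K) := Subfam {
  sf_in :> int -> A -> Prop;
  sf_0 : forall d, sf_in d 0;
  sf_lin : forall d a x y, sf_in d x -> sf_in d y -> sf_in d (a *: x + y);
  sf_indep : forall (s : seq int) (u : int -> A), uniq s ->
    (forall d, sf_in d (u d)) -> \sum_(d <- s) u d = 0 ->
    forall d, d \in s -> u d = 0
}.

(* A Z-graded vector space is presented internally: a vector space that is the
   direct sum of its homogeneous components. *)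
Record gvs (K : fieldType) := Gvs {
  gv_car :> lmodType K;
  gv_fam : subfam gv_car;
  gv_span : forall x : gv_car, exists2 s : seq gv_car,
    (forall y, y \in s -> exists d, gv_fam d y) & x = \sum_(y <- s) y
}.

Definition homog (K : fieldType) (V : gvs K) (d : int) (x : V) : Prop :=
  gv_fam V d x.

Section Components.
Context (K : fieldType) (V : gvs K).
Implicit Types (s t : seq int) (u : int -> V).

Definition decomp s u (x : V) : Prop :=
  [/\ uniq s, forall d, homog d (u d), forall d, d \notin s -> u d = 0
    & x = \sum_(d <- s) u d].

Lemma sum_supp (M : nmodType) s t (f : int -> M) : uniq s -> uniq t ->
  (forall d, d \notin s -> f d = 0) -> {subset s <= t} ->
  \sum_(d <- t) f d = \sum_(d <- s) f d.
Proof.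
move=> us ut fs st; rewrite (bigID (mem s)) /= addrC big1; last first.
  by move=> d /fs.
rewrite add0r -big_filter; apply: perm_big.
apply: uniq_perm => [||d]; rewrite ?filter_uniq // mem_filter andb_idr //.
exact: st.
Qed.

Lemma decomp_ex (x : V) : exists s u, decomp s u x.
Proof.
have [l hl ->] := gv_span x; elim: l hl => [|y l IH] hl.
  exists [::], (fun=> 0); split=> //; first by move=> d; apply: sf_0.
  by rewrite !big_nil.
have [|s [u [us hu su defl]]] := IH.
  by move=> z zl; apply: hl; rewrite inE zl orbT.
have [|d hd] := hl y; first by rewrite mem_head.
pose u' e := (if e == d then y else 0) + u e.
pose r := undup (d :: s); have ur : uniq r by apply: undup_uniq.
exists r, u'; split=> // [e|e|].
- rewrite /u' -[if _ then _ else _]scale1r; apply: sf_lin; last exact: hu.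
  by case: eqP => [->|_] //; apply: sf_0.
- rewrite mem_undup inE negb_or => /andP[/negPf ed /su ue].
  by rewrite /u' ed ue addr0.
rewrite big_cons big_split /= defl; congr (_ + _); last first.
  symmetry; apply: sum_supp => // e es.
  by rewrite mem_undup inE es orbT.
rewrite (@sum_supp _ [:: d]) //.
- by rewrite big_seq1 eqxx.
- by move=> e; rewrite inE => /negPf->.
- by move=> e; rewrite inE mem_undup inE => ->.
Qed.

Lemma decomp_uniq s u t v x : decomp s u x -> decomp t v x -> u = v.
Proof.
case=> us hu su ->; case=> ut hv tv e.
pose r := undup (s ++ t); have ur : uniq r by apply: undup_uniq.
have sr : {subset s <= r} by move=> d ds; rewrite mem_undup mem_cat ds.
have tr : {subset t <= r} by move=> d dt; rewrite mem_undup mem_cat dt orbT.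
have e0 : \sum_(d <- r) (u d - v d) = 0.
  apply/eqP; rewrite sumrB subr_eq0; apply/eqP.
  by rewrite (sum_supp us ur su sr) (sum_supp ut ur tv tr).
apply/funext => d; have [dr|] := boolP (d \in r).
  apply/eqP; rewrite -subr_eq0; apply/eqP.
  apply: (@sf_indep _ _ (gv_fam V) r (fun n => u n - v n)) => // n.
  by rewrite addrC -scaleN1r; apply: sf_lin; [apply: hv|apply: hu].
by rewrite mem_undup mem_cat negb_or => /andP[/su-> /tv->].
Qed.

End Components.

Section DirectSum.
Context (K : fieldType) (A : lmodType K) (F : subfam A).

Definition dsum_pred : {pred A} := fun x =>
  `[< exists2 s : seq A,
        (forall y, y \in s -> exists d, F d y) & x = \sum_(y <- s) y >].

Lemma dsum_submod_closed : submod_closed dsum_pred.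
Proof.
split=> [|a x y /asboolP[s hs ->] /asboolP[t ht ->]]; apply/asboolP.
  by exists [::]; rewrite ?big_nil.
exists ([seq a *: z | z <- s] ++ t) => [z|].
  rewrite mem_cat => /orP[/mapP[z' /hs[d hd] ->]|/ht //].
  by exists d; rewrite -[_ *: _]addr0; apply: sf_lin => //; apply: sf_0.
by rewrite big_cat /= big_map scaler_sumr.
Qed.

HB.instance Definition _ :=
  GRing.isSubmodClosed.Build K A dsum_pred dsum_submod_closed.

Record dsum_car := DsumCar { dsum_val :> A; _ : dsum_val \in dsum_pred }.

HB.instance Definition _ := [isSub for dsum_val].
HB.instance Definition _ := [Choice of dsum_car by <:].
HB.instance Definition _ := [SubChoice_isSubLmodule of dsum_car by <:].

Definition dsum_in (d : int) (x : dsum_car) : Prop := F d (dsum_val x).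

Lemma dsum_in0 d : dsum_in d 0.
Proof. exact: sf_0. Qed.

Lemma dsum_in_lin d a x y :
  dsum_in d x -> dsum_in d y -> dsum_in d (a *: x + y).
Proof. exact: sf_lin. Qed.

Lemma dsum_in_indep (s : seq int) (u : int -> dsum_car) : uniq s ->
  (forall d, dsum_in d (u d)) -> \sum_(d <- s) u d = 0 ->
  forall d, d \in s -> u d = 0.
Proof.
move=> us hu su d ds; apply: val_inj.
apply: (sf_indep (s := s) (u := fun d => dsum_val (u d)) us hu _ ds).
by have := congr1 val su; rewrite raddf_sum.
Qed.

Definition dsum_fam := Subfam dsum_in0 dsum_in_lin dsum_in_indep.

Lemma dsum_span (x : dsum_car) : exists2 s : seq dsum_car,
  (forall y, y \in s -> exists d, dsum_fam d y) & x = \sum_(y <- s) y.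
Proof.
case: x => x xP; have /asboolP[s hs defx] := xP.
have sP y : y \in s -> y \in dsum_pred.
  by move=> ys; apply/asboolP; exists [:: y];
    rewrite ?big_seq1 // => z; rewrite inE => /eqP->; apply: hs.
exists (pmap insub s) => [y|].
  by rewrite mem_pmap_sub => /hs.
apply: val_inj; rewrite raddf_sum /= defx.
rewrite -[RHS](big_map val xpredT id) (pmap_filter (@insubK _ _ _)).
rewrite (_ : filter _ _ = s) //; apply/all_filterP/allP => y ys /=.
by rewrite isSome_insub sP.
Qed.

Definition dsum : gvs K := Gvs dsum_span.

End DirectSum.

Section Shift.
Context (K : fieldType).

(* [shift k V] has [V^(d+k)] in degree [d], on the same underlying space. *)
Section Def.
Context (k : int) (V : gvs K).
Definition shift_in (d : int) (x : V) : Prop := homog (d + k) x.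

Lemma shift_in0 d : shift_in d 0.
Proof. exact: sf_0. Qed.

Lemma shift_in_lin d a x y :
  shift_in d x -> shift_in d y -> shift_in d (a *: x + y).
Proof. exact: sf_lin. Qed.

Lemma shift_in_indep (s : seq int) (u : int -> V) : uniq s ->
  (forall d, shift_in d (u d)) -> \sum_(d <- s) u d = 0 ->
  forall d, d \in s -> u d = 0.
Proof.
move=> us hu su d ds.
have := @sf_indep _ _ (gv_fam V) [seq d + k | d <- s] (fun e => u (e - k)).
move=> /(_ _ _ _ (d + k)); rewrite addrK; apply.
- by rewrite map_inj_uniq //; apply: addIr.
- by move=> e; have := hu (e - k); rewrite /shift_in subrK.
- by rewrite big_map -[RHS]su; apply: eq_bigr => e _; rewrite addrK.
- exact: (map_f (fun d => d + k)).
Qed.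

Definition shift_fam := Subfam shift_in0 shift_in_lin shift_in_indep.

Lemma shift_span (x : V) : exists2 s : seq V,
  (forall y, y \in s -> exists d, shift_fam d y) & x = \sum_(y <- s) y.
Proof.
have [s hs ->] := gv_span x; exists s => // y /hs[d hd].
by exists (d - k); rewrite /= /shift_in subrK.
Qed.

Definition shift : gvs K := Gvs shift_span.
End Def.

Definition susp (V : gvs K) : gvs K := shift (-1) V.
Definition desusp (V : gvs K) : gvs K := shift 1 V.

(* The map s : s^{-1}V -> V; both sides share their underlying space. *)
Definition smap (V : gvs K) (x : desusp V) : V := x.

End Shift.

Section Hom.
Context (K : fieldType) (U W : gvs K).

Definition hom_in (n : int) (f : U -> W) : Prop :=
  linear f /\ forall d x, homog d x -> homog (n + d) (f x).

Lemma hom_in0 n : hom_in n 0.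
Proof.
split=> [a x y|d x _]; first by rewrite /= scaler0 addr0.
exact: sf_0.
Qed.

Lemma hom_in_lin n a f g : hom_in n f -> hom_in n g -> hom_in n (a *: f + g).
Proof.
move=> [lf df] [lg dg]; have fgE x : (a *: f + g) x = a *: f x + g x by [].
split=> [b x y|d x hx]; last first.
  by apply: sf_lin; [apply: df|apply: dg].
rewrite !fgE lf lg !scalerDr !scalerA (mulrC a b) -!addrA.
by congr (_ + _); rewrite addrCA.
Qed.

Lemma hom_in_indep (s : seq int) (u : int -> U -> W) : uniq s ->
  (forall d, hom_in d (u d)) -> \sum_(d <- s) u d = 0 ->
  forall d, d \in s -> u d = 0.
Proof.
move=> us hu su d ds; apply: funext => x.
have lu e : linear (u e) by case: (hu e).
pose ul e := GRing.isLinear.Build K U W _ (u e) (lu e).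
pose U_ e : {linear U -> W} := HB.pack (u e) (ul e).
have [t ht ->] := gv_span x; rewrite -[RHS]/(0 : W) -[u d]/(U_ d : U -> W) linear_sum.
rewrite big1_seq // => y /= /ht[e he].
have := @sf_indep _ _ (gv_fam W) [seq n + e | n <- s] (fun k => u (k - e) y).
move=> /(_ _ _ _ (d + e)); rewrite addrK; apply.
- by rewrite map_inj_uniq //; apply: addIr.
- by move=> k; have [_ /(_ e y he)] := hu (k - e); rewrite subrK.
- rewrite big_map -[RHS](congr1 (fun f => f y) su) fct_sumE.
  by apply: eq_bigr => k _; rewrite addrK.
- exact: (map_f (fun n => n + e)).
Qed.

Definition hom_fam := Subfam hom_in0 hom_in_lin hom_in_indep.

Definition Hom : gvs K := dsum hom_fam.

End Hom.

Section Sym.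
Context (K : fieldType) (V : gvs K).

(* The free vector space on the set of words in elements of [V], i.e. the
   underlying space of the free associative algebra on the set [V], whose
   product is concatenation of words. *)
Definition freeA := {malg K[seq V]}.

Definition fword (w : seq V) : freeA := << w >>.

(* The two-sided ideal generated by the elements
   [a x + y] - a [x] - [y]  and  [x][y] - (-1)^{|x||y|} [y][x],
   i.e. the subspace spanned by all products u * r * w of such an element r
   with words u and w. *)
Inductive sym_ideal : freeA -> Prop :=
| sym_ideal0 : sym_ideal 0
| sym_ideal_lin a p q : sym_ideal p -> sym_ideal q -> sym_ideal (a *: p + q)
| sym_ideal_vect u w a x y :
    sym_ideal (fword (u ++ (a *: x + y) :: w) -
               (a *: fword (u ++ x :: w) + fword (u ++ y :: w)))
| sym_ideal_comm u w d e x y : homog d x -> homog e y ->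
    sym_ideal (fword (u ++ x :: y :: w) -
               (-1) ^ (d * e) *: fword (u ++ y :: x :: w)).

Definition sym_pred : {pred freeA} := fun p => `[< sym_ideal p >].

Lemma sym_submod_closed : submod_closed sym_pred.
Proof.
split=> [|a x y /asboolP hx /asboolP hy]; apply/asboolP.
  exact: sym_ideal0.
exact: sym_ideal_lin.
Qed.

HB.instance Definition _ :=
  GRing.isSubmodClosed.Build K freeA sym_pred sym_submod_closed.

Local Open Scope quotient_scope.

Definition sym_car := Quotient.quot sym_pred.
HB.instance Definition _ := GRing.Zmodule.on sym_car.

Definition sym_pi (p : freeA) : sym_car := \pi_sym_car p.

Lemma sym_pi_eq p q : sym_pi p = sym_pi q <-> sym_ideal (p - q).
Proof.
split=> [/eqP|] h.
  by apply/asboolP; move: h; rewrite /sym_pi -Quotient.idealrBE.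
by apply/eqP; rewrite /sym_pi -Quotient.idealrBE; apply/asboolP.
Qed.

Lemma sym_piD p q : sym_pi (p + q) = sym_pi p + sym_pi q.
Proof. by rewrite /sym_pi !piE. Qed.

Lemma sym_repr (x : sym_car) : sym_pi (repr x) = x.
Proof. exact: reprK. Qed.

Definition sym_scale (a : K) (x : sym_car) : sym_car := sym_pi (a *: repr x).

Lemma sym_scaleE a p : sym_scale a (sym_pi p) = sym_pi (a *: p).
Proof.
apply/sym_pi_eq; rewrite -scalerBr -[_ *: _]addr0.
apply: sym_ideal_lin; last exact: sym_ideal0.
by apply/sym_pi_eq; rewrite sym_repr.
Qed.

Lemma sym_scaleA a b x : sym_scale a (sym_scale b x) = sym_scale (a * b) x.
Proof. by rewrite -[x]sym_repr !sym_scaleE scalerA. Qed.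

Lemma sym_scale1 x : sym_scale 1 x = x.
Proof. by rewrite -[x]sym_repr !sym_scaleE scale1r. Qed.

Lemma sym_scaleDr a x y : sym_scale a (x + y) = sym_scale a x + sym_scale a y.
Proof.
by rewrite -[x]sym_repr -[y]sym_repr -sym_piD !sym_scaleE -sym_piD scalerDr.
Qed.

Lemma sym_scaleDl x a b : sym_scale (a + b) x = sym_scale a x + sym_scale b x.
Proof. by rewrite -[x]sym_repr !sym_scaleE -sym_piD scalerDl. Qed.

HB.instance Definition _ := GRing.Zmodule_isLmodule.Build K sym_car
  sym_scaleA sym_scale1 sym_scaleDr sym_scaleDl.

Lemma sym_pi_linear : linear sym_pi.
Proof. by move=> a p q; rewrite sym_piD -sym_scaleE. Qed.

HB.instance Definition _ :=
  GRing.isLinear.Build K freeA sym_car _ sym_pi sym_pi_linear.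

(* [sym_mon [:: v1; ...; vp]] is v1 \odot ... \odot vp. *)
Definition sym_mon (w : seq V) : sym_car := sym_pi (fword w).

Definition multilinear_on (M : lmodType K) (f : seq V -> M) : Prop :=
  forall u w a x y,
    f (u ++ (a *: x + y) :: w) = a *: f (u ++ x :: w) + f (u ++ y :: w).

Definition graded_symmetric (M : lmodType K) (f : seq V -> M) : Prop :=
  forall u w d e x y, homog d x -> homog e y ->
    f (u ++ x :: y :: w) = (-1) ^ (d * e) *: f (u ++ y :: x :: w).

Lemma sym_mon_multilinear : multilinear_on sym_mon.
Proof.
move=> u w a x y; rewrite /sym_mon -linearP; apply/sym_pi_eq.
exact: sym_ideal_vect.
Qed.

Lemma sym_mon_symmetric : graded_symmetric sym_mon.
Proof.
move=> u w d e x y hx hy; rewrite /sym_mon -linearZ; apply/sym_pi_eq.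
exact: sym_ideal_comm.
Qed.

Section Lift.
Context (M : lmodType K) (f : seq V -> M).

Definition free_ext (p : freeA) : M := \sum_(w <- msupp p) p@_w *: f w.

Lemma free_extw (D : {fset (seq V)}) p : (msupp p `<=` D)%fset ->
  free_ext p = \sum_(w <- D) p@_w *: f w.
Proof.
move=> sD; apply: big_fset_incl => // w _ /mcoeff_outdom->.
by rewrite scale0r.
Qed.

Lemma free_ext_linear : linear free_ext.
Proof.
move=> a p q; pose D := (msupp p `|` (msupp q `|` msupp (a *: p + q)))%fset.
rewrite !(@free_extw D); first last.
- by rewrite /D fsetUA fsubsetUr.
- exact: fsubsetUl.
- by rewrite /D fsetUCA fsubsetUl.
rewrite scaler_sumr -big_split; apply: eq_bigr => w _ /=.
by rewrite mcoeffD mcoeffZ scalerDl scalerA.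
Qed.

HB.instance Definition _ :=
  GRing.isLinear.Build K freeA M _ free_ext free_ext_linear.

Lemma free_ext_word w : free_ext (fword w) = f w.
Proof.
rewrite (@free_extw [fset w]%fset); last exact: msuppU_le.
by rewrite big_seq_fset1 mcoeffUU scale1r.
Qed.

Hypotheses (fL : multilinear_on f) (fS : graded_symmetric f).

Lemma free_ext_ideal p : sym_ideal p -> free_ext p = 0.
Proof.
elim=> {p} [|a p q _ hp _ hq|u w a x y|u w d e x y hx hy].
- exact: linear0.
- by rewrite free_ext_linear hp hq scaler0 addr0.
- by rewrite linearB /= free_ext_linear !free_ext_word fL subrr.
- by rewrite linearB linearZ /= !free_ext_word (fS _ _ hx hy) subrr.
Qed.

Definition sym_ext (x : sym_car) : M := free_ext (repr x).

Lemma sym_ext_pi p : sym_ext (sym_pi p) = free_ext p.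
Proof.
apply/eqP; rewrite -subr_eq0 -linearB; apply/eqP/free_ext_ideal.
by apply/sym_pi_eq; rewrite sym_repr.
Qed.

Lemma sym_ext_linear : linear sym_ext.
Proof.
move=> a x y; rewrite -[x]sym_repr -[y]sym_repr -linearP !sym_ext_pi.
exact: linearP.
Qed.

Lemma sym_ext_mon w : sym_ext (sym_mon w) = f w.
Proof. by rewrite sym_ext_pi free_ext_word. Qed.

End Lift.

Lemma sym_lift (M : lmodType K) (f : seq V -> M) :
  multilinear_on f -> graded_symmetric f ->
  exists2 F : sym_car -> M, linear F & forall w, F (sym_mon w) = f w.
Proof.
move=> fL fS; exists (sym_ext f); first exact: sym_ext_linear.
exact: sym_ext_mon.
Qed.

Inductive hword : int -> seq V -> Prop :=
| hword_nil : hword 0 [::]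
| hword_cons d e x w : homog d x -> hword e w -> hword (d + e) (x :: w).

Inductive sym_in (e : int) : sym_car -> Prop :=
| sym_in0 : sym_in e 0
| sym_in_cons a w y : hword e w -> sym_in e y -> sym_in e (a *: sym_mon w + y).

Lemma sym_in_lin e a x y :
  sym_in e x -> sym_in e y -> sym_in e (a *: x + y).
Proof.
move=> hx hy; elim: hx => [|b w z hw _ IH]; first by rewrite scaler0 add0r.
by rewrite scalerDr scalerA -addrA; apply: sym_in_cons.
Qed.

Lemma hword_cat d e u w : hword d u -> hword e w -> hword (d + e) (u ++ w).
Proof.
elim=> [|a b x v hx _ IH] hw; first by rewrite add0r.
by rewrite -addrA; apply: hword_cons => //; apply: IH.
Qed.

Lemma sym_mon0 u w : sym_mon (u ++ 0 :: w) = 0.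
Proof.
by have := sym_mon_multilinear u w (-1) 0 0; rewrite scaler0 add0r scaleN1r addNr.
Qed.

Lemma sym_mon_sum (s : seq V) u w :
  sym_mon (u ++ (\sum_(x <- s) x) :: w) = \sum_(x <- s) sym_mon (u ++ x :: w).
Proof.
elim: s => [|x s IH]; first by rewrite !big_nil sym_mon0.
by rewrite !big_cons -IH -[x in LHS]scale1r sym_mon_multilinear scale1r.
Qed.

Definition sym_spanned (x : sym_car) : Prop := exists2 s : seq sym_car,
  (forall y, y \in s -> exists d, sym_in d y) & x = \sum_(y <- s) y.

Lemma sym_spanned_lin a x y :
  sym_spanned x -> sym_spanned y -> sym_spanned (a *: x + y).
Proof.
move=> [s hs ->] [t ht ->]; exists ([seq a *: z | z <- s] ++ t) => [z|].
  rewrite mem_cat => /orP[/mapP[z' /hs[d hd] ->]|/ht //].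
  by exists d; rewrite -[_ *: _]addr0; apply: sym_in_lin => //; apply: sym_in0.
by rewrite big_cat /= big_map scaler_sumr.
Qed.

Lemma sym_spanned_sum I (s : seq I) (f : I -> sym_car) :
  (forall i, sym_spanned (f i)) -> sym_spanned (\sum_(i <- s) f i).
Proof.
move=> hf; elim: s => [|i s IH]; first by exists [::]; rewrite ?big_nil.
by rewrite big_cons -[f i]scale1r; apply: sym_spanned_lin.
Qed.

Lemma sym_spanned_mon d u w : hword d u -> sym_spanned (sym_mon (u ++ w)).
Proof.
elim: w d u => [|v w IH] d u hu.
  exists [:: sym_mon u]; last by rewrite cats0 big_seq1.
  move=> y; rewrite inE => /eqP->; exists d.
  rewrite -[sym_mon u]scale1r -[_ *: _]addr0.
  by apply: sym_in_cons => //; apply: sym_in0.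
have [s hs ->] := gv_span v; rewrite sym_mon_sum big_seq.
elim/big_rec: _ => [|x y /hs[e hx] hy]; first by exists [::]; rewrite ?big_nil.
rewrite -[sym_mon _]scale1r; apply: sym_spanned_lin => //.
rewrite -cat_rcons; apply: (IH (d + (e + 0))); rewrite -cats1.
by apply: hword_cat => //; apply: hword_cons => //; apply: hword_nil.
Qed.

Lemma sym_span (x : sym_car) : sym_spanned x.
Proof.
rewrite -[x]sym_repr [repr x]monalgE linear_sum /=.
apply: sym_spanned_sum => w; rewrite -[sym_pi _]addr0.
have -> : << (repr x)@_w *g w >> = (repr x)@_w *: fword w :> freeA.
  by apply/malgP => v; rewrite mcoeffZ !mcoeffU mulrnAr mulr1.
rewrite linearZ; apply: sym_spanned_lin; last by exists [::]; rewrite ?big_nil.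
exact: (@sym_spanned_mon 0 [::] w hword_nil).
Qed.

Let supp (x : V) : seq int := projT1 (cid (decomp_ex x)).
Let comp (x : V) : int -> V := projT1 (cid (projT2 (cid (decomp_ex x)))).

Let compP x : decomp (supp x) (comp x) x.
Proof. exact: (projT2 (cid (projT2 (cid (decomp_ex x))))). Qed.

Let comp_homog x d : homog d (comp x d).
Proof. by have [_ ] := compP x. Qed.

Let comp_lin a x y d : comp (a *: x + y) d = a *: comp x d + comp y d.
Proof.
have [us hu su ex] := compP x; have [ut ht st ey] := compP y.
pose r := undup (supp x ++ supp y).
have sr : {subset supp x <= r} by move=> n ns; rewrite mem_undup mem_cat ns.
have tr : {subset supp y <= r}.
  by move=> n ns; rewrite mem_undup mem_cat ns orbT.
suff /(decomp_uniq (compP _))-> :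
  decomp r (fun n => a *: comp x n + comp y n) (a *: x + y) by [].
split; first exact: undup_uniq.
- by move=> n; apply: sf_lin; [apply: hu|apply: ht].
- move=> n nr; have ns : n \notin supp x by apply: (contra _ nr) => /sr.
  have nt : n \notin supp y by apply: (contra _ nr) => /tr.
  by rewrite su // st // scaler0 addr0.
have ur : uniq r by apply: undup_uniq.
have Ex : \sum_(d <- r) comp x d = x := etrans (sum_supp us ur su sr) (esym ex).
have Ey : \sum_(d <- r) comp y d = y := etrans (sum_supp ut ur st tr) (esym ey).
by rewrite big_split -scaler_sumr /= Ex Ey.
Qed.

Let comp_id x d : homog d x -> comp x = fun e => if e == d then x else 0.
Proof.
move=> hx; apply: (decomp_uniq (compP x) (t := [:: d])); split=> //.
- by move=> e; case: eqP => [->|_] //; apply: sf_0.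
- by move=> e; rewrite inE => /negPf->.
- by rewrite big_seq1 eqxx.
Qed.

Let proj_sum (x : V) (f : int -> sym_car) s : uniq s -> {subset supp x <= s} ->
  (forall d, comp x d = 0 -> f d = 0) ->
  \sum_(d <- supp x) f d = \sum_(d <- s) f d.
Proof.
move=> us sx f0; have [ux _ sux _] := compP x.
by rewrite (sum_supp (s := supp x) (t := s)) // => d /sux/f0.
Qed.

(* The component of degree [e + deg u] of the product of [u] and [w], for a
   word [u] of homogeneous letters. *)
Fixpoint sym_proj_rec (u : seq V) (e : int) (w : seq V) : sym_car :=
  if w is x :: w' then
    \sum_(d <- supp x) sym_proj_rec (rcons u (comp x d)) (e - d) w'
  else if e == 0 then sym_mon u else 0.

Let recE u e x w : sym_proj_rec u e (x :: w) =
  \sum_(d <- supp x) sym_proj_rec (rcons u (comp x d)) (e - d) w.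
Proof. by []. Qed.

Let rec_linl e w : multilinear_on (fun u => sym_proj_rec u e w).
Proof.
elim: w e => [|z w IH] e u v a x y.
  rewrite /=; case: ifP => _; last by rewrite scaler0 addr0.
  exact: sym_mon_multilinear.
rewrite !recE scaler_sumr -big_split; apply: eq_bigr => d _ /=.
by rewrite !rcons_cat !rcons_cons IH.
Qed.

Let rec_symml e w : graded_symmetric (fun u => sym_proj_rec u e w).
Proof.
elim: w e => [|z w IH] e u v c d x y hx hy.
  rewrite /=; case: ifP => _; last by rewrite scaler0.
  exact: sym_mon_symmetric.
rewrite !recE scaler_sumr; apply: eq_bigr => n _ /=.
by rewrite !rcons_cat !rcons_cons (IH _ _ _ _ _ _ _ hx hy).
Qed.

Let rec0 u v e w : sym_proj_rec (u ++ 0 :: v) e w = 0.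
Proof.
have := rec_linl e w u v (-1) 0 0.
by rewrite scaler0 add0r scaleN1r addNr.
Qed.

Let rec0r u e w : sym_proj_rec (rcons u 0) e w = 0.
Proof. by rewrite -cats1 rec0. Qed.

Let rec_homog u e d x w : homog d x ->
  sym_proj_rec u e (x :: w) = sym_proj_rec (rcons u x) (e - d) w.
Proof.
move=> hx; rewrite recE (comp_id hx).
rewrite (@proj_sum _ _ (undup (d :: supp x))) ?undup_uniq //.
- rewrite (@sum_supp _ [:: d]) ?undup_uniq ?big_seq1 ?eqxx //.
    by move=> n; rewrite inE => /negPf->; apply: rec0r.
  by move=> n; rewrite inE mem_undup inE => ->.
- by move=> n ns; rewrite mem_undup inE ns orbT.
- by move=> n; rewrite (comp_id hx) => ->; apply: rec0r.
Qed.

Let rec_linr u e : multilinear_on (sym_proj_rec u e).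
Proof.
move=> w1; elim: w1 u e => [|z w1 IH] u e w2 a x y; last first.
  by rewrite /= scaler_sumr -big_split; apply: eq_bigr => d _; apply: IH.
pose s := undup (supp (a *: x + y) ++ supp x ++ supp y).
rewrite [_ ++ _]/= !recE.
have s1 : {subset supp (a *: x + y) <= s}.
  by move=> n ns; rewrite mem_undup mem_cat ns.
have s2 : {subset supp x <= s}.
  by move=> n ns; rewrite mem_undup !mem_cat ns orbT.
have s3 : {subset supp y <= s}.
  by move=> n ns; rewrite mem_undup !mem_cat ns !orbT.
have us : uniq s by apply: undup_uniq.
have f0 (v : V) d : comp v d = 0 ->
  sym_proj_rec (rcons u (comp v d)) (e - d) w2 = 0 by move=> ->; apply: rec0r.
rewrite (proj_sum us s1 (f0 _)) (proj_sum us s2 (f0 _)) (proj_sum us s3 (f0 _)).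
rewrite scaler_sumr -big_split; apply: eq_bigr => d _ /=.
by rewrite comp_lin -!cats1; apply: rec_linl.
Qed.

Let rec_symmr u e : graded_symmetric (sym_proj_rec u e).
Proof.
move=> w1; elim: w1 u e => [|z w1 IH] u e w2 c d x y hx hy; last first.
  rewrite /= scaler_sumr; apply: eq_bigr => n _.
  exact: IH.
rewrite [_ ++ _]/= (rec_homog _ _ _ hx) (rec_homog _ _ _ hy).
rewrite [_ ++ _]/= (rec_homog _ _ _ hy) (rec_homog _ _ _ hx).
rewrite -!cats1 -!catA /= (addrAC e).
exact: (rec_symml _ _ u [::] hx hy).
Qed.

Lemma sym_in_indep (s : seq int) (f : int -> sym_car) : uniq s ->
  (forall d, sym_in d (f d)) -> \sum_(d <- s) f d = 0 ->
  forall d, d \in s -> f d = 0.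
Proof.
move=> us hf f0 d ds.
have [P lP PE] := sym_lift (@rec_linr [::] d) (@rec_symmr [::] d).
pose PP : {linear sym_car -> sym_car} :=
  HB.pack P (GRing.isLinear.Build K sym_car sym_car _ P lP).
have Ph e z : sym_in e z -> PP z = if d == e then z else 0.
  elim=> {z} [|a w y hw _ IH]; first by rewrite linear0 if_same.
  rewrite linearP IH /= PE.
  suff -> : sym_proj_rec [::] d w = if d == e then sym_mon w else 0.
    by case: ifP => _; rewrite // scaler0 addr0.
  suff recP u k : sym_proj_rec u k w = if k == e then sym_mon (u ++ w) else 0.
    exact: recP.
  elim: hw u k => {e w IH y} [|n e x w hx _ IH] u k; first by rewrite cats0.
  by rewrite (rec_homog _ _ _ hx) IH cat_rcons subr_eq addrC.
have := congr1 PP f0; rewrite linear_sum linear0 (bigD1_seq d) //.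
rewrite (Ph _ _ (hf d)) eqxx big1 => [|e]; first by rewrite /= addr0.
by rewrite (Ph _ _ (hf e)) eq_sym => /negPf->.
Qed.

Definition sym_fam := Subfam sym_in0 sym_in_lin sym_in_indep.

Definition Sym : gvs K := @Gvs K sym_car sym_fam sym_span.

End Sym.

Record sgLa (K : fieldType) := SgLa {
  sg_gvs :> gvs K;
  sg_br : sg_gvs -> sg_gvs -> sg_gvs;
  sg_linl : forall y, linear (sg_br^~ y);
  sg_linr : forall x, linear (sg_br x);
  sg_deg : forall d e x y, homog d x -> homog e y ->
    homog (d + e + 1) (sg_br x y);
  sg_sym : forall d e x y, homog d x -> homog e y ->
    sg_br x y = (-1) ^ (d * e) *: sg_br y x;
  sg_jacobi : forall d e f x y z, homog d x -> homog e y -> homog f z ->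
    sg_br x (sg_br y z) = (-1) ^ (d + 1) *: sg_br (sg_br x y) z
                        + (-1) ^ ((d + 1) * (e + 1)) *: sg_br y (sg_br x z)
}.

Section Derivations.
Context (K : fieldType) (h : sgLa K).
Local Notation br := (@sg_br K h).

Definition der_in (n : int) (D : h -> h) : Prop :=
  hom_in (U := h) (W := h) n D /\
  forall d e x y, homog d x -> homog e y ->
    D (br x y) = (-1) ^ n *: br (D x) y + (-1) ^ (n * (d + 1)) *: br x (D y).

Lemma der_in0 n : der_in n 0.
Proof.
split=> [|d e x y _ _]; first exact: hom_in0.
have lin0 (f : h -> h) : linear f -> f 0 = 0.
  by move=> /(_ (-1) 0 0); rewrite scaler0 addr0 scaleN1r addNr.
have -> : br ((0 : h -> h) x) y = 0 by apply: (lin0 (br^~ y)); apply: sg_linl.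
have -> : br x ((0 : h -> h) y) = 0 by apply: (lin0 (br x)); apply: sg_linr.
by rewrite !scaler0 addr0.
Qed.

Lemma der_in_lin n a D E : der_in n D -> der_in n E -> der_in n (a *: D + E).
Proof.
move=> [hD dD] [hE dE]; split=> [|d e x y hx hy]; first exact: hom_in_lin.
have DE z : (a *: D + E) z = a *: D z + E z by [].
have ll := @sg_linl K h y a (D x) (E x); have lr := @sg_linr K h x a (D y) (E y).
rewrite !DE (dD _ _ _ _ hx hy) (dE _ _ _ _ hx hy) lr {}[br (_ + _) y]ll.
by rewrite !scalerDr !scalerA !(mulrC a) addrACA.
Qed.

Lemma der_in_indep (s : seq int) (u : int -> h -> h) : uniq s ->
  (forall d, der_in d (u d)) -> \sum_(d <- s) u d = 0 ->
  forall d, d \in s -> u d = 0.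
Proof.
move=> us hu; apply: (hom_in_indep (U := h) (W := h) us) => d.
by case: (hu d).
Qed.

Definition der_fam := Subfam der_in0 der_in_lin der_in_indep.

Definition Der : gvs K := dsum der_fam.

Definition gcomm (m n : int) (D E : h -> h) : h -> h :=
  fun y => D (E y) - (-1) ^ (m * n) *: E (D y).

End Derivations.

(* For v_i of degree [d i], this is the sign epsilon such that in S(V)
   v_1 ... v_p = epsilon v_s(1) ... v_s(p): each inversion of [s] contributes
   the sign of exchanging the two letters involved. *)
Definition koszul (K : fieldType) (p : nat) (d : 'I_p -> int) (s : 'S_p) : K :=
  \prod_(i < p) \prod_(j < p | (i < j)%N && (s j < s i)%N)
    (-1) ^ (d (s i) * d (s j)).

(* Shuffles with consecutive blocks of sizes [bs]. There are none unless the
   sizes add up to [p]; in the sums below, this makes the set empty when a size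
   is -1, since natural subtraction truncates it to 0. *)
Definition shuffles (p : nat) (bs : seq nat) : {set 'S_p} :=
  [set s : 'S_p | (sumn bs == p) &&
     [forall i : 'I_p, forall j : 'I_p,
        ((i < j)%N && (reshape_index bs i == reshape_index bs j)) ==>
        (s i < s j)%N]].

Definition letters (T : Type) (p : nat) (v : 'I_p -> T) : seq T :=
  [seq v i | i <- enum 'I_p].

Definition permuted (T : Type) (p : nat) (v : 'I_p -> T) (s : 'S_p) : seq T :=
  letters (fun i => v (s i)).

Definition omit2 (T : Type) (p : nat) (v : 'I_p -> T) (i j : 'I_p) : seq T :=
  [seq v k | k <- enum 'I_p & (k != i) && (k != j)].

(* v_i (v_1 + ... + v_{i-1}) + v_j (v_1 + ... + v_{j-1}) + v_i v_j *)
Definition front_exp (p : nat) (d : 'I_p -> int) (i j : 'I_p) : int :=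
  d i * (\sum_(k < p | (k < i)%N) d k) + d j * (\sum_(k < p | (k < j)%N) d k)
  + d i * d j.

(* Degree of the first [n] letters, resp. of the letters after the first [n],
   of a permuted word. *)
Definition deg_take (p : nat) (d : 'I_p -> int) (s : 'S_p) (n : nat) : int :=
  \sum_(i < p | (i < n)%N) d (s i).
Definition deg_drop (p : nat) (d : 'I_p -> int) (s : 'S_p) (n : nat) : int :=
  \sum_(i < p | (n <= i)%N) d (s i).

Definition homog_fam (K : fieldType) (V : gvs K) (p : nat)
  (v : 'I_p -> V) (d : 'I_p -> int) : Prop := forall i, homog (d i) (v i).

Record is_dgla (K : fieldType) (g : gvs K) (br : g -> g -> g) (D : g -> g) :
  Prop := IsDgla {
  dgla_linl : forall y, linear (br^~ y);
  dgla_linr : forall x, linear (br x);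
  dgla_deg : forall d e x y, homog d x -> homog e y -> homog (d + e) (br x y);
  dgla_anti : forall d e x y, homog d x -> homog e y ->
    br x y = - ((-1) ^ (d * e) *: br y x);
  dgla_jacobi : forall d e f x y z, homog d x -> homog e y -> homog f z ->
    br x (br y z) = br (br x y) z + (-1) ^ (d * e) *: br y (br x z);
  dgla_dlin : linear D;
  dgla_ddeg : forall d x, homog d x -> homog (d + 1) (D x);
  dgla_dd : forall x, D (D x) = 0;
  dgla_leibniz : forall d e x y, homog d x -> homog e y ->
    D (br x y) = br (D x) y + (-1) ^ d *: br x (D y)
}.

Definition maurer_cartan (K : fieldType) (g : gvs K) (br : g -> g -> g)
  (D : g -> g) (x : g) : Prop :=
  homog 1 x /\ D x + 2%:R^-1 *: br x x = 0.

Section Complex.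
Context (K : fieldType) (h : sgLa K).

Definition Cbar : gvs K := Hom (Sym h) (desusp (Der h)).

(* [capp f [:: v1; ...; vp]] is f_p(v_1, ..., v_p). *)
Definition capp (f : Cbar) (w : seq h) : desusp (Der h) :=
  dsum_val f (sym_mon w).

Definition sact (x : desusp (Der h)) : h -> h := dsum_val (smap x).

Definition is_partial (D : Cbar -> Cbar) : Prop :=
  linear D /\
  forall n (b : Cbar), homog n b ->
    homog (n + 1) (D b) /\
    forall p (v : 'I_p -> h) (d : 'I_p -> int), homog_fam v d ->
      capp (D b) (letters v) =
      \sum_(i < p) \sum_(j < p | (i < j)%N)
        (-1) ^ (n + 1 + front_exp d i j) *:
        capp b (sg_br (v i) (v j) :: omit2 v i j).

(* The right-hand side of the formula for [a, b]^c_p (v_1, ..., v_p), after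
   applying [s] and evaluating the resulting derivation at [y]. *)
Definition bracket_rhs (m n : int) (a b : Cbar) (p : nat)
    (v : 'I_p -> h) (d : 'I_p -> int) (y : h) : h :=
  - (\sum_(k < p.+2 | (0 < k)%N) \sum_(l < p.+2 | (k + l == p.+1)%N)
      \sum_(s in shuffles p [:: l : nat; 1; p - l - 1]%N)
        let w := permuted v s in
        koszul K d s *:
        sact (capp a (sact (capp b (take l w)) (nth 0 w l) :: drop l.+1 w)) y)
  + (-1) ^ ((m + 1) * (n + 1)) *:
    (\sum_(k < p.+2 | (0 < k)%N) \sum_(l < p.+2 | (k + l == p.+1)%N)
      \sum_(s in shuffles p [:: k - 1; 1; p - k]%N)
        let w := permuted v s in
        koszul K d s *:
        sact (capp b (sact (capp a (take k.-1 w)) (nth 0 w k.-1) :: drop k w)) y)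
  - (\sum_(k < p.+2 | (0 < k)%N) \sum_(l < p.+2 | (k + l == p.+1)%N)
      \sum_(s in shuffles p [:: k - 1; l : nat]%N)
        let w := permuted v s in
        ((-1) ^ ((n + 1) * deg_take d s k.-1) * koszul K d s) *:
        gcomm (m + 1 + deg_take d s k.-1) (n + 1 + deg_drop d s k.-1)
          (sact (capp a (take k.-1 w))) (sact (capp b (drop k.-1 w))) y).

Definition is_bracket (br : Cbar -> Cbar -> Cbar) : Prop :=
  [/\ forall b, linear (br^~ b), forall a, linear (br a) &
  forall m n (a b : Cbar), homog m a -> homog n b ->
    homog (m + n + 1) (br a b) /\
    forall p (v : 'I_p -> h) (d : 'I_p -> int), homog_fam v d ->
    forall y, sact (capp (br a b) (letters v)) y =
              bracket_rhs m n a b v d y].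

End Complex.

(* The family of multilinear maps theta_k, k >= 1, is encoded as a function
   with [theta [:: x1; ...; x(k-1)] xk = theta_k(x1, ..., xk)]. *)
Section PostLie.
Context (K : fieldType) (g : sgLa K) (theta : seq g -> g -> g).
Local Notation br := (@sg_br K g).

Definition theta_linear : Prop :=
  (forall y, multilinear_on (theta^~ y)) /\ forall w, linear (theta w).

Definition theta_degree : Prop := forall e d w y,
  hword e w -> homog d y -> homog (e + d + 1) (theta w y).

Definition theta_sym : Prop :=
  forall p (x : 'I_p -> g) (d : 'I_p -> int), homog_fam x d ->
  forall f y, homog f y -> forall s : 'S_p,
    theta (permuted x s) y = koszul K d s *: theta (letters x) y.

Definition theta_deriv : Prop := forall c d e w y z,
  hword c w -> homog d y -> homog e z ->
  theta w (br y z) = (-1) ^ (c + 1) *: br (theta w y) z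
                   + (-1) ^ ((c + 1) * (d + 1)) *: br y (theta w z).

(* Here x_1, ..., x_{n-1} is [x], with n = p + 1, and x_n is [y]. *)
Definition theta_homotopy : Prop :=
  forall p (x : 'I_p -> g) (d : 'I_p -> int), homog_fam x d ->
  forall f y, homog f y ->
  \sum_(i < p.+2 | (1 <= i)%N) \sum_(j < p.+2 | (i + j == p.+2)%N && (2 <= j)%N)
    \sum_(s in shuffles p [:: i - 1; 1; j - 2]%N)
      (let w := permuted x s in
       koszul K d s *:
       theta (theta (take i.-1 w) (nth 0 w i.-1) :: drop i w) y)
  + \sum_(i < p.+2 | (1 <= i)%N)
    \sum_(j < p.+2 | (i + j == p.+2)%N && (1 <= j)%N)
    \sum_(s in shuffles p [:: j - 1; i - 1]%N)
      (let w := permuted x s in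
       ((-1) ^ (deg_take d s j.-1) * koszul K d s) *:
       theta (take j.-1 w) (theta (drop j.-1 w) y))
  = \sum_(i < p) \sum_(j < p | (i < j)%N)
      (-1) ^ (front_exp d i j + 1) *: theta (br (x i) (x j) :: omit2 x i j) y.

Definition operator_homotopy_postLie : Prop :=
  [/\ theta_linear, theta_degree, theta_sym, theta_deriv & theta_homotopy].

End PostLie.

(* theta_k(v_1, ..., v_k) = (s L_{k-1}(v_1, ..., v_{k-1})) v_k *)
Definition theta_of (K : fieldType) (h : sgLa K) (L : Cbar h) :
  seq h -> h -> h := fun w y => sact (capp L w) y.

(* Main.v *)
Require Import Defs.
From mathcomp Require Import all_boot all_order all_algebra perm.
From mathcomp Require Import boolp functions zify ring.

Set Implicit Arguments.
Unset Strict Implicit.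
Unset Printing Implicit Defensive.

Import GRing.Theory.
Local Open Scope ring_scope.

(** A cochain is a formal function on [h] with values in Der(h), that is, a
    section of the Lie algebroid of the linear action of Der(h) on [h], and the
    bracket of the theorem is, up to a global sign, the bracket of this
    algebroid.  In detail, an operator-valued function B on S(h) generates the
    linear vector field v_1 ... v_p |-> sum +/- B(v_I) v_j ([vfield]), hence a
    coderivation of S(h) ([coder]), and it acts on functions G on S(h) whose
    values are linear maps out of [h] by
      act B G = (G composed with this coderivation) + (convolution of G and B).
    The bracket is [a, b]^c = - (act b a -/+ act a b), and the differential of b
    is, up to sign, the composite of b with the coderivation Q of S(h) which
    encodes the bracket of [h].

    Two commutation rules carry the proof.  Both compare operators on
    functions, which spares the expansion of identities in three cochains.
    - [act_comm]: the graded commutator of act C and act B is the action of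
      act C B -/+ act B C.  Indeed act C (act B G) and act (act C B) G differ by
      terms in which B and C act on different letters or on different factors,
      and those terms are symmetric in B and C ([act_act], [act_symC]).  In
      other words (B, C) |-> act C B is a graded pre-Lie product, and the Jacobi
      identity of its commutator follows.
    - [coder_quad_act]: the graded commutator of Q and act B is the action of
      B o Q.  This uses that B takes its values in derivations, and it is the
      Leibniz rule.  That the differential squares to zero is Q^2 = 0
      ([coder_quad_quad]), which is the Jacobi identity of [h].

    For L of degree 0 both halves of [L, L]^c are equal, so as 2 is invertible
    the Maurer-Cartan equation reads act L L = - L o Q ([maurer_cartanE]).
    Evaluated at a last argument, the two summands of act L L are the two sums
    on the left of the homotopy identity of a post-Lie structure, and - L o Q is
    its right-hand side ([homotopyE]).

    All this takes place on words of letters tagged with their degrees.  There,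
    the coproduct of S(h) is the operation [unsh w F], the signed sum of F over
    all the ways of splitting the word w into two subwords; coassociativity and
    cocommutativity are [unshA] and [unshC].  Sums over shuffles turn into
    such sums by induction on the length of the word, removing the first letter
    ([shuffle_sum3]).  Conversely, a function of tagged words which is
    multilinear, graded symmetric and has derivations of the right degrees as
    values comes from a unique cochain ([cochain_exists], [ev_inj]).  This yields the existence of
    the differential and of the bracket, which are first defined on homogeneous
    cochains, and the cochain attached to a post-Lie structure. *)

(** * Signs and parities *)

Section Sign.
Context (K : fieldType).
Implicit Types (a b : int).

Definition sg (a : int) : K := (-1) ^ a.
Definition oddz (a : int) : bool := odd `|a|%N.

Lemma sgD a b : sg (a + b) = sg a * sg b.
Proof. by rewrite /sg expfzDr // oppr_eq0 oner_eq0. Qed.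

Lemma sgE a : sg a = (-1) ^+ oddz a.
Proof.
rewrite /sg /oddz; case: a => n; first by rewrite /= -exprnP signr_odd.
rewrite NegzE -invr_expz -exprnP -[_ ^+ n.+1]signr_odd /=.
by case: (odd n); rewrite /= ?invr1 ?invrN1 ?expr0 ?expr1 ?invr1 ?invrN1.
Qed.

Lemma oddzD a b : oddz (a + b) = oddz a (+) oddz b.
Proof. rewrite /oddz; lia. Qed.

Lemma oddzM a b : oddz (a * b) = oddz a && oddz b.
Proof. by rewrite /oddz abszM oddM. Qed.

Lemma oddzN a : oddz (- a) = oddz a.
Proof. by rewrite /oddz abszN. Qed.

Lemma oddz1 : oddz 1 = true. Proof. by []. Qed.
Lemma oddz0 : oddz 0 = false. Proof. by []. Qed.

Definition oddzE := (oddzD, oddzM, oddzN, oddz1, oddz0).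

Lemma sg_eq a b : oddz a = oddz b -> sg a = sg b.
Proof. by rewrite !sgE => ->. Qed.

Lemma sg0 : sg 0 = 1. Proof. by []. Qed.
Lemma sg1 : sg 1 = -1. Proof. by []. Qed.

Lemma sgN (V : lmodType K) a (x : V) : - (sg a *: x) = sg (a + 1) *: x.
Proof. by rewrite sgD sg1 mulrN1 scaleNr. Qed.

End Sign.

(** The exponents of all signs are polynomials in degrees, and a sign only
    depends on the parity of its exponent: an equality of signs is therefore
    settled by trying all the parities of the degrees that occur. *)
Ltac sgn := rewrite ?scalerA -?sgD; congr (_ *: _); apply: sg_eq; rewrite ?oddzE;
  repeat match goal with |- context [oddz ?x] => case: (oddz x) end; reflexivity.

(** * Unshuffle sums: the coproduct of a word *)

Lemma lin0 (K : fieldType) (M N : lmodType K) (f : M -> N) : linear f -> f 0 = 0.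
Proof. by move=> lf; have := lf (-1) 0 0; rewrite scaleN1r addNr scaleN1r addNr. Qed.

Lemma linZ (K : fieldType) (M N : lmodType K) (f : M -> N) : linear f ->
  forall k x, f (k *: x) = k *: f x.
Proof. by move=> lf k x; rewrite -[k *: x]addr0 lf (lin0 lf) addr0. Qed.

Lemma linD (K : fieldType) (M N : lmodType K) (f : M -> N) : linear f ->
  forall x y, f (x + y) = f x + f y.
Proof. by move=> lf x y; rewrite -[x]scale1r lf !scale1r. Qed.

Section Unshuffle.
Context (K : fieldType) (V : gvs K).
Local Notation letter := (int * V)%type.
Local Notation word := (seq (int * V)).
Local Notation sg := (sg K).
Implicit Types (a b c u w : word) (x y z : letter).

(** A vector does not determine its degree, as zero has all of them; letters
    are tagged with degrees so that signs can be computed from a word. *)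
Definition wdeg w : int := \sum_(l <- w) l.1.

Lemma wdeg0 : wdeg [::] = 0. Proof. exact: big_nil. Qed.
Lemma wdegS x w : wdeg (x :: w) = x.1 + wdeg w. Proof. exact: big_cons. Qed.
Lemma wdeg_cat u w : wdeg (u ++ w) = wdeg u + wdeg w.
Proof. exact: big_cat. Qed.

Definition hletters w : Prop := forall x, x \in w -> homog x.1 x.2.

Lemma hletters_cons x w : homog x.1 x.2 -> hletters w -> hletters (x :: w).
Proof. by move=> hx hw y; rewrite inE => /predU1P[->|/hw]. Qed.

Lemma hletters_consP x w : hletters (x :: w) -> homog x.1 x.2 /\ hletters w.
Proof.
by move=> h; split=> [|y yw]; apply: h; rewrite inE ?eqxx ?yw ?orbT.
Qed.

Lemma hletters_hword w : hletters w -> hword (wdeg w) (map snd w).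
Proof.
elim: w => [|x w IH] hw; first by rewrite wdeg0; apply: hword_nil.
have [hx h] := hletters_consP hw.
by rewrite wdegS; apply: hword_cons => //; apply: IH.
Qed.

Lemma hword_hletters e (v : seq V) : hword e v ->
  exists w, [/\ hletters w, wdeg w = e & map snd w = v].
Proof.
elim=> {e v} [|d e x v hx _ [w [hw <- <-]]]; first by exists [::]; rewrite wdeg0.
by exists ((d, x) :: w); rewrite wdegS; split=> //; apply: hletters_cons.
Qed.

(** The pairing of [F] with the coproduct of the word [w] in S(V): the first
    letter joins one of the two factors, and acquires a Koszul sign when it
    has to cross [a] to reach the second one. Taking [F] as an argument
    dispenses with tensor products. *)
Fixpoint unsh (M : lmodType K) w (F : word -> word -> M) : M :=
  if w is x :: w' then
    unsh w' (fun a b => F (x :: a) b)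
    + unsh w' (fun a b => sg (x.1 * wdeg a) *: F a (x :: b))
  else F [::] [::].

Lemma unshS (M : lmodType K) x w (F : word -> word -> M) : unsh (x :: w) F =
  unsh w (fun a b => F (x :: a) b)
  + unsh w (fun a b => sg (x.1 * wdeg a) *: F a (x :: b)).
Proof. by []. Qed.

Section Basic.
Context (M : lmodType K).
Implicit Types (F G : word -> word -> M).

Lemma eq_unsh_hom w F G : hletters w ->
  (forall a b, hletters a -> hletters b -> wdeg w = wdeg a + wdeg b ->
     F a b = G a b) ->
  unsh w F = unsh w G.
Proof.
elim: w F G => [|x w IH] F G hw FG /=; first by apply: FG; rewrite ?wdeg0.
have [hx h] := hletters_consP hw.
congr (_ + _); apply: IH => // a b ha hb wE.
  by apply: FG; rewrite ?wdegS ?wE ?addrA //; apply: hletters_cons.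
congr (_ *: _); apply: FG => //; first exact: hletters_cons.
by rewrite !wdegS wE addrCA.
Qed.

Lemma eq_unsh_size w F G :
  (forall a b, wdeg w = wdeg a + wdeg b -> (size w = size a + size b)%N ->
     F a b = G a b) ->
  unsh w F = unsh w G.
Proof.
elim: w F G => [|x w IH] F G FG /=; first by apply: FG; rewrite ?wdeg0.
congr (_ + _); apply: IH => // a b wE sE.
  by apply: FG; rewrite ?wdegS ?wE ?addrA //= sE.
congr (_ *: _); apply: FG => //; last by rewrite /= sE addnS.
by rewrite !wdegS wE addrCA.
Qed.

Lemma eq_unsh w F G :
  (forall a b, wdeg w = wdeg a + wdeg b -> F a b = G a b) -> unsh w F = unsh w G.
Proof. by move=> FG; apply: eq_unsh_size => a b + _; apply: FG. Qed.

Lemma unshD w F G : unsh w (fun a b => F a b + G a b) = unsh w F + unsh w G.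
Proof.
elim: w F G => [|x w IH] F G //=; rewrite IH addrACA -IH; congr (_ + _).
by rewrite -IH; apply: eq_unsh => a b _; rewrite scalerDr.
Qed.

Lemma unshZ w k F : unsh w (fun a b => k *: F a b) = k *: unsh w F.
Proof.
elim: w F => [|x w IH] F //=; rewrite scalerDr -!IH; congr (_ + _).
by apply: eq_unsh => a b _; rewrite !scalerA mulrC.
Qed.

Lemma unsh0 w : unsh w (fun _ _ => 0 : M) = 0.
Proof.
rewrite -[RHS](scale0r (unsh w (fun _ _ => 0))) -unshZ.
by apply: eq_unsh => *; rewrite scale0r.
Qed.

Lemma unshN w F : unsh w (fun a b => - F a b) = - unsh w F.
Proof. by rewrite -scaleN1r -unshZ; apply: eq_unsh => *; rewrite scaleN1r. Qed.

Lemma unshB w F G : unsh w (fun a b => F a b - G a b) = unsh w F - unsh w G.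
Proof. by rewrite unshD unshN. Qed.

Lemma unsh_sum I (r : seq I) (P : pred I) w (F : I -> word -> word -> M) :
  unsh w (fun a b => \sum_(i <- r | P i) F i a b) =
  \sum_(i <- r | P i) unsh w (F i).
Proof.
elim: r => [|i r IH].
  by rewrite big_nil -[RHS](unsh0 w); apply: eq_unsh => *; rewrite big_nil.
rewrite big_cons -IH; case Pi: (P i).
  by rewrite -unshD; apply: eq_unsh => *; rewrite big_cons Pi.
by apply: eq_unsh => *; rewrite big_cons Pi.
Qed.

End Basic.

Lemma unsh_lin (M N : lmodType K) (f : M -> N) w (F : word -> word -> M) :
  linear f -> f (unsh w F) = unsh w (fun a b => f (F a b)).
Proof.
move=> lf; elim: w F => [|x w IH] F //=; rewrite (linD lf) !IH; congr (_ + _).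
by apply: eq_unsh => *; rewrite (linZ lf).
Qed.

Lemma unsh_fct (M : lmodType K) T w (F : word -> word -> T -> M) t :
  unsh w F t = unsh w (fun a b => F a b t).
Proof. exact: (@unsh_lin _ _ (fun f => f t)). Qed.

Section Coalgebra.
Context (M : lmodType K).

(** Coassociativity: both sides distribute the letters over three factors, a
    letter crossing exactly the letters already placed in earlier factors. *)
Lemma unshA w (F : word -> word -> word -> M) :
  unsh w (fun a b => unsh a (fun c d => F c d b)) =
  unsh w (fun a b => unsh b (fun c d => F a c d)).
Proof.
elim: w F => [|x w IH] F //=; rewrite unshD IH -addrA; congr (_ + _).
transitivity (
  unsh w (fun a b => unsh b (fun c d => sg (x.1 * wdeg a) *: F a (x :: c) d)) +
  unsh w (fun a b => unsh b (fun c d =>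
    sg (x.1 * (wdeg a + wdeg c)) *: F a c (x :: d)))).
  rewrite -2!IH; congr (_ + _); apply: eq_unsh => a b _.
  by rewrite -unshZ; apply: eq_unsh => c d ->.
rewrite -unshD; apply: eq_unsh => a b _; rewrite scalerDr -!unshZ.
by congr (_ + _); apply: eq_unsh => c d _; rewrite scalerA -sgD mulrDr.
Qed.

(** Graded cocommutativity. *)
Lemma unshC w (F : word -> word -> M) :
  unsh w F = unsh w (fun a b => sg (wdeg a * wdeg b) *: F b a).
Proof.
elim: w F => [|x w IH] F /=; first by rewrite wdeg0 mul0r sg0 scale1r.
rewrite addrC; congr (_ + _); rewrite IH; apply: eq_unsh => a b _.
  by rewrite wdegS; sgn.
by rewrite wdegS; sgn.
Qed.

Lemma unshCA w (F : word -> word -> word -> M) :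
  unsh w (fun a b => unsh b (fun c d => F a c d)) =
  unsh w (fun a b => unsh b (fun c d => sg (wdeg a * wdeg c) *: F c a d)).
Proof.
rewrite -unshA -[RHS]unshA; apply: eq_unsh => a b _; exact: unshC.
Qed.

(** The counit axiom, the counit being the projection onto the empty word. *)
Lemma unsh_nilr w (F : word -> M) :
  unsh w (fun a b => if nilp b then F a else 0) = F w.
Proof.
elim: w F => [|x w IH] F //=; rewrite IH -[RHS]addr0; congr (_ + _).
by rewrite -[RHS](unsh0 M w); apply: eq_unsh => *; rewrite scaler0.
Qed.

(** The projection of S(V) onto V, followed by [F]. *)
Definition single (F : letter -> M) w : M := if w is [:: z] then F z else 0.

End Coalgebra.
End Unshuffle.

Section Single.
Context (K : fieldType) (V : gvs K).
Local Notation word := (seq (int * V)).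
Local Notation letter := (int * V)%type.

Lemma single_lin (M N : lmodType K) (f : M -> N) (F : letter -> M) (e : word) :
  f 0 = 0 -> f (single F e) = single (fun z => f (F z)) e.
Proof. by case: e => [|z [|? ?]]. Qed.

Lemma singleZ (M : lmodType K) k (F : letter -> M) (e : word) :
  k *: single F e = single (fun z => k *: F z) e.
Proof. by apply: (single_lin (f := fun t => k *: t)); rewrite scaler0. Qed.

Lemma singleD (M : lmodType K) (F G : letter -> M) (e : word) :
  single (fun z => F z + G z) e = single F e + single G e.
Proof. by case: e => [|z [|? ?]] /=; rewrite ?addr0. Qed.

Lemma single_cons (M : lmodType K) (F : letter -> M) x (e : word) :
  single F (x :: e) = if nilp e then F x else 0.
Proof. by case: e. Qed.

Lemma eq_single (M : lmodType K) (F G : letter -> M) (e : word) :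
  (forall z, z \in e -> F z = G z) -> single F e = single G e.
Proof. by case: e => [|z [|? ?]] //= FG; apply: FG; rewrite inE. Qed.

Lemma unsh_single (M : lmodType K) (w e : word)
    (F : word -> word -> letter -> M) :
  unsh w (fun a b => single (F a b) e) =
  single (fun z => unsh w (fun a b => F a b z)) e.
Proof. by case: e => [|z [|? ?]] //=; rewrite unsh0. Qed.

End Single.

(** * Coderivations and the action of operator-valued functions *)

Section Coder.
Context (K : fieldType) (V : gvs K).
Local Notation word := (seq (int * V)).
Local Notation letter := (int * V)%type.
Local Notation sg := (sg K).

(** The function [G] composed with the coderivation of degree [N] of S(V)
    whose corestriction to V is [th]. *)
Definition coder (M : lmodType K) (N : int) (th : word -> V) (w : word)
  (G : word -> M) : M := unsh w (fun a b => G ((N + wdeg a, th a) :: b)).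

(** The linear vector field x |-> B(x) x, as the corestriction of a
    coderivation: the single letter [e] is the one that [B c] acts upon. *)
Definition vfield (M : lmodType K) (B : word -> V -> M) (w : word) : M :=
  unsh w (fun c e => single (fun z => B c z.2) e).

Definition head_lin (M : lmodType K) (G : word -> M) : Prop :=
  forall t w, linear (fun x => G ((t, x) :: w)).

Definition front_sym (M : lmodType K) (G : word -> M) : Prop :=
  forall x y w, homog x.1 x.2 -> homog y.1 y.2 ->
    G (x :: y :: w) = sg (x.1 * y.1) *: G (y :: x :: w).

Definition val_deg (N : int) (th : word -> V) : Prop :=
  forall w, hletters w -> homog (N + wdeg w) (th w).

(** The terms of a product of two coderivations in which neither consumes the
    letter produced by the other. *)
Definition cross (M : lmodType K) N (th : word -> V) N' (et : word -> V) w
    (G : word -> M) : M :=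
  unsh w (fun a b => unsh b (fun c d => sg ((N + wdeg a) * wdeg c) *:
    G ((N' + wdeg c, et c) :: (N + wdeg a, th a) :: d))).

(** The letter produced by [th] either is an argument of [et], which gives the
    coderivation with corestriction [coder N th e et], or it is not. *)
Lemma coder_comp (M : lmodType K) N N' th et (G : word -> M) w : head_lin G ->
  coder N th w (fun u => coder N' et u G) =
  coder (N + N') (fun e => coder N th e et) w G + cross N th N' et w G.
Proof.
move=> lG; rewrite /coder /cross -unshD -[X in _ = X]/(unsh w _) [RHS]unshD.
rewrite [LHS]unshD; congr (_ + _).
rewrite -unshA; apply: eq_unsh => a b _.
rewrite (unsh_lin _ _ (lG _ _)); apply: eq_unsh => c d ->.
rewrite wdegS /=; congr (G ((_, _) :: _)); lia.
Qed.

(** Exchanging the two letters produced costs the sign of their degrees;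
    together with the sign of exchanging their arguments [a] and [c], it is
    the sign of the degrees of the two coderivations. *)
Lemma cross_sym (M : lmodType K) N N' th et (G : word -> M) w : front_sym G ->
  hletters w -> val_deg N th -> val_deg N' et ->
  cross N th N' et w G = sg (N * N') *: cross N' et N th w G.
Proof.
move=> sG hw dt de; rewrite /cross unshCA -unshZ.
apply: eq_unsh_hom => // a b ha hb _; rewrite -unshZ.
apply: eq_unsh_hom => // c d hc _ _.
rewrite (sG (_, et a)); [|exact: de|exact: dt].
by rewrite !scalerA -!sgD; sgn.
Qed.

(** The letter produced by [th] is either an argument of the operator [B], or
    the letter that the operator is applied to; the latter case is a
    convolution. *)
Lemma coder_vfield (M : lmodType K) N th (B : word -> V -> M) w :
  coder N th w (vfield B) =
  vfield (fun u y => coder N th u (B^~ y)) w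
  + unsh w (fun a b => sg (N * wdeg a) *: B a (th b)).
Proof.
rewrite /coder /vfield [LHS]unshD; congr (_ + _).
  by rewrite -unshA; apply: eq_unsh => f e _; rewrite unsh_single.
rewrite [RHS]unshC; apply: eq_unsh => a b _.
rewrite -[RHS](unsh_nilr b
  (fun c => sg (wdeg a * wdeg c) *: (sg (N * wdeg c) *: B c (th a)))).
by apply: eq_unsh => c [|z e] _ /=; rewrite ?scaler0 //; sgn.
Qed.

Lemma vfieldD (M : lmodType K) (B C : word -> V -> M) w :
  vfield (fun u y => B u y + C u y) w = vfield B w + vfield C w.
Proof. by rewrite /vfield -unshD; apply: eq_unsh => c e _; rewrite singleD. Qed.

(** The operator-valued function [B] acts on [G] by differentiating it along
    the vector field of [B], and by composing the values of [G] with those of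
    [B]. *)
Definition act (M : lmodType K) (N : int) (B : word -> V -> V)
    (G : word -> V -> M) (w : word) (y : V) : M :=
  coder N (vfield B) w (G^~ y)
  + unsh w (fun a b => sg (N * wdeg a) *: G a (B b y)).

(** The map [vfield] turns [act] into the composition of vector fields. *)
Lemma coder_vfield_act (M : lmodType K) N (C : word -> V -> V) (B : word -> V -> M) w :
  (forall u, linear (B u)) ->
  coder N (vfield C) w (vfield B) = vfield (act N C B) w.
Proof.
move=> lB; rewrite coder_vfield vfieldD; congr (_ + _).
rewrite /vfield.
under [RHS]eq_unsh => f e _ do rewrite -unsh_single.
rewrite unshA; apply: eq_unsh => a b _.
rewrite (unsh_lin _ _ (lB a)) -unshZ; apply: eq_unsh => c e _.
by rewrite (single_lin _ _ (lin0 (lB a))) singleZ.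
Qed.

(** The coderivation property: a coderivation is distributed over the two
    factors of a coproduct. *)
Lemma coder_unsh (M : lmodType K) N th w (F : word -> word -> M) :
  coder N th w (fun u => unsh u F) =
  unsh w (fun a b => coder N th a (F^~ b))
  + unsh w (fun a b => sg (N * wdeg a) *: coder N th b (F a)).
Proof.
rewrite /coder [LHS]unshD; congr (_ + _); first by rewrite -unshA.
rewrite unshCA; apply: eq_unsh => a b _; rewrite -unshZ.
by apply: eq_unsh => c d _; sgn.
Qed.

Lemma coderD (M : lmodType K) N th w (F G : word -> M) :
  coder N th w (fun u => F u + G u) = coder N th w F + coder N th w G.
Proof. by rewrite /coder -unshD. Qed.

Lemma coderZ (M : lmodType K) N th w k (F : word -> M) :
  coder N th w (fun u => k *: F u) = k *: coder N th w F.
Proof. by rewrite /coder -unshZ. Qed.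

(** The part of [act N C (act N' B G)] in which the operators [B] and [C] act
    independently of each other: on different letters, or one on the argument
    of [G] and the other on its value. *)
Definition act_sym (M : lmodType K) N (C : word -> V -> V) N' (B : word -> V -> V)
    (G : word -> V -> M) w y : M :=
  cross N (vfield C) N' (vfield B) w (G^~ y)
  + (sg (N * N') *: unsh w (fun a b => sg (N' * wdeg a) *:
                       coder N (vfield C) a (G^~ (B b y)))
  + unsh w (fun a b => sg (N * wdeg a) *: coder N' (vfield B) a (G^~ (C b y)))).

(** With [coder_comp] and [coder_unsh], each of the two halves of the two
    actions splits according to whether [C] acts on [B]; the terms where it
    does add up to the action of [act N C B]. *)
Lemma act_act (M : lmodType K) N N' (C B : word -> V -> V) (G : word -> V -> M) w y :
  (forall y, head_lin (G^~ y)) -> (forall u, linear (G u)) ->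
  (forall u, linear (B u)) ->
  act N C (act N' B G) w y =
  act (N + N') (act N C B) G w y + act_sym N C N' B G w y.
Proof.
move=> hG lG lB; rewrite {1}/act coderD (coder_comp _ _ _ _ _ (hG y)) coder_unsh.
rewrite [in X in _ = X + _]/act /act_sym.
have -> : (fun e => coder N (vfield C) e (vfield B)) = vfield (act N C B).
  by apply/funext => e; apply: coder_vfield_act.
have -> : unsh w (fun a b => sg (N * wdeg a) *: act N' B G a (C b y)) =
    unsh w (fun a b => sg (N * wdeg a) *: coder N' (vfield B) a (G^~ (C b y)))
  + unsh w (fun a b => sg ((N + N') * wdeg a) *: G a
             (unsh b (fun c d => sg (N * wdeg c) *: B c (C d y)))).
  under eq_unsh => a b _ do rewrite scalerDr.
  rewrite unshD; congr (_ + _).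
  transitivity (unsh w (fun a b => unsh a (fun c d =>
      sg (N * (wdeg c + wdeg d) + N' * wdeg c) *: G c (B d (C b y))))).
    apply: eq_unsh => a b _; rewrite -unshZ; apply: eq_unsh => c d ->.
    by rewrite scalerA -sgD.
  rewrite unshA; apply: eq_unsh => a b _.
  rewrite (unsh_lin _ _ (lG a)) -unshZ; apply: eq_unsh => c d _.
  by rewrite (linZ (lG a)); sgn.
have -> : unsh w (fun a b =>
     sg ((N + N') * wdeg a) *: G a (act N C B b y)) =
   unsh w (fun a b => sg ((N + N') * wdeg a) *: G a (coder N (vfield C) b (B^~ y)))
 + unsh w (fun a b => sg ((N + N') * wdeg a) *: G a
             (unsh b (fun c d => sg (N * wdeg c) *: B c (C d y)))).
  by rewrite -unshD; apply: eq_unsh => a b _; rewrite /act (linD (lG a)) scalerDr.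
have -> : unsh w (fun a b => coder N (vfield C) a
      (fun u => sg (N' * wdeg u) *: G u (B b y))) =
   sg (N * N') *: unsh w (fun a b => sg (N' * wdeg a) *:
                       coder N (vfield C) a (G^~ (B b y))).
  rewrite -unshZ; apply: eq_unsh => a b _; rewrite -!unshZ.
  apply: eq_unsh => c d ->; rewrite wdegS /=; sgn.
have -> : unsh w (fun a b => sg (N * wdeg a) *: coder N (vfield C) b
      (fun u => sg (N' * wdeg a) *: G a (B u y))) =
   unsh w (fun a b => sg ((N + N') * wdeg a) *: G a (coder N (vfield C) b (B^~ y))).
  apply: eq_unsh => a b _; rewrite -unshZ /coder (unsh_lin _ _ (lG a)) -unshZ.
  by apply: eq_unsh => c d _; sgn.
rewrite -!addrA; congr (_ + _); rewrite !addrA.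
by rewrite [LHS](ACl (3 * 5 * 1 * 2 * 4)).
Qed.

Definition op_deg (B : word -> V -> V) (N : int) : Prop :=
  forall w d y, hletters w -> homog d y -> homog (N + wdeg w + d) (B w y).

Lemma unsh_in (M : lmodType K) (S : subfam M) w n (F : word -> word -> M) :
  hletters w ->
  (forall a b, hletters a -> hletters b -> wdeg w = wdeg a + wdeg b ->
     S n (F a b)) ->
  S n (unsh w F).
Proof.
elim: w F => [|x w IH] F hw hF /=; first by apply: hF; rewrite ?wdeg0.
have [hx h] := hletters_consP hw.
rewrite -[X in X + _]scale1r; apply: sf_lin; apply: IH => // a b ha hb wE.
  by apply: hF; rewrite ?wdegS ?wE ?addrA //; apply: hletters_cons.
rewrite -[_ *: _]addr0; apply: sf_lin; last exact: sf_0.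
by apply: hF => //; [apply: hletters_cons|rewrite !wdegS wE addrCA].
Qed.

Lemma vfield_deg N B : op_deg B N -> val_deg N (vfield B).
Proof.
move=> dB w hw; apply: (unsh_in (S := gv_fam V)) => //.
move=> c [|z [|? ?]] hc he ->; try exact: sf_0.
rewrite wdegS wdeg0 addr0 addrA; apply: dB => //.
by apply: he; rewrite inE.
Qed.

Lemma eq_coder_hom (M : lmodType K) N th th' w (F G : word -> M) :
  hletters w -> val_deg N th -> (forall u, hletters u -> th u = th' u) ->
  (forall u, hletters u -> F u = G u) ->
  coder N th w F = coder N th' w G.
Proof.
move=> hw dt tE FG; apply: eq_unsh_hom => // a b ha hb _.
rewrite -tE // FG //; apply: hletters_cons => //=; exact: dt.
Qed.

Lemma eq_vfield_hom (M : lmodType K) (B C : word -> V -> M) w :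
  hletters w -> (forall u y, hletters u -> B u y = C u y) ->
  vfield B w = vfield C w.
Proof.
move=> hw BC; apply: eq_unsh_hom => // c e hc _ _.
by apply: eq_single => z _; apply: BC.
Qed.

Lemma eq_act_hom (M : lmodType K) N B C (F G : word -> V -> M) w y :
  hletters w -> op_deg B N -> (forall u y, hletters u -> B u y = C u y) ->
  (forall u y, hletters u -> F u y = G u y) ->
  act N B F w y = act N C G w y.
Proof.
move=> hw dB BC FG; congr (_ + _).
  apply: eq_coder_hom => // [|u hu|u hu]; [exact: vfield_deg| |exact: FG].
  by apply: eq_vfield_hom.
by apply: eq_unsh_hom => // a b ha hb _; rewrite FG // BC.
Qed.

Lemma coder_linear_map (M : lmodType K) N k th th1 th2 (G : word -> M) w :
  hletters w -> head_lin G ->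
  (forall u, hletters u -> th u = k *: th1 u + th2 u) ->
  coder N th w G = k *: coder N th1 w G + coder N th2 w G.
Proof.
move=> hw lG thE; rewrite /coder -unshZ -unshD.
by apply: eq_unsh_hom => // a b ha _ _; rewrite thE // lG.
Qed.

Lemma act_linear (M : lmodType K) N k l B C (G : word -> V -> M) w y :
  (forall y, head_lin (G^~ y)) -> (forall u, linear (G u)) ->
  act N (fun u z => k *: B u z + l *: C u z) G w y =
  k *: act N B G w y + l *: act N C G w y.
Proof.
move=> hG lG; rewrite /act !scalerDr addrACA; congr (_ + _).
  rewrite /coder -!unshZ -unshD; apply: eq_unsh => a b _.
  have -> : vfield (fun u z => k *: B u z + l *: C u z) a =
      k *: vfield B a + (l *: vfield C a + 0).
    rewrite addr0 /vfield -!unshZ -unshD; apply: eq_unsh => c e _.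
    by rewrite singleD !singleZ.
  by rewrite hG hG (lin0 (hG _ _ _)) addr0.
rewrite -!unshZ -unshD; apply: eq_unsh => a b _.
by rewrite (linD (lG a)) !(linZ (lG a)) scalerDr !scalerA !(mulrC (sg _)).
Qed.

Lemma act_linear_arg (M : lmodType K) N k l B (F G : word -> V -> M) w y :
  act N B (fun u z => k *: F u z + l *: G u z) w y =
  k *: act N B F w y + l *: act N B G w y.
Proof.
rewrite /act !scalerDr addrACA coderD !coderZ; congr (_ + _).
rewrite -!unshZ -unshD; apply: eq_unsh => a b _.
by rewrite scalerDr !scalerA !(mulrC (sg _)).
Qed.

Lemma actZ (M : lmodType K) N k B (G : word -> V -> M) w y :
  (forall y, head_lin (G^~ y)) -> (forall u, linear (G u)) ->
  act N (fun u z => k *: B u z) G w y = k *: act N B G w y.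
Proof.
move=> hG lG; rewrite (_ : (fun u z => _) = fun u z => k *: B u z + 0 *: B u z).
  by rewrite act_linear // scale0r addr0.
by apply/funext => u; apply/funext => z; rewrite scale0r addr0.
Qed.

Lemma actZ_arg (M : lmodType K) N k B (F : word -> V -> M) w y :
  act N B (fun u z => k *: F u z) w y = k *: act N B F w y.
Proof.
rewrite (_ : (fun u z => _) = fun u z => k *: F u z + 0 *: F u z).
  by rewrite act_linear_arg scale0r addr0.
by apply/funext => u; apply/funext => z; rewrite scale0r addr0.
Qed.

(** The crossed terms are symmetric by [cross_sym], while the two mixed terms
    are exchanged. *)
Lemma act_symC (M : lmodType K) N N' C B (G : word -> V -> M) w y :
  hletters w -> op_deg C N -> op_deg B N' ->
  (forall y, front_sym (G^~ y)) ->
  act_sym N C N' B G w y = sg (N * N') *: act_sym N' B N C G w y.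
Proof.
move=> hw dC dB sG; rewrite /act_sym scalerDr; congr (_ + _).
  by apply: cross_sym => //; apply: vfield_deg.
rewrite scalerDr addrC scalerA -sgD; congr (_ + _).
rewrite (mulrC N') (@sg_eq _ _ 0) ?sg0 ?scale1r // !oddzE.
by case: (oddz N); case: (oddz N').
Qed.

(** The symmetric parts of the two products cancel, so that [act] is a
    representation of the commutator of the product (B, C) |-> [act N C B]. *)
Lemma act_comm (M : lmodType K) N N' C B (G : word -> V -> M) w y :
  hletters w -> op_deg C N -> op_deg B N' ->
  (forall u, linear (C u)) -> (forall u, linear (B u)) ->
  (forall y, head_lin (G^~ y)) -> (forall u, linear (G u)) ->
  (forall y, front_sym (G^~ y)) ->
  act N C (act N' B G) w y - sg (N * N') *: act N' B (act N C G) w y =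
  act (N + N') (fun u z => act N C B u z - sg (N * N') *: act N' B C u z) G w y.
Proof.
move=> hw dC dB lC lB hG lG sG; rewrite !act_act // (act_symC _ hw dC dB sG).
move: (act_sym _ _ _ _ _ _ _) => S; rewrite [in X in _ - X]scalerDr opprD.
rewrite addrACA subrr addr0 (addrC N').
rewrite (_ : (fun u z => act N C B u z - _) = fun u z =>
    1 *: act N C B u z + - sg (N * N') *: act N' B C u z); last first.
  by apply/funext => u; apply/funext => z; rewrite scale1r scaleNr.
by rewrite act_linear // scale1r scaleNr.
Qed.

End Coder.

(** * The coderivation of the bracket *)

Section Quad.
Context (K : fieldType) (h : sgLa K).
Local Notation word := (seq (int * h)).
Local Notation letter := (int * h)%type.
Local Notation sg := (sg K).
Local Notation br := (@sg_br K h).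

(** The corestriction of the coderivation of S(h) that encodes the bracket of
    [h]. *)
Definition quad (w : word) : h := if w is [:: x; y] then br x.2 y.2 else 0.

Lemma br0l y : br 0 y = 0. Proof. exact: (lin0 (sg_linl y)). Qed.

Lemma quad_cons x (w : word) : quad (x :: w) = single (fun z => br x.2 z.2) w.
Proof. by case: w => [|y []]. Qed.

Lemma quad_deg : val_deg 1 quad.
Proof.
move=> [|x [|y [|z w]]] hw; try exact: sf_0.
have [hx /hletters_consP[hy _]] := hletters_consP hw.
rewrite !wdegS wdeg0 addr0 addrC; exact: sg_deg.
Qed.

(** A word splits into two single letters only if it has length two, and then
    in two ways. *)
Lemma unsh_pair (M : lmodType K) (w : word) (H : letter -> letter -> M) :
  unsh w (fun c d => single (fun z => single (H^~ z) c) d) =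
  if w is [:: x; y] then H x y + sg (x.1 * y.1) *: H y x else 0.
Proof.
case: w => [|x [|y [|z w]]] //=.
- by rewrite wdeg0 scaler0 addr0.
- by rewrite !wdegS wdeg0 !scaler0 !mulr0 addr0 sg0 scale1r add0r !addr0.
rewrite -!unshD -[RHS](unsh0 M w); apply: eq_unsh => c d _.
by case: c => [|? c]; case: d => [|? [|? d]]; rewrite /= ?scaler0 ?addr0.
Qed.

Definition der_op N (B : word -> h -> h) : Prop :=
  forall a d e x y, hletters a -> homog d x -> homog e y ->
    B a (br x y) = sg (N + wdeg a) *: br (B a x) y
                 + sg ((N + wdeg a) * (d + 1)) *: br x (B a y).

(** Expanding the left-hand side by the derivation rule for [B a] gives, for
    the two letters x and y of [b], the brackets of [B a x] with y and of [B a
    y] with x. These are the terms of the right-hand side, where the letter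
    acted upon is bracketed with the remaining one. *)
Lemma coder_vfield_quad N B w : hletters w -> op_deg B N -> der_op N B ->
  (forall u, linear (B u)) ->
  unsh w (fun a b => sg (wdeg a) *: B a (quad b)) =
  sg N *: coder N (vfield B) w quad.
Proof.
move=> hw dB derB lB.
transitivity (sg N *: unsh w (fun a b => unsh b (fun c d =>
    single (fun z => single (fun x => br (B a x.2) z.2) c) d))); last first.
  congr (_ *: _); rewrite -unshA; apply: eq_unsh => a b _.
  rewrite quad_cons unsh_single; apply: eq_single => z _ /=.
  rewrite /vfield (unsh_lin _ _ (sg_linl z.2)); apply: eq_unsh => c d _.
  by case: d => [|t [|? ?]] /=; rewrite ?br0l.
rewrite -unshZ; apply: eq_unsh_hom => // a b ha hb _.
rewrite (unsh_pair _ (fun x z => br (B a x.2) z.2)).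
case: b hb => [|x [|y [|z b]]] hb; rewrite /= ?(lin0 (lB a)) ?scaler0 //.
have [hx /hletters_consP[hy _]] := hletters_consP hb.
rewrite (derB _ _ _ _ _ ha hx hy) (sg_sym hx (dB _ _ _ ha hy)).
rewrite -[(-1) ^ _]/(sg _) !scalerDr; congr (_ + _); sgn.
Qed.

(** The first term of [coder_vfield] differentiates the operator itself; the
    second one is exchanged with the vector field by [coder_vfield_quad]. *)
Lemma coder_quad_vfield N B w : hletters w -> op_deg B N -> der_op N B ->
  (forall u, linear (B u)) ->
  coder 1 quad w (vfield B) =
  vfield (fun u y => coder 1 quad u (B^~ y)) w + sg N *: coder N (vfield B) w quad.
Proof.
move=> hw dB derB lB; rewrite coder_vfield -(coder_vfield_quad hw dB derB lB).
by congr (_ + _); apply: eq_unsh => a b _; rewrite mul1r.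
Qed.

(** The coderivation of the bracket commutes, in the graded sense, with the
    action of a family of derivations, up to the action of the differentiated
    family. *)
Lemma coder_quad_act (M : lmodType K) N B (G : word -> h -> M) w y :
  hletters w -> op_deg B N -> der_op N B -> (forall u, linear (B u)) ->
  (forall y, head_lin (G^~ y)) -> (forall u, linear (G u)) ->
  (forall y, front_sym (G^~ y)) ->
  coder 1 quad w (fun u => act N B G u y) =
  sg N *: act N B (fun u z => coder 1 quad u (G^~ z)) w y
  + act (1 + N) (fun u z => coder 1 quad u (B^~ z)) G w y.
Proof.
move=> hw dB derB lB hG lG sG.
rewrite coderD coder_unsh /act !scalerDr.
rewrite (coder_comp _ _ _ _ _ (hG y)) (coder_comp _ _ _ _ _ (hG y)).
rewrite (cross_sym (sG y) hw quad_deg (vfield_deg dB)) mul1r scalerDr.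
have -> : coder (1 + N) (fun e => coder 1 quad e (vfield B)) w (G^~ y) =
    coder (1 + N) (vfield (fun u y => coder 1 quad u (B^~ y))) w (G^~ y)
  + sg N *: coder (N + 1) (fun e => coder N (vfield B) e quad) w (G^~ y).
  rewrite [RHS]addrC (addrC N); apply: coder_linear_map => // u hu.
  by rewrite (coder_quad_vfield hu dB derB lB) addrC.
have -> : unsh w (fun a b =>
    coder 1 quad a (fun u => sg (N * wdeg u) *: G u (B b y))) =
  sg N *: unsh w (fun a b => sg (N * wdeg a) *: coder 1 quad a (G^~ (B b y))).
  rewrite -unshZ; apply: eq_unsh => a b _; rewrite -!unshZ.
  by apply: eq_unsh => c d ->; rewrite wdegS /=; sgn.
have -> : unsh w (fun a b => sg (1 * wdeg a) *:
    coder 1 quad b (fun u => sg (N * wdeg a) *: G a (B u y))) =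
  unsh w (fun a b => sg ((1 + N) * wdeg a) *: G a (coder 1 quad b (B^~ y))).
  apply: eq_unsh => a b _; rewrite -unshZ /coder (unsh_lin _ _ (lG a)) -unshZ.
  by apply: eq_unsh => c d _; sgn.
set P := coder _ (vfield _) _ _; set Q := sg N *: coder _ _ _ _.
set X := sg N *: cross _ _ _ _ _ _; set Y := sg N *: unsh _ _; set Z := unsh _ _.
by rewrite !addrA [LHS](ACl (2 * 3 * 4 * 1 * 5)).
Qed.

(** Only words of length three contribute, where the three ways of bracketing
    two letters and then the third one add up to zero by the Jacobi identity.
    *)
Lemma quad_quad w : hletters w -> coder 1 quad w quad = 0.
Proof.
move=> hw; have [/eqP s3|s3] := boolP (size w == 3); last first.
  rewrite -[RHS](unsh0 _ w); apply: eq_unsh_size => a b _ sE.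
  rewrite quad_cons; case: b sE => [|y [|? b]] //= sE.
  case: a sE => [|? [|? [|? a]]] /= sE; rewrite ?br0l //.
  by move: s3; rewrite sE.
case: w s3 hw => [|x [|y [|z []]]] // _ hw.
have [hx /hletters_consP[hy /hletters_consP[hz _]]] := hletters_consP hw.
rewrite /coder /= ?br0l !wdegS !wdeg0 ?br0l /=.
rewrite ?scaler0 ?addr0 ?add0r ?mulr0 ?sg0 ?scale1r.
rewrite (sg_sym (sg_deg hx hz) hy) (sg_sym (sg_deg hy hz) hx).
rewrite (sg_jacobi hx hy hz) -!/(sg _) !scalerDr !scalerA -!sgD.
rewrite addrACA -[X in X + _ + _]scale1r -[X in X *: _](sg0 K) -!scalerDl.
have sgN1 p q : oddz p = ~~ oddz q -> sg p + sg q = 0.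
  by rewrite !sgE => ->; case: oddz; rewrite /= ?subrr ?addNr.
rewrite !sgN1 ?scale0r ?addr0 // !oddzE.
  by case: (oddz x.1); case: (oddz y.1); case: (oddz z.1).
by case: (oddz x.1); case: (oddz y.1); case: (oddz z.1).
Qed.

(** The crossed terms of an odd coderivation with itself are equal to their
    opposites. *)
Lemma coder_quad_quad (M : lmodType K) (G : word -> M) w : (2%:R : K) != 0 ->
  hletters w -> head_lin G -> front_sym G ->
  coder 1 quad w (fun u => coder 1 quad u G) = 0.
Proof.
move=> nz2 hw lG sG; rewrite coder_comp //.
have -> : cross 1 quad 1 quad w G = 0.
  have /eqP := cross_sym sG hw quad_deg quad_deg.
  rewrite mul1r sg1 scaleN1r -subr_eq0 opprK -mulr2n -scaler_nat scaler_eq0.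
  by rewrite (negPf nz2) => /eqP.
rewrite addr0 -[RHS](unsh0 _ w); apply: eq_unsh_hom => // a b ha _ _.
by rewrite quad_quad // (lin0 (lG _ _)).
Qed.

End Quad.

(** * Linear maps on graded spaces *)

Section Graded.
Context (K : fieldType).

Lemma dsum_ind (A : lmodType K) (F : subfam A) (P : A -> Prop) (x : dsum F) :
  P 0 -> (forall d y z, F d y -> P z -> P (y + z)) -> P (dsum_val x).
Proof.
move=> P0 PD; case: x => /= x /asboolP[s hs ->].
elim: s hs => [|y s IH] hs; first by rewrite big_nil.
rewrite big_cons; have [d hd] := hs y (mem_head _ _); apply: PD hd (IH _) => z zs.
by apply: hs; rewrite inE zs orbT.
Qed.

Lemma dsum_valP (A : lmodType K) (F : subfam A) k (x y : dsum F) :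
  dsum_val (k *: x + y) = k *: dsum_val x + dsum_val y.
Proof. exact: (linearP (\val : dsum_car F -> A)). Qed.

Lemma dsum_linear (U W : lmodType K) (F : subfam (U -> W)) (x : dsum F) :
  (forall d f, F d f -> linear f) -> linear (dsum_val x).
Proof.
move=> lF; apply: (dsum_ind (F := F) (P := fun f : U -> W => linear f)).
  by move=> a u v; rewrite /= scaler0 addr0.
move=> d f g /lF lf lg a u v; rewrite -[LHS]/(f _ + g _) lf lg.
by rewrite -[RHS]/(a *: (f u + g u) + (f v + g v)) scalerDr addrACA.
Qed.

Lemma linear_zero (W : lmodType K) (V : gvs K) (f : V -> W) : linear f ->
  (forall d x, homog d x -> f x = 0) -> forall x, f x = 0.
Proof.
move=> lf f0 x; have [s hs ->] := gv_span x.
elim: s hs => [|y s IH] hs; first by rewrite big_nil (lin0 lf).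
rewrite big_cons (linD lf); have [d hd] := hs y (mem_head _ _).
rewrite (f0 d) // IH ?addr0 // => z zs.
by apply: hs; rewrite inE zs orbT.
Qed.

Lemma linear_ext (W : lmodType K) (V : gvs K) (f g : V -> W) :
  linear f -> linear g ->
  (forall d x, homog d x -> f x = g x) -> forall x, f x = g x.
Proof.
move=> lf lg fg x; apply/eqP; rewrite -subr_eq0; apply/eqP.
apply: (@linear_zero W V (fun x => f x - g x)) => [a u v|d y hy].
  by rewrite lf lg scalerBr opprD addrACA.
by rewrite (fg d) ?subrr.
Qed.

End Graded.

(** * Cochains, and the differential graded Lie algebra *)

Section Cochains.
Context (K : fieldType) (h : sgLa K).
Local Notation word := (seq (int * h)).
Local Notation sg := (sg K).
Local Notation br := (@sg_br K h).
Implicit Types (a b c : Cbar h) (w u : word) (y : h).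

(** The cochain as an operator-valued function on tagged words, where the
    formalism above applies. *)
Definition ev a w y : h := sact (capp a (map snd w)) y.

Lemma cbar_linear a : linear (dsum_val a).
Proof. by apply: dsum_linear => d f []. Qed.

Lemma der_linear (D : Der h) : linear (dsum_val D).
Proof. by apply: dsum_linear => d f [[]]. Qed.

Lemma evE a w y : ev a w y = dsum_val (dsum_val a (sym_mon (map snd w))) y.
Proof. by []. Qed.

Lemma ev_linear a w : linear (ev a w).
Proof. exact: der_linear. Qed.

Lemma ev_linear_c k a b w y : ev (k *: a + b) w y = k *: ev a w y + ev b w y.
Proof.
have E := dsum_valP k a b; pose s := sym_mon (map snd w).
rewrite evE (congr1 (fun f => dsum_val (f s) y) E).
exact: (congr1 (fun f => f y) (dsum_valP k (dsum_val a s) (dsum_val b s))).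
Qed.

Lemma ev0 w y : ev 0 w y = 0.
Proof. by have := ev_linear_c (-1) 0 0 w y; rewrite scaler0 addr0 scaleN1r addNr. Qed.

Lemma evZ k a w y : ev (k *: a) w y = k *: ev a w y.
Proof. by have := ev_linear_c k a 0 w y; rewrite ev0 !addr0. Qed.

Lemma evD a b w y : ev (a + b) w y = ev a w y + ev b w y.
Proof. by have := ev_linear_c 1 a b w y; rewrite !scale1r. Qed.

Definition letter_linear (M : lmodType K) (f : word -> M) : Prop :=
  forall u t k x y w, f (u ++ (t, k *: x + y) :: w) =
    k *: f (u ++ (t, x) :: w) + f (u ++ (t, y) :: w).

Definition letter_sym (M : lmodType K) (f : word -> M) : Prop :=
  forall u (x y : int * h) w, homog x.1 x.2 -> homog y.1 y.2 ->
    f (u ++ x :: y :: w) = sg (x.1 * y.1) *: f (u ++ y :: x :: w).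

Lemma letter_head (M : lmodType K) (f : word -> M) :
  letter_linear f -> head_lin f.
Proof. by move=> fl t w k x y; apply: (fl [::]). Qed.

Lemma letter_front (M : lmodType K) (f : word -> M) :
  letter_sym f -> front_sym f.
Proof. by move=> fs x y w; apply: (fs [::]). Qed.

Lemma ev_letter_linear a y : letter_linear (fun w => ev a w y).
Proof.
move=> u t k x z w; rewrite !evE !map_cat /= sym_mon_multilinear.
by rewrite (cbar_linear a).
Qed.

Lemma ev_letter_sym a y : letter_sym (fun w => ev a w y).
Proof.
move=> u x z w hx hz; rewrite !evE !map_cat /= (sym_mon_symmetric _ _ hx hz).
by rewrite (linZ (cbar_linear a)).
Qed.

Lemma sym_mon_homog e (v : seq h) : hword e v -> homog (V := Defs.Sym h) e (sym_mon v).
Proof.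
move=> hv; rewrite -[sym_mon v]scale1r -[_ *: _]addr0.
by apply: sym_in_cons => //; apply: sym_in0.
Qed.

Lemma ev_der n a w : homog n a -> hletters w -> der_in (n + 1 + wdeg w) (ev a w).
Proof.
move=> [_ da] hw; have := da _ _ (sym_mon_homog (hletters_hword hw)).
by rewrite addrAC.
Qed.

Lemma ev_op_deg n a : homog n a -> op_deg (ev a) (n + 1).
Proof. by move=> ha w d y hw hy; have [[_ dD] _] := ev_der ha hw; apply: dD. Qed.

Lemma ev_der_op n a : homog n a -> der_op (n + 1) (ev a).
Proof. by move=> ha w d e x y hw hx hy; have [_] := ev_der ha hw; apply; eauto. Qed.

(** Homogeneous words span S(h). *)
Lemma ev_inj a b :
  (forall w y, hletters w -> ev a w y = ev b w y) -> a = b.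
Proof.
move=> ab; apply: val_inj; apply/funext => s.
have la := @cbar_linear a; have lb := @cbar_linear b.
apply: (@linear_ext K (Der h) (Defs.Sym h)) s => // d s.
elim=> {s} [|k v s hv _ IH]; first exact: etrans (lin0 la) (esym (lin0 lb)).
apply: (etrans (la k (sym_mon v) s)); apply: esym.
apply: (etrans (lb k (sym_mon v) s)); rewrite IH; congr (_ *: _ + _).
apply: esym.
have [w [hw _ <-]] := hword_hletters hv.
by apply: val_inj; apply/funext => y; apply: ab.
Qed.

Definition partial_spec (D : Cbar h -> Cbar h) : Prop :=
  linear D /\ forall n b, homog n b -> homog (n + 1) (D b) /\
    forall w y, hletters w ->
      ev (D b) w y = sg (n + 1) *: coder 1 (@quad _ _) w (fun u => ev b u y).

(** The negative of the commutator of the product of [act_comm]. *)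
Definition bracket_val M N (A B : word -> h -> h) (w : word) (y : h) : h :=
  - (act N B A w y - sg (M * N) *: act M A B w y).

Definition bracket_spec (bk : Cbar h -> Cbar h -> Cbar h) : Prop :=
  [/\ forall b, linear (bk^~ b), forall a, linear (bk a) &
  forall m n a b, homog m a -> homog n b -> homog (m + n + 1) (bk a b) /\
    forall w y, hletters w ->
      ev (bk a b) w y = bracket_val (m + 1) (n + 1) (ev a) (ev b) w y].

Section Dgla.
Context (D : Cbar h -> Cbar h) (bk : Cbar h -> Cbar h -> Cbar h).
Context (hD : partial_spec D) (hbk : bracket_spec bk).
Local Notation g := (susp (Cbar h)).

Let good a := [/\ forall u, linear (ev a u), forall y, head_lin (fun u => ev a u y)
  & forall y, front_sym (fun u => ev a u y)].
Let goodP a : good a.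
Proof.
split; first by move=> u; apply: ev_linear.
  by move=> y; apply/letter_head/ev_letter_linear.
by move=> y; apply/letter_front/ev_letter_sym.
Qed.

Let susp_deg d (x : g) : homog d x -> op_deg (ev x) d.
Proof. by move=> hx; have := ev_op_deg (n := d - 1) hx; rewrite subrK. Qed.

Let susp_der d (x : g) : homog d x -> der_op d (ev x).
Proof. by move=> hx; have := ev_der_op (n := d - 1) hx; rewrite subrK. Qed.

Let susp_br d e (x y : g) : homog d x -> homog e y ->
  homog (V := g) (d + e) (bk x y) /\
  forall w t, hletters w -> ev (bk x y) w t = bracket_val d e (ev x) (ev y) w t.
Proof.
move=> hx hy; have [_ _ /(_ (d - 1) (e - 1) _ _ hx hy)[dxy xyE]] := hbk; split.
  by move: dxy; rewrite /homog /= /shift_in /= (_ : _ + _ + 1 = d + e - 1) //; lia.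
by move=> w t hw; rewrite xyE // !subrK.
Qed.

Let susp_D d (x : g) : homog d x -> homog (V := g) (d + 1) (D x) /\
  forall w t, hletters w ->
    ev (D x) w t = sg d *: coder 1 (@quad _ _) w (fun u => ev x u t).
Proof.
move=> hx; have [_ /(_ (d - 1) _ hx)[dx xE]] := hD; split.
  by move: dx; rewrite /homog /= /shift_in /= addrAC.
by move=> w t hw; rewrite xE // subrK.
Qed.

(* [(A . B) . C] for the product [X . Y := act Y X] *)
Let triple (A : Cbar h) e (B : Cbar h) f (C : Cbar h) w t : h :=
  act f (ev C) (act e (ev B) (ev A)) w t.

Let act_bracket_arg N (B : word -> h -> h) k (P Q : word -> h -> h) w t :
  act N B (fun u z => - (P u z - k *: Q u z)) w t =
  - (act N B P w t - k *: act N B Q w t).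
Proof.
rewrite (_ : (fun u z => _) = fun u z => -1 *: P u z + k *: Q u z); last first.
  by apply/funext => u; apply/funext => z; rewrite scaleN1r opprB addrC.
by rewrite act_linear_arg scaleN1r opprB addrC.
Qed.

Let act_bracket_op d e (x y z : g) w t : homog d x -> homog e y -> hletters w ->
  act (d + e) (bracket_val d e (ev x) (ev y)) (ev z) w t =
  - (triple z d x e y w t - sg (d * e) *: triple z e y d x w t).
Proof.
move=> hx hy hw; have [lx _ _] := goodP x; have [ly _ _] := goodP y.
have [lz hz sz] := goodP z.
rewrite (mulrC d) /triple act_comm //; try exact: susp_deg.
rewrite (_ : bracket_val d e (ev x) (ev y) = fun u z =>
  -1 *: (act e (ev y) (ev x) u z - sg (e * d) *: act d (ev x) (ev y) u z)
  + 0 *: ev x u z); last first.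
  apply/funext => u; apply/funext => v.
  by rewrite scale0r addr0 scaleN1r (mulrC e).
by rewrite act_linear // scale0r addr0 scaleN1r (addrC d).
Qed.

Let quad_on (x : g) (u : word) (z : h) : h := coder 1 (@quad _ _) u (fun v => ev x v z).

Let br_l d e f (x y z : g) w t : homog d x -> homog e y -> homog f z ->
  hletters w ->
  ev (bk (bk x y) z) w t =
  triple x e y f z w t - sg (d * e) *: triple y d x f z w t
  - sg ((d + e) * f) *: (triple z d x e y w t - sg (d * e) *: triple z e y d x w t).
Proof.
move=> hx hy hz hw; have [dxy xyE] := susp_br hx hy.
have [_ ->] // := susp_br dxy hz.
rewrite /bracket_val (eq_act_hom (G := bracket_val d e (ev x) (ev y))
  _ hw (susp_deg hz) (fun _ _ _ => erefl) (fun u v hu => xyE u v hu)).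
rewrite act_bracket_arg (eq_act_hom (C := bracket_val d e (ev x) (ev y))
  _ hw (susp_deg dxy) (fun u v hu => xyE u v hu) (fun _ _ _ => erefl)).
by rewrite act_bracket_op // scalerN opprK opprD opprK.
Qed.

Let br_r d e f (x y z : g) w t : homog d x -> homog e y -> homog f z ->
  hletters w ->
  ev (bk x (bk y z)) w t =
  triple x e y f z w t - sg (e * f) *: triple x f z e y w t
  - sg (d * (e + f)) *: (triple y f z d x w t - sg (e * f) *: triple z e y d x w t).
Proof.
move=> hx hy hz hw; have [dyz yzE] := susp_br hy hz.
have [_ ->] // := susp_br hx dyz.
rewrite /bracket_val (eq_act_hom (G := ev x) (C := bracket_val e f (ev y) (ev z))
  _ hw (susp_deg dyz) (fun u v hu => yzE u v hu) (fun _ _ _ => erefl)).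
rewrite act_bracket_op // (eq_act_hom (G := bracket_val e f (ev y) (ev z))
  _ hw (susp_deg hx) (fun _ _ _ => erefl) (fun u v hu => yzE u v hu)).
by rewrite act_bracket_arg scalerN opprK opprD opprK.
Qed.

(** By [br_l] and [br_r] each double bracket is a combination of four iterated
    products, and [act_comm] has already been used to this end; what remains
    is a cancellation of twelve terms. *)
Lemma bracket_jacobi d e f (x y z : g) : homog d x -> homog e y -> homog f z ->
  bk x (bk y z) = bk (bk x y) z + sg (d * e) *: bk y (bk x z).
Proof.
move=> hx hy hz; apply: ev_inj => w t hw.
rewrite evD evZ (br_r _ hx hy hz hw) (br_l _ hx hy hz hw).
rewrite (br_r _ hy hx hz hw).
move: (triple x e y f z w t) (triple x f z e y w t) (triple y f z d x w t)
  (triple z e y d x w t) (triple y d x f z w t) (triple z d x e y w t).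
move=> t1 t2 t3 t4 t5 t6.
rewrite !sgE !oddzE; case: (oddz d); case: (oddz e); case: (oddz f);
  rewrite /= ?expr0 ?expr1 ?scaleN1r ?scale1r ?opprK ?opprD ?opprK ?addrA;
  (* whatever the signs, the terms 2 and 5, and 3 and 8, are opposite *)
  rewrite [RHS](ACl (1 * 7 * 6 * 4 * (2 * 5) * (3 * 8))) /=;
  by rewrite !(subrr, addNr, addr0).
Qed.

Lemma bracket_anti d e (x y : g) : homog d x -> homog e y ->
  bk x y = - (sg (d * e) *: bk y x).
Proof.
move=> hx hy; apply: ev_inj => w t hw; have [_ xyE] := susp_br hx hy.
have [_ yxE] := susp_br hy hx.
rewrite -scaleNr evZ xyE // yxE //.
rewrite /bracket_val scaleNr scalerN opprK scalerBr scalerA -sgD opprB.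
rewrite (@sg_eq _ (_ + _) 0) ?sg0 ?scale1r //.
by rewrite !oddzE; case: (oddz d); case: (oddz e).
Qed.

(** Both sides are expanded by [coder_quad_act], applied to each of the two
    products in the bracket. *)
Lemma bracket_leibniz d e (x y : g) : homog d x -> homog e y ->
  D (bk x y) = bk (D x) y + sg d *: bk x (D y).
Proof.
move=> hx hy; apply: ev_inj => w t hw.
have [dDx DxE] := susp_D hx; have [dDy DyE] := susp_D hy.
have [dxy xyE] := susp_br hx hy; have [_ ->] // := susp_D dxy.
rewrite evD evZ.
have [_ ->] // := susp_br dDx hy; have [_ ->] // := susp_br hx dDy.
have [lx hdx sx] := goodP x; have [ly hdy sy] := goodP y.
rewrite (eq_coder_hom (G := fun u => bracket_val d e (ev x) (ev y) u t) hw
  (@quad_deg _ _) (fun _ _ => erefl) (fun u hu => xyE u t hu)).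
rewrite {}/bracket_val.
rewrite (eq_act_hom (B := ev y) (C := ev y) (G := fun u z => sg d *: quad_on x u z)
  t hw (susp_deg hy) (fun _ _ _ => erefl) (fun u v hu => DxE u v hu)).
rewrite (eq_act_hom (B := ev x) (C := ev x) (G := fun u z => sg e *: quad_on y u z)
  t hw (susp_deg hx) (fun _ _ _ => erefl) (fun u v hu => DyE u v hu)).
rewrite (eq_act_hom (C := fun u z => sg d *: quad_on x u z) (G := ev y)
  t hw (susp_deg dDx) (fun u v hu => DxE u v hu) (fun _ _ _ => erefl)).
rewrite (eq_act_hom (C := fun u z => sg e *: quad_on y u z) (G := ev x)
  t hw (susp_deg dDy) (fun u v hu => DyE u v hu) (fun _ _ _ => erefl)).
rewrite !actZ // !actZ_arg.
have -> (P Q : word -> h) k : coder 1 (@quad _ _) w (fun u => - (P u - k *: Q u)) =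
    - (coder 1 (@quad _ _) w P - k *: coder 1 (@quad _ _) w Q).
  by rewrite /coder -unshZ -unshB -unshN.
rewrite (coder_quad_act _ hw (susp_deg hx) (susp_der hx)) //.
rewrite (coder_quad_act _ hw (susp_deg hy) (susp_der hy)) //.
rewrite -!/(quad_on _) (addrC 1 d) (addrC 1 e).
move: (act _ _ _ _ _) (act _ _ _ _ _) (act _ _ _ _ _) (act _ _ _ _ _).
move=> t1 t2 t3 t4.
rewrite !sgE !oddzE; case: (oddz d); case: (oddz e);
  rewrite /= ?expr0 ?expr1 ?scaleN1r ?scale1r ?opprK ?opprD ?opprK ?addrA;
  rewrite [RHS](ACl (1 * 3 * 4 * 2)) //=.
Qed.

Lemma partial_partial (x : Cbar h) : (2%:R : K) != 0 -> D (D x) = 0.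
Proof.
have [lD _] := hD; move=> nz2; apply: (@linear_zero K _ g (D \o D)).
  by move=> k u v; rewrite /= !lD.
move=> d {}x hx /=; apply: ev_inj => w t hw; rewrite ev0.
have [dDx DxE] := susp_D hx; have [_ ->] // := susp_D dDx.
rewrite (eq_coder_hom hw (@quad_deg _ _) (fun _ _ => erefl) (fun u hu => DxE u t hu)).
have [_ hdx sx] := goodP x.
by rewrite coderZ coder_quad_quad // !scaler0.
Qed.

Lemma cochains_dgla : (2%:R : K) != 0 -> is_dgla (g := g) bk D.
Proof.
move=> nz2; have [lD _] := hD; have [ll lr _] := hbk; split=> //.
- by move=> d e x y hx hy; have [] := susp_br hx hy.
- exact: bracket_anti.
- exact: bracket_jacobi.
- by move=> d x hx; have [] := susp_D hx.
- by move=> x; apply: partial_partial.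
- exact: bracket_leibniz.
Qed.

(** For [L] of suspended degree 1 the two products in [L, L]^c are equal, and
    the factor 1/2 leaves one of them. *)
Lemma maurer_cartanE (L : Cbar h) : (2%:R : K) != 0 -> homog 0 L ->
  (maurer_cartan (g := g) bk D L <-> forall w t, hletters w ->
     act 1 (ev L) (ev L) w t = - coder 1 (@quad _ _) w (fun u => ev L u t)).
Proof.
move=> nz2 hL; have hL1 : homog (V := g) 1 L by [].
have [_ DLE] := susp_D hL1; have [_ LLE] := susp_br hL1 hL1.
have mcE w t : hletters w -> ev (D L + 2%:R^-1 *: bk L L) w t =
    - (coder 1 (@quad _ _) w (fun u => ev L u t) + act 1 (ev L) (ev L) w t).
  move=> hw; rewrite evD evZ DLE // LLE // /bracket_val mulr1 sg1 !scaleN1r.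
  rewrite opprK -mulr2n -scaler_nat scalerN scalerA mulVf // scale1r.
  by rewrite -opprD.
split=> [[_ mc] w t hw|mc]; last first.
  split=> //; apply: ev_inj => w t hw; rewrite ev0 mcE // mc //.
  by rewrite subrr oppr0.
apply/eqP; rewrite -addr_eq0 addrC -oppr_eq0 -mcE //.
by apply/eqP; rewrite -[RHS](ev0 w t); congr ev.
Qed.

End Dgla.
End Cochains.

(** * Sums over shuffles are unshuffle sums *)

Section Letters.
Context (T : Type).

Lemma size_letters p (v : 'I_p -> T) : size (letters v) = p.
Proof. by rewrite size_map size_enum_ord. Qed.

Lemma nth_letters x0 p (v : 'I_p -> T) (k : 'I_p) : nth x0 (letters v) k = v k.
Proof. by rewrite (nth_map k) ?size_enum_ord // nth_ord_enum. Qed.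

Lemma lettersS p (v : 'I_p.+1 -> T) :
  letters v = v ord0 :: letters (fun k => v (lift ord0 k)).
Proof. by rewrite /letters enum_ordSl /= -map_comp. Qed.

Lemma letters0 (v : 'I_0 -> T) : letters v = [::].
Proof. by apply: size0nil; rewrite size_letters. Qed.

Lemma letters_nth x0 (w : seq T) p : size w = p ->
  letters (fun k : 'I_p => nth x0 w k) = w.
Proof.
move=> sw; apply: (@eq_from_nth _ x0); rewrite size_letters ?sw // => k kp.
by rewrite -[k]/(nat_of_ord (Ordinal kp)) nth_letters.
Qed.

Lemma map_letters T' (f : T -> T') p (v : 'I_p -> T) :
  map f (letters v) = letters (fun k => f (v k)).
Proof. by rewrite /letters -map_comp. Qed.

(** A permutation is determined by the position [i] given to the first letter
    and by the order [s] of the other ones. *)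
Lemma permuted_lift p (v : 'I_p.+1 -> T) (i : 'I_p.+1) (s : 'S_p) :
  let u := permuted (fun k => v (lift ord0 k)) s in
  permuted v (lift_perm i ord0 s) = take i u ++ v ord0 :: drop i u.
Proof.
move=> u; have su : size u = p by rewrite size_letters.
have ip : (i <= p)%N by rewrite -ltnS.
apply: (@eq_from_nth _ (v ord0)).
  by rewrite size_letters size_cat /= addnS -size_cat cat_take_drop su.
rewrite size_letters => k kp; rewrite -[k]/(nat_of_ord (Ordinal kp)).
rewrite nth_letters nth_cat size_takel ?su //.
have [k' kE|<-] := unliftP i (Ordinal kp); last by rewrite lift_perm_id ltnn subnn.
rewrite {}kE lift_perm_lift /=.
rewrite -[v _](nth_letters (v ord0) (fun k => v (lift ord0 (s k)))).
rewrite -/(permuted _ _) -/u.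
rewrite /bump; have [ik|ki] := leqP i k'.
  by rewrite ltnNge leqW //= subSn //= nth_drop subnKC.
by rewrite add0n ki nth_take.
Qed.

End Letters.

Section Shuffles.
Context (K : fieldType).
Local Notation sg := (sg K).

Lemma sum_lift_perm (M : nmodType) p (f : 'S_p.+1 -> M) :
  \sum_t f t = \sum_(i < p.+1) \sum_(s : 'S_p) f (lift_perm i ord0 s).
Proof.
rewrite pair_bigA /=; apply: reindex => /=.
apply: onW_bij; apply: inj_card_bij; last first.
  by rewrite card_prod card_ord !card_Sn factS.
move=> [i s] [j t] /= /permP E.
have ij : i = j.
  have := E i; rewrite lift_perm_id; have [k ->|->//] := unliftP j i.
  rewrite lift_perm_lift => /eqP.
  by rewrite (negPf (neq_lift _ _)).
subst j; congr (_, _); apply/permP => k.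
by have := E (lift i k); rewrite !lift_perm_lift => /lift_inj.
Qed.

Lemma lift_lt p (i : 'I_p.+1) (a b : 'I_p) : (lift i a < lift i b)%N = (a < b)%N.
Proof. by rewrite /= /bump; lia. Qed.

(** The inversions that involve the first letter are those with the letters
    placed before it. *)
Lemma koszul_lift p (d : 'I_p.+1 -> int) (i : 'I_p.+1) (s : 'S_p) :
  koszul K d (lift_perm i ord0 s) =
  sg (d ord0 * \sum_(k < p | (k < i)%N) d (lift ord0 (s k)))
  * koszul K (fun k => d (lift ord0 k)) s.
Proof.
rewrite /koszul (bigD1_ord i) //= big1 ?mul1r; last first.
  by move=> j /andP[_]; rewrite lift_perm_id.
rewrite mulr_sumr.
have -> : sg (\sum_(k < p | (k < i)%N) d ord0 * d (lift ord0 (s k))) =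
    \prod_(k < p) (if (k < i)%N then sg (d ord0 * d (lift ord0 (s k))) else 1).
  rewrite -big_mkcond; apply: (big_morph (fun z => sg z)); last exact: sg0.
  exact: sgD.
rewrite -big_split; apply: eq_bigr => k _ /=.
rewrite big_mkcond (bigD1_ord i) //=; congr (_ * _).
  rewrite lift_perm_id lift_perm_lift /= andbT.
  rewrite (_ : (bump i k < i)%N = (k < i)%N); last by rewrite /bump; lia.
  by rewrite mulrC.
rewrite [RHS]big_mkcond; apply: eq_bigr => j _ /=.
by rewrite !lift_perm_lift !lift_lt.
Qed.

Context (V : gvs K).
Local Notation letter := (int * V)%type.
Local Notation word := (seq (int * V)).

Lemma wdeg_letters p (v : 'I_p -> letter) : wdeg (letters v) = \sum_k (v k).1.
Proof. by rewrite /wdeg big_map big_enum. Qed.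

Lemma wdeg_take_letters p (v : 'I_p -> letter) n :
  wdeg (take n (letters v)) = \sum_(k < p | (k < n)%N) (v k).1.
Proof.
elim: p v n => [|p IH] v n; first by rewrite letters0 big_ord0 wdeg0.
rewrite lettersS big_mkcond big_ord_recl; case: n => [|n].
  by rewrite take0 wdeg0 big1 ?add0r.
by rewrite /= wdegS IH big_mkcond.
Qed.

Lemma wdeg_drop_letters p (v : 'I_p -> letter) n :
  wdeg (drop n (letters v)) = \sum_(k < p | (n <= k)%N) (v k).1.
Proof.
apply: (@addrI _ (wdeg (take n (letters v)))).
rewrite -wdeg_cat cat_take_drop wdeg_letters wdeg_take_letters.
rewrite (bigID (fun k : 'I_p => (k < n)%N)) /=.
by congr (_ + _); apply: eq_bigl => k; rewrite -leqNgt.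
Qed.

Definition unsh3 (M : lmodType K) (w : word) (F : word -> word -> word -> M) : M :=
  unsh w (fun a b => unsh b (fun c r => F a c r)).

(** The first letter joins one of three factors, crossing the factors before.
    *)
Lemma unsh3S (M : lmodType K) x w (F : word -> word -> word -> M) :
  unsh3 (x :: w) F =
  unsh3 w (fun a c r => F (x :: a) c r)
  + unsh3 w (fun a c r => sg (x.1 * wdeg a) *: F a (x :: c) r)
  + unsh3 w (fun a c r => sg (x.1 * (wdeg a + wdeg c)) *: F a c (x :: r)).
Proof.
rewrite /unsh3 /= -addrA; congr (_ + _); rewrite -unshD.
apply: eq_unsh => a b _; rewrite scalerDr -!unshZ; congr (_ + _).
by apply: eq_unsh => c d _; rewrite scalerA -sgD mulrDr.
Qed.

(** The number of the block that contains the position [i], for three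
    consecutive blocks of which the first two have sizes [l0] and [l1]. *)
Definition block (l0 l1 i : nat) : nat := ((l0 <= i) + (l0 + l1 <= i))%N.

Definition increasing_on p (c : nat -> nat) (s : 'S_p) : bool :=
  [forall i : 'I_p, forall j : 'I_p, ((i < j)%N && (c i == c j)) ==> (s i < s j)%N].

Lemma increasing_onP p (c : nat -> nat) (s : 'S_p) :
  reflect (forall i j : 'I_p, (i < j)%N -> c i = c j -> (s i < s j)%N)
    (increasing_on c s).
Proof.
apply: (iffP forallP) => [H i j ij cij|H i].
  by have /forallP/(_ j)/implyP := H i; apply; rewrite ij cij eqxx.
apply/forallP => j; apply/implyP => /andP[ij /eqP cij]; exact: H.
Qed.

(** The value 0 is the smallest one, so that in an increasing block it can
    only be taken at the first position. *)
Lemma increasing_on_lift p (c : nat -> nat) (i : 'I_p.+1) (s : 'S_p) :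
  increasing_on c (lift_perm i ord0 s) =
  [forall j : 'I_p.+1, (j < i)%N ==> (c j != c i)]
  && increasing_on (fun k => c (bump i k)) s.
Proof.
apply/increasing_onP/andP => [H|[/forallP H1 /increasing_onP H2] a b].
  split.
    apply/forallP => j; apply/implyP => ji; apply/eqP => cji.
    by have := H j i ji cji; rewrite lift_perm_id.
  apply/increasing_onP => a b ab cab.
  by have := H (lift i a) (lift i b); rewrite !lift_perm_lift !lift_lt; apply.
have [a' ->|->] := unliftP i a; have [b' ->|->] := unliftP i b.
- by rewrite !lift_perm_lift !lift_lt; apply: H2.
- by move=> ai cai; have /implyP/(_ ai) := H1 (lift i a'); rewrite cai eqxx.
- by rewrite lift_perm_id lift_perm_lift.
- by rewrite ltnn.
Qed.

Lemma shuffles3E p l0 l1 l2 (s : 'S_p) :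
  (s \in shuffles p [:: l0; l1; l2]) =
  (l0 + l1 + l2 == p)%N && increasing_on (block l0 l1) s.
Proof.
rewrite inE /= addn0 addnA; case: eqP => //= sp.
apply: eq_forallb => i; apply: eq_forallb => j; congr (_ && _ ==> _).
have riE (k : 'I_p) : reshape_index [:: l0; l1; l2] k = block l0 l1 k.
  have := ltn_ord k; rewrite -{2}sp /reshape_index /block /=.
  by do 3?[case: eqP => /=]; lia.
by rewrite !riE.
Qed.

(** Two blocks are three blocks of which the last one is empty, so that only
    sums over three blocks have to be studied. *)
Lemma shuffles2E p l0 l1 (s : 'S_p) :
  (s \in shuffles p [:: l0; l1]) = (s \in shuffles p [:: l0; l1; 0%N]).
Proof.
rewrite shuffles3E inE /= !addn0; case: eqP => //= sp.
apply: eq_forallb => i; apply: eq_forallb => j; congr (_ && _ ==> _).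
have riE (k : 'I_p) : reshape_index [:: l0; l1] k = block l0 l1 k.
  have := ltn_ord k; rewrite -{2}sp /reshape_index /block /=.
  by do 3?[case: eqP => /=]; lia.
by rewrite !riE.
Qed.

Section ShuffleSum.
Context (M : lmodType K).

Let sum_at p m (b : bool) (A : M) : (b -> m < p)%N ->
  \sum_(i < p) (if (i == m :> nat) && b then A else 0) = if b then A else 0.
Proof.
case: b => [|_]; last by rewrite big1 // => i _; rewrite andbF.
move=> /(_ isT) mp; rewrite -big_mkcond (big_pred1 (Ordinal mp)) // => i.
by rewrite andbT.
Qed.

Let unsh3_0 w : unsh3 w (fun _ _ _ => 0 : M) = 0.
Proof. by rewrite /unsh3 -[RHS](unsh0 M w); apply: eq_unsh => a b _; apply: unsh0. Qed.

Let eq_unsh3_size w (F G : word -> word -> word -> M) :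
  (forall a c r, (size w = size a + size c + size r)%N -> F a c r = G a c r) ->
  unsh3 w F = unsh3 w G.
Proof.
move=> FG; apply: eq_unsh_size => a b _ wE; apply: eq_unsh_size => c r _ bE.
by apply: FG; rewrite wE bE addnA.
Qed.

Let notin_lift p l0 l1 l2 (i : 'I_p.+1) s : (0 < i)%N ->
  block l0 l1 i.-1 = block l0 l1 i ->
  (lift_perm i ord0 s \in shuffles p.+1 [:: l0; l1; l2]) = false.
Proof.
move=> i0 bE; rewrite shuffles3E increasing_on_lift.
(* the position before [i] is in the same block *)
have jp : (i.-1 < p.+1)%N by have := ltn_ord i; lia.
rewrite (_ : [forall j, _] = false) ?andbF //; apply/forallP.
by move=> /(_ (Ordinal jp)); rewrite /= bE eqxx prednK // leqnn.
Qed.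

Let in_lift p l0 l1 l2 m0 m1 m2 (i : 'I_p.+1) (s : 'S_p) :
  (l0 + l1 + l2 = p.+1)%N -> (m0 + m1 + m2 = p)%N ->
  (forall k, (k < p)%N -> block l0 l1 (bump i k) = block m0 m1 k) ->
  (forall j, (j < i)%N -> block l0 l1 j != block l0 l1 i) ->
  (lift_perm i ord0 s \in shuffles p.+1 [:: l0; l1; l2]) =
  (s \in shuffles p [:: m0; m1; m2]).
Proof.
move=> sl sm bE bN; rewrite !shuffles3E sl sm !eqxx /= increasing_on_lift.
rewrite (_ : [forall j, _] = true) /=; last first.
  by apply/forallP => j; apply/implyP; apply: bN.
by apply/increasing_onP/increasing_onP => H a b ab cab; apply: H => //;
  move: cab; rewrite !bE.
Qed.

(** By induction on the length: a shuffle puts the first letter at the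
    beginning of one of the three blocks, which corresponds to the three terms
    of [unsh3S], and it restricts to a shuffle of the other letters. *)
Lemma shuffle_sum3 p (v : 'I_p -> letter) l0 l1 l2 (F : word -> word -> word -> M) :
  \sum_(s in shuffles p [:: l0; l1; l2])
    koszul K (fun k => (v k).1) s *:
      (let u := permuted v s in
       F (take l0 u) (take l1 (drop l0 u)) (drop l1 (drop l0 u))) =
  unsh3 (letters v) (fun a c r =>
    if [&& size a == l0, size c == l1 & size r == l2] then F a c r else 0).
Proof.
have [sp|nsp] := eqVneq (l0 + l1 + l2)%N p; last first.
  rewrite big_pred0 => [|s]; last by rewrite shuffles3E (negPf nsp).
  rewrite -(unsh3_0 (letters v)); apply: eq_unsh3_size => a c r.
  rewrite size_letters => pE; case: and3P => // -[/eqP al /eqP cl /eqP rl].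
  by move: nsp; rewrite pE al cl rl eqxx.
elim: p v l0 l1 l2 F sp => [|p IH] v l0 l1 l2 F sp.
  rewrite letters0 /unsh3 /=.
  have [-> -> ->] : [/\ l0 = 0%N, l1 = 0%N & l2 = 0%N] by split; lia.
  rewrite (big_pred1 (1%g : 'S_0)) => [|s]; last first.
    rewrite shuffles3E /= (_ : increasing_on _ _ = true).
      by apply/esym/eqP/permP => -[].
    by apply/increasing_onP => -[].
  by rewrite /koszul big_ord0 scale1r /permuted letters0.
rewrite big_mkcond sum_lift_perm lettersS unsh3S.
set x := v ord0; set v' := fun k => v (lift ord0 k).
set A := unsh3 _ _; set B := unsh3 _ _; set C := unsh3 _ _.
(* the first letter may go to the first position of any nonempty block *)
transitivity (\sum_(i < p.+1) (
   (if (i == 0 :> nat)%N && (0 < l0)%N then A else 0)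
 + (if (i == l0 :> nat) && (0 < l1)%N then B else 0)
 + (if (i == (l0 + l1)%N :> nat) && (0 < l2)%N then C else 0))); last first.
  rewrite !big_split /= !sum_at; try lia.
  congr (_ + _ + _); case: ltnP => //; rewrite leqn0 => /eqP l0E.
  - by rewrite /A -[LHS](unsh3_0 (letters v')); apply: eq_unsh3_size => a c r _; rewrite l0E.
  - rewrite /B -[LHS](unsh3_0 (letters v')); apply: eq_unsh3_size => a c r _.
    by rewrite l0E /= ?andbF ?scaler0.
  - rewrite /C -[LHS](unsh3_0 (letters v')); apply: eq_unsh3_size => a c r _.
    by rewrite l0E; case: and3P => [[_ _ /eqP]|_]; rewrite ?scaler0.
apply: eq_bigr => i _; have ip := ltn_ord i.
have [il|li] := ltnP i l0.
  rewrite [X in _ + X + _]ifN ?addr0; last by rewrite negb_and; lia.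
  rewrite [X in _ + X]ifN ?addr0; last by rewrite negb_and; lia.
  have [i0|i0] := posnP i; last first.
    rewrite /= big1 //.
    by move=> s _; rewrite notin_lift // /block; lia.
  case: l0 sp @A @B @C il => // l0 sp A B C il.
  rewrite /= /A -(IH v' l0 l1 l2 (fun a c r => F (x :: a) c r)); last lia.
  rewrite [RHS]big_mkcond; apply: eq_bigr => s _.
  rewrite (@in_lift _ _ _ _ l0 l1 l2) //; try (by rewrite /block /bump; lia).
  case: ifP => // _; rewrite koszul_lift permuted_lift i0 take0 drop0 /=.
  by rewrite big_pred0 // mulr0 sg0 mul1r.
rewrite [X in X + _ + _]ifN ?add0r; last by rewrite negb_and; lia.
have [il|li2] := ltnP i (l0 + l1)%N.
  rewrite [X in _ + X]ifN ?addr0; last by rewrite negb_and; lia.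
  have [i0|i0] := eqVneq (i : nat) l0; last first.
    rewrite big1 //=; move=> s _.
    by rewrite notin_lift // /block; lia.
  case: l1 sp @A @B @C il => [|l1] sp A B C il; first by lia.
  have -> : B = unsh3 (letters v') (fun a c r =>
      if [&& size a == l0, size c == l1 & size r == l2]
      then sg (x.1 * wdeg a) *: F a (x :: c) r else 0).
    by apply: eq_unsh3_size => a c r _; rewrite /= eqSS; case: ifP; rewrite ?scaler0.
  rewrite /= -(IH v' l0 l1 l2 (fun a c r => sg (x.1 * wdeg a) *: F a (x :: c) r));
    last lia.
  rewrite [RHS]big_mkcond; apply: eq_bigr => s _.
  rewrite (@in_lift _ _ _ _ l0 l1 l2) //; try (by rewrite /block /bump; lia).
  case: ifP => // _; rewrite koszul_lift permuted_lift i0.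
  have su : size (permuted v' s) = p by rewrite size_letters.
  have st : size (take l0 (permuted v' s)) = l0 by rewrite size_takel // su; lia.
  rewrite /= take_size_cat // drop_size_cat //= wdeg_take_letters.
  by rewrite scalerA mulrC.
rewrite [X in X + _]ifN ?add0r; last by rewrite negb_and; lia.
have [i0|i0] := eqVneq (i : nat) (l0 + l1)%N; last first.
  rewrite big1 //=; move=> s _.
  by rewrite notin_lift // /block; lia.
case: l2 sp @A @B @C => [|l2] sp A B C; first by lia.
have -> : C = unsh3 (letters v') (fun a c r =>
    if [&& size a == l0, size c == l1 & size r == l2]
    then sg (x.1 * (wdeg a + wdeg c)) *: F a c (x :: r) else 0).
  by apply: eq_unsh3_size => a c r _; rewrite /= eqSS; case: ifP; rewrite ?scaler0.
rewrite /= -(IH v' l0 l1 l2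
  (fun a c r => sg (x.1 * (wdeg a + wdeg c)) *: F a c (x :: r))); last lia.
rewrite [RHS]big_mkcond; apply: eq_bigr => s _.
rewrite (@in_lift _ _ _ _ l0 l1 l2) //; try (by rewrite /block /bump; lia).
case: ifP => // _; rewrite koszul_lift permuted_lift i0.
have su : size (permuted v' s) = p by rewrite size_letters.
have st : size (take l0 (permuted v' s)) = l0 by rewrite size_takel // su; lia.
have st1 : size (take l1 (drop l0 (permuted v' s))) = l1.
  by rewrite size_takel // size_drop su; lia.
rewrite takeD -catA addnC -drop_drop /= !(take_size_cat, drop_size_cat) //.
rewrite -wdeg_cat -takeD wdeg_take_letters.
by rewrite scalerA mulrC (addnC l1).
Qed.

End ShuffleSum.
End Shuffles.

(** * Sums over all block sizes and over pairs *)

Section Sums.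
Context (K : fieldType) (V : gvs K) (M : lmodType K).
Local Notation letter := (int * V)%type.
Local Notation word := (seq (int * V)).
Local Notation sg := (sg K).

Lemma unsh_nill (w : word) (F : word -> M) :
  unsh w (fun a b => if nilp a then F b else 0) = F w.
Proof.
rewrite unshC -[RHS](unsh_nilr w F); apply: eq_unsh => a [|z b] _ /=.
  by rewrite wdeg0 mulr0 sg0 scale1r.
by rewrite scaler0.
Qed.

(** Summing over all sizes of the blocks removes the size condition of
    [shuffle_sum3]. *)
Lemma shuffle_sum2_all p (v : 'I_p -> letter) (F : word -> word -> M) :
  \sum_(l < p.+1) \sum_(s in shuffles p [:: l : nat; (p - l)%N])
    koszul K (fun k => (v k).1) s *:
      F (take l (permuted v s)) (drop l (permuted v s)) =
  unsh (letters v) F.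
Proof.
transitivity (\sum_(l < p.+1) unsh3 (letters v) (fun a c r =>
    if [&& size a == l, size c == (p - l)%N & size r == 0%N] then F a c else 0)).
  apply: eq_bigr => l _; rewrite -(shuffle_sum3 v l (p - l) 0 (fun a c _ => F a c)).
  apply: eq_big => s; first exact: shuffles2E.
  by move=> _ /=; rewrite [take (p - l) _]take_oversize // size_drop size_letters.
rewrite -[RHS](eq_unsh (F := fun a b =>
  unsh b (fun c r => if nilp r then F a c else 0))); last first.
  by move=> a b _; apply: unsh_nilr.
rewrite /unsh3 -unsh_sum; apply: eq_unsh_size => a b _ wE; rewrite -unsh_sum.
apply: eq_unsh_size => c r _ bE.
rewrite size_letters in wE; rewrite /nilp; have [r0|r0] := eqVneq; last first.
  by rewrite big1 // => l _; rewrite !andbF.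
have ap : (size a < p.+1)%N by lia.
rewrite (bigD1 (Ordinal ap)) //= eqxx big1 ?addr0 => [|l].
  by rewrite ifT //; lia.
by rewrite -(inj_eq val_inj) /= => la; rewrite ifN //; lia.
Qed.

Lemma shuffle_sum3_all x0 p (v : 'I_p -> letter) (F : word -> letter -> word -> M) :
  \sum_(l < p.+1) \sum_(s in shuffles p [:: l : nat; 1%N; (p - l - 1)%N])
    koszul K (fun k => (v k).1) s *:
      (let u := permuted v s in F (take l u) (nth x0 u l) (drop l.+1 u)) =
  unsh3 (letters v) (fun a c r => single (fun z => F a z r) c).
Proof.
transitivity (\sum_(l < p.+1) unsh3 (letters v) (fun a c r =>
    if [&& size a == l, size c == 1%N & size r == (p - l - 1)%N] then
      single (fun z => F a z r) c else 0)).
  apply: eq_bigr => l _.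
  rewrite -(shuffle_sum3 v l 1 (p - l - 1) (fun a c r => single (fun z => F a z r) c)).
  apply: eq_bigr => s; rewrite shuffles3E => /andP[/eqP lp _].
  have lu : (l < size (permuted v s))%N by rewrite size_letters; lia.
  by rewrite /= (drop_nth x0 lu) /= take0 drop0.
rewrite /unsh3 -unsh_sum; apply: eq_unsh_size => a b _ wE; rewrite -unsh_sum.
rewrite size_letters in wE.
apply: eq_unsh_size => -[|z [|z' c]] r _ bE /=.
- by rewrite big1 // => l _; rewrite andbF.
- have ap : (size a < p.+1)%N by lia.
  rewrite (bigD1 (Ordinal ap)) //= eqxx big1 ?addr0 => [|l].
    by rewrite ifT //=; move: bE => /=; lia.
  by rewrite -(inj_eq val_inj) /= => la; rewrite ifN //; lia.
- by rewrite big1 // => l _; rewrite andbF.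
Qed.

Lemma sum_kl p (g : nat -> nat -> M) :
  \sum_(k < p.+2 | (0 < k)%N) \sum_(l < p.+2 | (k + l == p.+1)%N) g k l =
  \sum_(k < p.+1) g k.+1 (p - k)%N.
Proof.
rewrite big_mkcond big_ord_recl /= add0r; apply: eq_bigr => k _.
have lp : (p - k < p.+2)%N by lia.
rewrite (big_pred1 (Ordinal lp)) // => l /=.
by rewrite -(inj_eq val_inj) /=; have := ltn_ord k; rewrite /bump /=; lia.
Qed.

Lemma sum_rev p (g : nat -> M) :
  \sum_(k < p.+1) g (p - k)%N = \sum_(k < p.+1) g k.
Proof.
rewrite (reindex_inj rev_ord_inj) /=; apply: eq_bigr => k _; congr g.
by have := ltn_ord k; lia.
Qed.

Lemma sum_ij p (b : pred nat) (g : nat -> nat -> M) :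
  \sum_(i < p.+2 | (1 <= i)%N) \sum_(j < p.+2 | (i + j == p.+2)%N && b j) g i j =
  \sum_(i < p.+1) if b (p.+1 - i)%N then g i.+1 (p.+1 - i)%N else 0.
Proof.
rewrite big_mkcond big_ord_recl /= add0r; apply: eq_bigr => i _.
have lp : (p.+1 - i < p.+2)%N by lia.
rewrite big_mkcond (bigD1 (Ordinal lp)) //= big1 ?addr0 => [|j].
  rewrite (_ : (_ + _ == _)%N = true) //.
  by have := ltn_ord i; rewrite /bump /=; lia.
rewrite -(inj_eq val_inj) /= => ji; rewrite ifN //.
by move: ji; have := ltn_ord i; rewrite /bump /=; lia.
Qed.

Section Pairs.

Definition omit1 (T : Type) p (v : 'I_p -> T) (i : 'I_p) : seq T :=
  [seq v k | k <- enum 'I_p & k != i].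

Lemma omit1_0 (T : Type) p (v : 'I_p.+1 -> T) :
  omit1 v ord0 = letters (fun k => v (lift ord0 k)).
Proof.
rewrite /omit1 enum_ordSl /= filter_map -map_comp; congr map.
by apply/all_filterP/allP.
Qed.

Lemma omit1_lift (T : Type) p (v : 'I_p.+1 -> T) i :
  omit1 v (lift ord0 i) = v ord0 :: omit1 (fun k => v (lift ord0 k)) i.
Proof.
rewrite /omit1 enum_ordSl /= filter_map -map_comp; congr (_ :: map _ _).
Qed.

Lemma omit2_0 (T : Type) p (v : 'I_p.+1 -> T) j :
  omit2 v ord0 (lift ord0 j) = omit1 (fun k => v (lift ord0 k)) j.
Proof.
rewrite /omit2 enum_ordSl /= filter_map -map_comp; congr map.
Qed.

Lemma omit2_lift (T : Type) p (v : 'I_p.+1 -> T) i j :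
  omit2 v (lift ord0 i) (lift ord0 j)
  = v ord0 :: omit2 (fun k => v (lift ord0 k)) i j.
Proof.
rewrite /omit2 enum_ordSl /= filter_map -map_comp; congr (_ :: map _ _).
Qed.

Lemma sum_ltS p (f : 'I_p.+1 -> int) (i : 'I_p) :
  \sum_(k < p.+1 | (k < lift ord0 i)%N) f k =
  f ord0 + \sum_(k < p | (k < i)%N) f (lift ord0 k).
Proof. by rewrite big_mkcond big_ord_recl /= [in RHS]big_mkcond. Qed.

(** The terms of the coproduct with a single letter in the first factor, as a
    sum over the positions of this letter. *)
Lemma pick1_letters p (v : 'I_p -> letter) (F : letter -> word -> M) :
  unsh (letters v) (fun a r => single (fun z => F z r) a) =
  \sum_(i < p) sg ((v i).1 * \sum_(k < p | (k < i)%N) (v k).1) *: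
    F (v i) (omit1 v i).
Proof.
elim: p v F => [|p IH] v F; first by rewrite letters0 big_ord0.
rewrite lettersS unshS big_ord_recl; congr (_ + _).
  rewrite omit1_0 big_pred0 // mulr0 sg0 scale1r.
  rewrite -[RHS]unsh_nill; apply: eq_unsh => a b _; exact: single_cons.
pose F' z r := sg ((v ord0).1 * z.1) *: F z (v ord0 :: r).
transitivity (unsh (letters (fun k => v (lift ord0 k)))
                (fun a r => single (fun z => F' z r) a)).
  apply: eq_unsh => -[|z [|? ?]] b _ /=; rewrite ?scaler0 //.
  by rewrite wdegS wdeg0 addr0.
rewrite IH; apply: eq_bigr => i _; rewrite /F' omit1_lift sum_ltS; sgn.
Qed.

(** The terms of the coproduct with two letters in the first factor; the sign
    is that of moving both letters to the front. *)
Lemma pick2_letters p (v : 'I_p -> letter) (F : letter -> letter -> word -> M) :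
  unsh (letters v) (fun a r => if a is [:: y; z] then F y z r else 0) =
  \sum_(i < p) \sum_(j < p | (i < j)%N)
    sg (front_exp (fun k => (v k).1) i j) *: F (v i) (v j) (omit2 v i j).
Proof.
elim: p v F => [|p IH] v F; first by rewrite letters0 big_ord0.
rewrite lettersS unshS big_ord_recl; congr (_ + _).
  transitivity (unsh (letters (fun k => v (lift ord0 k)))
                  (fun a r => single (fun z => F (v ord0) z r) a)).
    by apply: eq_unsh => -[|z [|? ?]].
  rewrite pick1_letters big_mkcond [RHS]big_mkcond [RHS]big_ord_recl /= add0r.
  apply: eq_bigr => j _; rewrite omit2_0 /front_exp sum_ltS.
  by rewrite [X in (v ord0).1 * X]big_pred0 // mulr0 add0r mulrDr; sgn.
pose F' y z r := sg ((v ord0).1 * (y.1 + z.1)) *: F y z (v ord0 :: r).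
transitivity (unsh (letters (fun k => v (lift ord0 k)))
                (fun a r => if a is [:: y; z] then F' y z r else 0)).
  apply: eq_unsh => -[|y [|z [|? ?]]] b _ /=; rewrite ?scaler0 //.
  by rewrite !wdegS wdeg0 addr0.
rewrite IH; apply: eq_bigr => i _; rewrite [RHS]big_mkcond big_ord_recl /= add0r.
rewrite big_mkcond; apply: eq_bigr => j _.
rewrite [in RHS]/bump !leq0n !add1n ltnS; case: ifP => // _.
rewrite /F' omit2_lift /front_exp !sum_ltS !mulrDr; sgn.
Qed.

End Pairs.
End Sums.

(** * The defining formulas as unshuffle sums *)

Section Formulas.
Context (K : fieldType) (h : sgLa K).
Local Notation letter := (int * h)%type.
Local Notation word := (seq (int * h)).
Local Notation sg := (sg K).
Local Notation br := (@sg_br K h).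
Implicit Types (w u : word) (y : h).

Definition tag p (d : 'I_p -> int) (v : 'I_p -> h) (k : 'I_p) : letter := (d k, v k).

Lemma tagged_word p w : size w = p -> hletters w ->
  exists d v, homog_fam v d /\ letters (@tag p d v) = w.
Proof.
move=> sw hw; exists (fun k => (nth (0, 0) w k).1), (fun k => (nth (0, 0) w k).2).
split=> [k|]; first by apply/hw/mem_nth; rewrite sw.
rewrite -[RHS](letters_nth (0, 0) sw) /letters; apply: eq_map => k.
by rewrite /tag -surjective_pairing.
Qed.

Lemma hletters_tag p d v : homog_fam v d -> hletters (letters (@tag p d v)).
Proof. by move=> hv x /mapP[k _ ->]; apply: hv. Qed.

Lemma snd_tag p d v : map snd (letters (@tag p d v)) = letters v.
Proof. by rewrite map_letters. Qed.

Lemma snd_permuted p d v s : map snd (permuted (@tag p d v) s) = permuted v s.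
Proof. by rewrite /permuted map_letters. Qed.

Lemma nth_snd w n : nth 0 (map snd w) n = (nth (0, 0) w n).2.
Proof. by elim: w n => [|x w IH] [|n] /=. Qed.

Lemma coder_vfield3 (M : lmodType K) N B w (G : word -> M) : head_lin G ->
  coder N (vfield B) w G =
  unsh3 w (fun a c r =>
    single (fun z : letter => G ((N + wdeg a + z.1, B a z.2) :: r)) c).
Proof.
move=> lG; rewrite /unsh3 -unshA; apply: eq_unsh => a b _.
rewrite (unsh_lin _ _ (lG _ _)); apply: eq_unsh => c e ->.
case: e => [|z [|? ?]] /=; rewrite ?(lin0 (lG _ _)) //.
by rewrite wdegS wdeg0 addr0 addrA.
Qed.

(** The convolution of the commutator of operators is the commutator of their
    convolution, by cocommutativity. *)
Lemma conv_gcomm M N (A B : word -> h -> h) w y :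
  unsh w (fun a b => sg (N * wdeg a) *:
    gcomm (M + wdeg a) (N + wdeg b) (A a) (B b) y) =
  unsh w (fun a b => sg (N * wdeg a) *: A a (B b y))
  - sg (M * N) *: unsh w (fun a b => sg (M * wdeg a) *: B a (A b y)).
Proof.
rewrite [X in _ - _ *: X]unshC -unshZ -unshB; apply: eq_unsh => a b _.
rewrite /gcomm scalerBr -[(-1) ^ _]/(sg _); congr (_ - _); sgn.
Qed.

Lemma bracket_valE M N (A B : word -> h -> h) w y :
  bracket_val M N A B w y =
  - coder N (vfield B) w (A^~ y) + sg (M * N) *: coder M (vfield A) w (B^~ y)
  - unsh w (fun a b => sg (N * wdeg a) *:
      gcomm (M + wdeg a) (N + wdeg b) (A a) (B b) y).
Proof.
rewrite conv_gcomm /bracket_val /act scalerDr !opprD !opprK.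
by rewrite [LHS]addrACA.
Qed.

Lemma ev_head_lin (a : Cbar h) y : head_lin (fun u => ev a u y).
Proof. exact/letter_head/ev_letter_linear. Qed.

(** The common form of the first two sums of the bracket and of the first sum
    of the homotopy identity: the block of size one is the letter acted upon.
    *)
Lemma insertion_sum (N : int) (a b : Cbar h) p d v y :
  \sum_(l < p.+1) \sum_(s in shuffles p [:: l : nat; 1%N; (p - l - 1)%N])
     (let w := permuted v s in
      koszul K d s *:
      sact (capp a (sact (capp b (take l w)) (nth 0 w l) :: drop l.+1 w)) y) =
  coder N (vfield (ev b)) (letters (@tag p d v)) (fun u => ev a u y).
Proof.
rewrite (coder_vfield3 _ _ _ (ev_head_lin a y)).
rewrite -(shuffle_sum3_all (0, 0) (tag d v) (fun a' z r =>
  ev a ((N + wdeg a' + z.1, ev b a' z.2) :: r) y)).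
apply: eq_bigr => l _; apply: eq_bigr => s _ /=; congr (_ *: _).
by rewrite /ev /= map_take map_drop snd_permuted -nth_snd snd_permuted.
Qed.

Lemma bracket_rhsE m n (a b : Cbar h) p (v : 'I_p -> h) d y :
  bracket_rhs m n a b v d y =
  bracket_val (m + 1) (n + 1) (ev a) (ev b) (letters (tag d v)) y.
Proof.
rewrite bracket_valE /bracket_rhs; congr (- _ + _ *: _ - _).
- rewrite -(insertion_sum _).
  rewrite (sum_kl p (fun k l => \sum_(s in shuffles p [:: l : nat; 1; p - l - 1]%N)
        (let w := permuted v s in
        koszul K d s *:
        sact (capp a (sact (capp b (take l w)) (nth 0 w l) :: drop l.+1 w)) y))).
  by rewrite (sum_rev p (fun l => \sum_(s in shuffles p [:: l : nat; 1; p - l - 1]%N)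
        (let w := permuted v s in
        koszul K d s *:
        sact (capp a (sact (capp b (take l w)) (nth 0 w l) :: drop l.+1 w)) y))).
- rewrite -(insertion_sum _).
  rewrite (sum_kl p (fun k l => \sum_(s in shuffles p [:: k - 1; 1; p - k]%N)
        (let w := permuted v s in
        koszul K d s *:
        sact (capp b (sact (capp a (take k.-1 w)) (nth 0 w k.-1) :: drop k w)) y))).
  apply: eq_bigr => k _; apply: eq_bigl => s.
  by rewrite subSS subn0 -subnDA addn1.
rewrite (sum_kl p (fun k l => \sum_(s in shuffles p [:: k - 1; l : nat]%N)
        (let w := permuted v s in
        ((-1) ^ ((n + 1) * deg_take d s k.-1) * koszul K d s) *:
        gcomm (m + 1 + deg_take d s k.-1) (n + 1 + deg_drop d s k.-1)
          (sact (capp a (take k.-1 w))) (sact (capp b (drop k.-1 w))) y))).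
rewrite -(shuffle_sum2_all (tag d v) (fun a' b' => sg ((n + 1) * wdeg a') *:
    gcomm (m + 1 + wdeg a') (n + 1 + wdeg b') (ev a a') (ev b b') y)).
apply: eq_bigr => k _; rewrite subSS subn0; apply: eq_bigr => s _ /=.
rewrite wdeg_take_letters wdeg_drop_letters scalerA mulrC.
by rewrite /ev map_take map_drop snd_permuted.
Qed.

Lemma is_bracketE (bk : Cbar h -> Cbar h -> Cbar h) : is_bracket bk <-> bracket_spec bk.
Proof.
split=> -[ll lr H]; split=> // m n a b ha hb; have [hab E] := H m n a b ha hb;
  split=> //.
  move=> w y hw; have [d [v [hv wE]]] := tagged_word (erefl (size w)) hw.
  by rewrite -wE -bracket_rhsE -E // /ev snd_tag.
move=> p v d hv y; rewrite bracket_rhsE -E; last exact: hletters_tag.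
by rewrite /ev snd_tag.
Qed.

Lemma sact_linear y : linear (fun x : desusp (Der h) => sact x y).
Proof.
move=> k x z; exact: (congr1 (fun f => f y)
  (dsum_valP k (smap x) (smap z))).
Qed.

Lemma sact_inj (x z : desusp (Der h)) : (forall y, sact x y = sact z y) -> x = z.
Proof. by move=> xz; apply: val_inj; apply/funext => y; apply: xz. Qed.

Lemma lin_sum (U W : lmodType K) (f : U -> W) I (r : seq I) (P : pred I) F :
  linear f -> f (\sum_(i <- r | P i) F i) = \sum_(i <- r | P i) f (F i).
Proof. by move=> lf; apply: (big_morph f); [exact: linD|exact: lin0]. Qed.

Lemma map_omit2 (T T' : Type) (f : T -> T') p (v : 'I_p -> T) i j :
  map f (omit2 v i j) = omit2 (fun k => f (v k)) i j.
Proof. by rewrite /omit2 -map_comp. Qed.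

Lemma coder_quad_pairs (b : Cbar h) p d v y :
  coder 1 (@quad _ _) (letters (@tag p d v)) (fun u => ev b u y) =
  \sum_(i < p) \sum_(j < p | (i < j)%N) sg (front_exp d i j) *:
    sact (capp b (br (v i) (v j) :: omit2 v i j)) y.
Proof.
(* [ev b] ignores the tags, so that the bracket may be tagged with 0 *)
rewrite /coder; transitivity (unsh (letters (tag d v)) (fun a r =>
    if a is [:: x; z] then ev b ((0, br x.2 z.2) :: r) y else 0)).
  apply: eq_unsh => -[|x [|z [|t a]]] r _ //; exact: (lin0 (ev_head_lin b y _ _)).
rewrite (pick2_letters _ (fun x z r => ev b ((0, br x.2 z.2) :: r) y)).
apply: eq_bigr => i _; apply: eq_bigr => j _; congr (_ *: _).
by rewrite /ev /= map_omit2.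
Qed.

Lemma partial_sumE n (b : Cbar h) p d v y :
  sact (\sum_(i < p) \sum_(j < p | (i < j)%N)
        (-1) ^ (n + 1 + front_exp d i j) *:
        capp b (br (v i) (v j) :: omit2 v i j)) y =
  sg (n + 1) *: coder 1 (@quad _ _) (letters (tag d v)) (fun u => ev b u y).
Proof.
rewrite (lin_sum _ _ _ (sact_linear y)) coder_quad_pairs scaler_sumr.
apply: eq_bigr => i _; rewrite (lin_sum _ _ _ (sact_linear y)) scaler_sumr.
apply: eq_bigr => j _; rewrite (linZ (sact_linear y)) scalerA -sgD.
by [].
Qed.

Lemma is_partialE (D : Cbar h -> Cbar h) : is_partial D <-> partial_spec D.
Proof.
split=> -[lD H]; split=> // n b hb; have [hDb E] := H n b hb; split=> //.
  move=> w y hw; have [d [v [hv wE]]] := tagged_word (erefl (size w)) hw.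
  by rewrite -wE -partial_sumE -E // /ev snd_tag.
move=> p v d hv; apply: sact_inj => y; rewrite partial_sumE -E; last exact: hletters_tag.
by rewrite /ev snd_tag.
Qed.

(** The homotopy identity only concerns homogeneous last arguments, which
    suffices as both sides are linear. *)
Lemma homotopyE (L : Cbar h) :
  theta_homotopy (theta_of L) <-> forall w y, hletters w ->
    act 1 (ev L) (ev L) w y = - coder 1 (@quad _ _) w (fun u => ev L u y).
Proof.
have E p (x : 'I_p -> h) d y : 
  \sum_(i < p.+2 | (1 <= i)%N) \sum_(j < p.+2 | (i + j == p.+2)%N && (2 <= j)%N)
    \sum_(s in shuffles p [:: i - 1; 1; j - 2]%N)
      (let w := permuted x s in
       koszul K d s *:
       theta_of L (theta_of L (take i.-1 w) (nth 0 w i.-1) :: drop i w) y)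
  + \sum_(i < p.+2 | (1 <= i)%N)
    \sum_(j < p.+2 | (i + j == p.+2)%N && (1 <= j)%N)
    \sum_(s in shuffles p [:: j - 1; i - 1]%N)
      (let w := permuted x s in
       ((-1) ^ (deg_take d s j.-1) * koszul K d s) *:
       theta_of L (take j.-1 w) (theta_of L (drop j.-1 w) y))
  = act 1 (ev L) (ev L) (letters (tag d x)) y.
  rewrite /act; congr (_ + _).
    rewrite -insertion_sum.
    rewrite (sum_ij p (leq 2) (fun i j => \sum_(s in shuffles p [:: i - 1; 1; j - 2]%N)
      (let w := permuted x s in
       koszul K d s *:
       theta_of L (theta_of L (take i.-1 w) (nth 0 w i.-1) :: drop i w) y))).
    apply: eq_bigr => i _; have ip := ltn_ord i.
    case: ifP => i2.
      apply: eq_big => [s|s _ //].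
      by rewrite (_ : (p.+1 - i - 2 = p - i - 1)%N) ?subn1 //; lia.
    rewrite big_pred0 // => s; rewrite shuffles3E.
    by rewrite (_ : (_ + _ + _ == _)%N = false) //; lia.
  rewrite (sum_ij p (leq 1) (fun i j => \sum_(s in shuffles p [:: j - 1; i - 1]%N)
      (let w := permuted x s in
       ((-1) ^ (deg_take d s j.-1) * koszul K d s) *:
       theta_of L (take j.-1 w) (theta_of L (drop j.-1 w) y)))).
  rewrite -(shuffle_sum2_all (tag d x) (fun a b => sg (1 * wdeg a) *: ev L a (ev L b y))).
  rewrite -[RHS](sum_rev p (fun l => \sum_(s in shuffles p [:: l; (p - l)%N])
      koszul K d s *: (sg (1 * wdeg (take l (permuted (tag d x) s))) *:
        ev L (take l (permuted (tag d x) s))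
             (ev L (drop l (permuted (tag d x) s)) y)))).
  apply: eq_bigr => i _; have ip := ltn_ord i; rewrite subn_gt0 ip.
  rewrite subSS subn0 subSn // subSS subn0 subKn //.
  apply: eq_bigr => s _ /=.
  rewrite mul1r wdeg_take_letters scalerA mulrC.
  by rewrite /ev map_take map_drop snd_permuted.
have E2 p (x : 'I_p -> h) d y :
  \sum_(i < p) \sum_(j < p | (i < j)%N)
      (-1) ^ (front_exp d i j + 1) *: theta_of L (br (x i) (x j) :: omit2 x i j) y
  = - coder 1 (@quad _ _) (letters (tag d x)) (fun u => ev L u y).
  rewrite coder_quad_pairs -sumrN; apply: eq_bigr => i _; rewrite -sumrN.
  by apply: eq_bigr => j _; rewrite sgN.
split=> [H w y hw|H p x d hx f y hy]; last first.
  by rewrite E E2; apply: H; apply: hletters_tag.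
have [d [v [hv <-]]] := tagged_word (erefl (size w)) hw.
apply: (linear_ext (f := act 1 (ev L) (ev L) (letters (tag d v)))
  (g := fun y => - coder 1 (@quad _ _) (letters (tag d v)) (fun u => ev L u y))).
- move=> k s t; rewrite /act scalerDr addrACA; congr (_ + _).
    by rewrite /coder -unshZ -unshD; apply: eq_unsh => a b _; apply: ev_linear.
  rewrite -unshZ -unshD; apply: eq_unsh => a b _.
  by rewrite ev_linear ev_linear scalerDr !scalerA mulrC.
- move=> k s t; rewrite scalerN -opprD; congr (- _).
  by rewrite /coder -unshZ -unshD; apply: eq_unsh => a b _; apply: ev_linear.
by move=> f t ht; rewrite -E -E2; apply: H hv _ _ ht.
Qed.

End Formulas.

(** * Extension from homogeneous elements *)

Section Components.
Context (K : fieldType) (V : gvs K) (M : lmodType K).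
Implicit Types (x y : V) (d : int) (f : int -> V -> M).

Definition gsupp x : seq int := sval (cid (decomp_ex x)).
Definition gcomp x : int -> V := sval (cid (svalP (cid (decomp_ex x)))).

Lemma gcompP x : decomp (gsupp x) (gcomp x) x.
Proof. exact: (svalP (cid (svalP (cid (decomp_ex x))))). Qed.

Lemma gcomp_homog x d : homog d (gcomp x d).
Proof. by have [_ H _ _] := gcompP x. Qed.

(** The extension to all vectors of maps given on the homogeneous components.
    *)
Definition gsum f x : M := \sum_(d <- gsupp x) f d (gcomp x d).

Definition linear_on d (g : V -> M) : Prop :=
  forall k x y, homog d x -> homog d y -> g (k *: x + y) = k *: g x + g y.

Lemma linear_on0 d g : linear_on d g -> g 0 = 0.
Proof.
move=> lg; have := lg (-1) 0 0 (sf_0 _ d) (sf_0 _ d).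
by rewrite scaleN1r addNr scaleN1r addNr.
Qed.

Lemma gsumE f x s u : (forall d, linear_on d (f d)) -> decomp s u x ->
  gsum f x = \sum_(d <- s) f d (u d).
Proof.
move=> lf du; have [us _ s0 _] := du; have [ut _ t0 _] := gcompP x.
have f0 d : f d 0 = 0 := linear_on0 (lf d).
have cE := decomp_uniq (gcompP x) du.
rewrite /gsum cE; pose r := undup (gsupp x ++ s).
rewrite -(@sum_supp M (gsupp x) r) -1?(@sum_supp M s r) ?undup_uniq //.
- by move=> d /s0->.
- by move=> d ds; rewrite mem_undup mem_cat ds orbT.
- by move=> d /t0; rewrite cE => ->.
- by move=> d ds; rewrite mem_undup mem_cat ds.
Qed.

Lemma decomp_widen s r u x : decomp s u x -> uniq r -> {subset s <= r} ->
  decomp r u x.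
Proof.
move=> [us hu s0 ->] ur sr; split=> // [d dr|].
  by apply: s0; apply: contra dr => /sr.
by rewrite (sum_supp us ur s0 sr).
Qed.

Lemma decomp_linear r k u v x y : decomp r u x -> decomp r v y ->
  decomp r (fun d => k *: u d + v d) (k *: x + y).
Proof.
move=> [ur hu u0 ->] [_ hv v0 ->]; split=> // [d|d dr|].
- by apply: sf_lin; [apply: hu|apply: hv].
- by rewrite u0 // v0 // scaler0 addr0.
- by rewrite big_split scaler_sumr.
Qed.

Lemma gsum_linear f : (forall d, linear_on d (f d)) -> linear (gsum f).
Proof.
move=> lf k x y; pose r := undup (gsupp x ++ gsupp y).
have ur : uniq r by apply: undup_uniq.
have dx : decomp r (gcomp x) x.
  by apply: decomp_widen (gcompP x) ur _ => d ds; rewrite mem_undup mem_cat ds.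
have dy : decomp r (gcomp y) y.
  by apply: decomp_widen (gcompP y) ur _ => d ds; rewrite mem_undup mem_cat ds orbT.
rewrite (gsumE lf (decomp_linear k dx dy)) (gsumE lf dx) (gsumE lf dy).
rewrite scaler_sumr -big_split; apply: eq_bigr => d _ /=.
by apply: lf; apply: gcomp_homog.
Qed.

Lemma gsum_homog f d x : (forall d, linear_on d (f d)) -> homog d x ->
  gsum f x = f d x.
Proof.
move=> lf hx; rewrite (gsumE (s := [:: d]) (u := fun e => if e == d then x else 0) lf).
  by rewrite big_seq1 eqxx.
split=> [//|e|e|]; last by rewrite big_seq1 eqxx.
  by case: eqP => [->|_] //; apply: sf_0.
by rewrite inE => /negPf->.
Qed.

Lemma eq_gsum f g x : (forall d y, homog d y -> f d y = g d y) -> gsum f x = gsum g x.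
Proof. by move=> fg; apply: eq_bigr => d _; apply: fg; apply: gcomp_homog. Qed.

Lemma gsum_linear_fun f g k x :
  gsum (fun d y => k *: f d y + g d y) x = k *: gsum f x + gsum g x.
Proof. by rewrite /gsum scaler_sumr -big_split. Qed.

End Components.

Section WordExtension.
Context (K : fieldType) (h : sgLa K) (M : lmodType K).
Local Notation letter := (int * h)%type.
Local Notation word := (seq (int * h)).
Local Notation sg := (sg K).
Implicit Types (u w : word) (v : seq h).

(** The symmetry of a post-Lie structure is only given for families of
    homogeneous vectors, whence the weaker form of [letter_sym]. *)
Definition hom_letter_sym (f : word -> M) : Prop :=
  forall u (x y : letter) w, hletters u -> hletters w ->
    homog x.1 x.2 -> homog y.1 y.2 ->
    f (u ++ x :: y :: w) = sg (x.1 * y.1) *: f (u ++ y :: x :: w).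

(** The extension of a function of tagged words to all words: the letters of
    [v] are expanded one by one into their homogeneous components, which are
    collected, with their tags, at the end of [u]. *)
Fixpoint word_ext (f : word -> M) u v : M :=
  if v is x :: v' then gsum (fun d y => word_ext f (rcons u (d, y)) v') x else f u.

Lemma hletters_cat u w : hletters u -> hletters w -> hletters (u ++ w).
Proof. by move=> hu hw x; rewrite mem_cat => /orP[/hu|/hw]. Qed.

Lemma hletters_rcons u x : hletters u -> homog x.1 x.2 -> hletters (rcons u x).
Proof. by move=> hu hx y; rewrite mem_rcons inE => /predU1P[->|/hu]. Qed.

Lemma word_ext_linl f v : letter_linear f -> letter_linear (fun u => word_ext f u v).
Proof.
move=> lf; elim: v => [|z v IH] u t k x y w //=.
rewrite -gsum_linear_fun; apply: eq_gsum => d z' _.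
by rewrite !rcons_cat !rcons_cons IH.
Qed.

Let word_ext_on f u v d : letter_linear f ->
  linear_on d (fun y => word_ext f (rcons u (d, y)) v).
Proof. by move=> lf k x y _ _; rewrite -!cats1; apply: (word_ext_linl v lf). Qed.

Lemma word_ext_syml f v : hom_letter_sym f ->
  hom_letter_sym (fun u => word_ext f u v).
Proof.
move=> sf; elim: v => [|z v IH] u x y w hu hw hx hy /=; first exact: sf.
rewrite -[RHS]addr0 -[X in _ + X](_ : gsum (fun _ _ => 0) z = 0); last exact: big1.
rewrite -gsum_linear_fun; apply: eq_gsum => d z' hz; rewrite addr0.
by rewrite !rcons_cat !rcons_cons IH //; apply: hletters_rcons.
Qed.

Lemma word_ext_linear f u : letter_linear f -> multilinear_on (word_ext f u).
Proof.
move=> lf v; elim: v u => [|z v IH] u v' k x y /=.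
  by apply: gsum_linear => d; apply: word_ext_on.
by rewrite -gsum_linear_fun; apply: eq_gsum => d z' _; apply: IH.
Qed.

Lemma word_ext_cons f u v d x : letter_linear f -> homog d x ->
  word_ext f u (x :: v) = word_ext f (rcons u (d, x)) v.
Proof. by move=> lf hx; apply: (gsum_homog _ hx) => e; apply: word_ext_on. Qed.

Lemma word_ext_hom f u w : letter_linear f -> hletters w ->
  word_ext f u (map snd w) = f (u ++ w).
Proof.
move=> lf; elim: w u => [|x w IH] u hw; first by rewrite cats0.
have [hx h'] := hletters_consP hw.
rewrite map_cons (word_ext_cons _ _ lf hx) IH // -surjective_pairing.
by rewrite cat_rcons.
Qed.

Lemma word_ext_sym f u : letter_linear f -> hom_letter_sym f -> hletters u ->
  graded_symmetric (word_ext f u).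
Proof.
move=> lf sf hu v; elim: v u hu => [|z v IH] u hu v' d e x y hx hy.
  rewrite !cat0s (word_ext_cons _ _ lf hx) (word_ext_cons _ _ lf hy).
  rewrite (word_ext_cons _ _ lf hy) (word_ext_cons _ _ lf hx) -!cats1 -!catA /=.
  exact: (word_ext_syml v' sf).
rewrite /= -[RHS]addr0 -[X in _ + X](_ : gsum (fun _ _ => 0) z = 0); last exact: big1.
rewrite -gsum_linear_fun; apply: eq_gsum => c z' hz; rewrite addr0.
by apply: IH => //; apply: hletters_rcons.
Qed.

Lemma sym_lift_hom f : letter_linear f -> hom_letter_sym f ->
  exists2 F : Defs.Sym h -> M, linear F &
    forall w, hletters w -> F (sym_mon (map snd w)) = f w.
Proof.
move=> lf sf; have h0 : hletters ([::] : word) by [].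
have [F lF FE] := sym_lift (word_ext_linear [::] lf) (word_ext_sym lf sf h0).
by exists F => // w hw; rewrite FE word_ext_hom.
Qed.

End WordExtension.

Section Make.
Context (K : fieldType) (h : sgLa K).
Local Notation letter := (int * h)%type.
Local Notation word := (seq (int * h)).
Local Notation sg := (sg K).

Lemma dsum_in_pred (A : lmodType K) (F : subfam A) d x : F d x -> x \in dsum_pred F.
Proof.
move=> hx; apply/asboolP; exists [:: x]; last by rewrite big_seq1.
by move=> y; rewrite inE => /eqP->; exists d.
Qed.

(** The universal property of S(h) gives a linear map into all functions on
    [h]; its values are sums of homogeneous derivations because S(h) is
    spanned by homogeneous words. *)
Lemma cochain_exists N (f : word -> h -> h) :
  (forall y, letter_linear (fun w => f w y)) ->
  (forall y, hom_letter_sym (fun w => f w y)) ->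
  (forall w, hletters w -> der_in (N + 1 + wdeg w) (f w)) ->
  exists c : Cbar h, homog N c /\ forall w y, hletters w -> ev c w y = f w y.
Proof.
move=> lf sf df.
have lf' : letter_linear (f : word -> (h -> h)).
  by move=> u t k x y w; apply/funext => z; apply: lf.
have sf' : hom_letter_sym (f : word -> (h -> h)).
  by move=> u x y w hu hw hx hy; apply/funext => z; apply: sf.
have [F lF FE] := sym_lift_hom lf' sf'.
have Fhom e s : homog (V := Defs.Sym h) e s -> der_in (N + 1 + e) (F s).
  elim=> {s} [|k v s hv _ IH]; first by rewrite (lin0 lF); apply: der_in0.
  have [w [hw wE vE]] := hword_hletters hv.
  rewrite (lF k (sym_mon v) s) -vE FE //; apply: der_in_lin => //.
  by rewrite -wE; apply: df.
have Fder (z : Defs.Sym h) : F z \in dsum_pred (der_fam h).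
  have [r hr ->] := gv_span z; rewrite (big_morph F (linD lF) (lin0 lF)).
  rewrite big_seq; apply: rpred_sum => i /hr[d hi].
  exact: (dsum_in_pred (F := der_fam h) (Fhom d i hi)).
pose G (s : Defs.Sym h) : desusp (Der h) := DsumCar (Fder s).
have Ghom : hom_in (U := Defs.Sym h) (W := desusp (Der h)) N G.
  split=> [k s t|e s hs].
    apply: val_inj; rewrite [RHS](dsum_valP k (G s : Der h) (G t)).
    exact: lF.
  have := Fhom e s hs; rewrite addrAC; exact.
exists (DsumCar (dsum_in_pred (F := hom_fam _ _) Ghom)); split=> // w y hw.
by rewrite -(FE w hw).
Qed.

End Make.

(** * Existence of the differential and of the bracket *)

Section Existence.
Context (K : fieldType) (h : sgLa K).
Local Notation letter := (int * h)%type.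
Local Notation word := (seq (int * h)).
Local Notation sg := (sg K).
Local Notation br := (@sg_br K h).

Section Closure.
Context (M : lmodType K).
Implicit Types (F : word -> word -> M).

Lemma letter_linearZ k (f : word -> M) :
  letter_linear f -> letter_linear (fun w => k *: f w).
Proof. by move=> lf u t l x y w; rewrite lf scalerDr !scalerA mulrC. Qed.

Lemma letter_linearD (f g : word -> M) :
  letter_linear f -> letter_linear g -> letter_linear (fun w => f w + g w).
Proof. by move=> lf lg u t l x y w; rewrite lf lg scalerDr addrACA. Qed.

Lemma letter_symZ k (f : word -> M) :
  letter_sym f -> letter_sym (fun w => k *: f w).
Proof. by move=> sf u x y w hx hy; rewrite (sf _ _ _ _ hx hy) !scalerA mulrC. Qed.

Lemma letter_symD (f g : word -> M) :
  letter_sym f -> letter_sym g -> letter_sym (fun w => f w + g w).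
Proof.
by move=> sf sg u x y w hx hy; rewrite (sf _ _ _ _ hx hy) (sg _ _ _ _ hx hy) scalerDr.
Qed.

Lemma letter_linear_cons z (f : word -> M) :
  letter_linear f -> letter_linear (fun w => f (z :: w)).
Proof. by move=> lf u; apply: (lf (z :: u)). Qed.

Lemma letter_sym_cons z (f : word -> M) :
  letter_sym f -> letter_sym (fun w => f (z :: w)).
Proof. by move=> sf u; apply: (sf (z :: u)). Qed.

Lemma letter_linear_deg (g : int -> K) (f : word -> M) :
  letter_linear f -> letter_linear (fun w => g (wdeg w) *: f w).
Proof.
move=> lf u t l x y w; rewrite lf scalerDr !scalerA !wdeg_cat !wdegS /=.
by rewrite mulrC.
Qed.

Lemma letter_sym_deg (g : int -> K) (f : word -> M) :
  letter_sym f -> letter_sym (fun w => g (wdeg w) *: f w).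
Proof.
move=> sf u x y w hx hy; rewrite (sf _ _ _ _ hx hy) !scalerA !wdeg_cat !wdegS.
by rewrite mulrC (addrCA x.1).
Qed.

Lemma unsh_letter_linear F : (forall b, letter_linear (F^~ b)) ->
  (forall a, letter_linear (F a)) -> letter_linear (fun w => unsh w F).
Proof.
move=> lF rF u; elim: u F lF rF => [|z u IH] F lF rF t k x y w.
  rewrite !cat0s !unshS scalerDr addrACA.
  congr (_ + _); rewrite -unshZ -unshD; apply: eq_unsh => a b _.
    exact: (lF b [::]).
  by rewrite (rF a [::]) /= scalerDr !scalerA mulrC.
rewrite !cat_cons !unshS scalerDr addrACA; congr (_ + _); apply: IH.
- by move=> b; exact: (letter_linear_cons z (lF b)).
- by move=> a; apply: rF.
- by move=> b; exact: (letter_linear_deg (fun d => sg (z.1 * d)) (lF (z :: b))).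
- by move=> a; exact: (letter_linearZ (sg (z.1 * wdeg a)) (letter_linear_cons z (rF a))).
Qed.

(** Two exchanged neighbours stay neighbours if they join the same factor;
    otherwise their exchange swaps the two mixed terms. *)
Lemma unsh_letter_sym F : (forall b, letter_sym (F^~ b)) ->
  (forall a, letter_sym (F a)) -> letter_sym (fun w => unsh w F).
Proof.
move=> lF rF u; elim: u F lF rF => [|z u IH] F lF rF x y w hx hy; last first.
  rewrite !cat_cons !unshS scalerDr; congr (_ + _); apply: (IH _ _ _ _ _ _ hx hy).
  - by move=> b; exact: (letter_sym_cons z (lF b)).
  - by move=> a; apply: rF.
  - by move=> b; exact: (letter_sym_deg (fun d => sg (z.1 * d)) (lF (z :: b))).
  - by move=> a; exact: (letter_symZ (sg (z.1 * wdeg a)) (letter_sym_cons z (rF a))).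
rewrite !cat0s !unshS !scalerDr !addrA [RHS](ACl (1 * 3 * 2 * 4)) /=.
congr (_ + _ + _ + _); rewrite -unshZ; apply: eq_unsh => a b _.
- exact: (lF b [::]).
- by rewrite wdegS; sgn.
- by rewrite wdegS; sgn.
- by rewrite (rF a [::] x y) //; sgn.
Qed.

End Closure.

Lemma vfield_letter_linear (B : word -> h -> h) :
  (forall y, letter_linear (fun w => B w y)) -> (forall u, linear (B u)) ->
  letter_linear (vfield B).
Proof.
move=> lB lB2; apply: unsh_letter_linear => [b|a] u t k x y w.
  by case: b => [|z [|? ?]] /=; rewrite ?scaler0 ?addr0 // lB.
case: u => [|z [|? u]] /=; rewrite ?scaler0 ?addr0 //.
  by case: w => [|? ?] /=; rewrite ?scaler0 ?addr0 // lB2.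
Qed.

Lemma vfield_letter_sym (B : word -> h -> h) :
  (forall y, letter_sym (fun w => B w y)) -> letter_sym (vfield B).
Proof.
move=> sB; apply: unsh_letter_sym => [b|a] u x y w hx hy.
  by case: b => [|z [|? ?]] /=; rewrite ?scaler0 // (sB _ _ _ _ _ hx hy).
by case: u => [|z [|? u]] /=; rewrite ?scaler0.
Qed.

Lemma coder_letter_linear (M : lmodType K) N (th : word -> h) (G : word -> M) :
  letter_linear th -> letter_linear G -> letter_linear (fun w => coder N th w G).
Proof.
move=> lt lG; apply: unsh_letter_linear => [b|a].
  move=> u t k x y w; rewrite lt !wdeg_cat !wdegS /=; exact: letter_head.
exact: letter_linear_cons.
Qed.

Lemma coder_letter_sym (M : lmodType K) N (th : word -> h) (G : word -> M) :
  letter_sym th -> letter_sym G -> head_lin G -> letter_sym (fun w => coder N th w G).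
Proof.
move=> st sG lG; apply: unsh_letter_sym => [b|a]; last exact: letter_sym_cons.
move=> u x y w hx hy; rewrite (st _ _ _ _ hx hy) !wdeg_cat !wdegS (addrCA x.1).
by rewrite (linZ (lG _ _)).
Qed.

Lemma act_letter_linear N (A B : word -> h -> h) y :
  (forall y, letter_linear (fun w => A w y)) ->
  (forall y, letter_linear (fun w => B w y)) ->
  (forall u, linear (A u)) -> (forall u, linear (B u)) ->
  letter_linear (fun w => act N B A w y).
Proof.
move=> lA lB lA2 lB2; apply: letter_linearD.
  by apply: coder_letter_linear => //; apply: vfield_letter_linear.
apply: unsh_letter_linear => [b|a].
  by apply: (letter_linear_deg (fun d => sg (N * d))).
by apply: letter_linearZ => u t k x z w; rewrite lB lA2.
Qed.

Lemma act_letter_sym N (A B : word -> h -> h) y :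
  (forall y, letter_linear (fun w => A w y)) ->
  (forall y, letter_sym (fun w => A w y)) ->
  (forall y, letter_sym (fun w => B w y)) -> (forall u, linear (A u)) ->
  letter_sym (fun w => act N B A w y).
Proof.
move=> lA sA sB lA2; apply: letter_symD.
  by apply: coder_letter_sym => //; [apply: vfield_letter_sym|apply: letter_head].
apply: unsh_letter_sym => [b|a].
  by apply: (letter_sym_deg (fun d => sg (N * d))).
apply: letter_symZ => u x z w hx hz; rewrite (sB _ _ _ _ _ hx hz).
by rewrite (linZ (lA2 a)).
Qed.

Lemma quad_letter_linear : letter_linear (@quad _ h).
Proof.
move=> [|z [|z' [|z'' u]]] t k x y w /=; rewrite ?scaler0 ?addr0 //.
- by case: w => [|? [|? ?]] /=; rewrite ?scaler0 ?addr0 ?sg_linl.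
- by case: w => [|? ?] /=; rewrite ?scaler0 ?addr0 ?sg_linr.
Qed.

Lemma quad_letter_sym : letter_sym (@quad _ h).
Proof.
move=> [|z [|z' [|z'' u]]] x y w hx hy /=; rewrite ?scaler0 //.
by case: w => [|? ?]; rewrite ?scaler0 // (sg_sym hx hy).
Qed.

Lemma letter_symW (M : lmodType K) (f : word -> M) : letter_sym f -> hom_letter_sym f.
Proof. by move=> sf u x y w _ _; apply: sf. Qed.

(** The mixed terms, in which each of the two arguments of the bracket is hit
    by one derivation, cancel in the commutator. *)
Lemma gcomm_der m n (D E : h -> h) : der_in m D -> der_in n E ->
  der_in (m + n) (gcomm m n D E).
Proof.
move=> [[lD dD] derD] [[lE dE] derE]; split.
  split=> [k x y|d x hx].
    by rewrite /gcomm lE !lD lE !scalerDr opprD addrACA scalerN !scalerA mulrC.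
  rewrite /gcomm -scaleNr [X in homog _ X]addrC; apply: sf_lin.
    by have := dE _ _ (dD _ _ hx); rewrite addrA (addrC n).
  by have := dD _ _ (dE _ _ hx); rewrite addrA.
move=> d e x y hx hy; rewrite /gcomm (derD _ _ _ _ hx hy) (derE _ _ _ _ hx hy).
rewrite lD (linZ lD) lE (linZ lE).
rewrite (derD _ _ _ _ (dE _ _ hx) hy) (derD _ _ _ _ hx (dE _ _ hy)).
rewrite (derE _ _ _ _ (dD _ _ hx) hy) (derE _ _ _ _ hx (dD _ _ hy)).
have brl u v k : br (u - k *: v) y = br u y - k *: br v y.
  by rewrite -![_ - k *: _]addrC -!scaleNr sg_linl.
have brr u v k : br x (u - k *: v) = br x u - k *: br x v.
  by rewrite -![_ - k *: _]addrC -!scaleNr sg_linr.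
rewrite {}brl {}brr -!/(sg _).
move: (br (D (E x)) y) (br (E x) (D y)) (br (D x) (E y)) (br x (D (E y)))
  (br (E (D x)) y) (br x (E (D y))) => p1 p2 p3 p4 p5 p6.
rewrite !sgE !oddzE; case: (oddz m); case: (oddz n); case: (oddz d);
  rewrite /= ?expr0 ?expr1 ?scaleN1r ?scale1r ?opprK ?opprD ?opprK ?addrA;
  (* whatever the signs, the mixed terms 2 and 7, and 3 and 6, are opposite *)
  rewrite [LHS](ACl (1 * 5 * 4 * 8 * (2 * 7) * (3 * 6))) /=;
  by rewrite !(subrr, addNr, addr0).
Qed.

(** The convolution products are not derivations one by one, which is why
    [bracket_valE] groups them into commutators. *)
Lemma bracket_val_der m n (a b : Cbar h) w : homog m a -> homog n b -> hletters w ->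
  der_in (m + n + 1 + 1 + wdeg w) (bracket_val (m + 1) (n + 1) (ev a) (ev b) w).
Proof.
move=> ha hb hw.
have dins p q (x z : Cbar h) : homog p x -> homog q z ->
    der_in (p + q + 1 + 1 + wdeg w) (unsh w (fun u v =>
      ev x ((q + 1 + wdeg u, vfield (ev z) u) :: v))).
  move=> hx hz; apply: (unsh_in (S := der_fam h)) => // u v hu hv ->.
  rewrite (_ : _ + _ = p + 1 + (q + 1 + wdeg u + wdeg v)); last by ring.
  have := ev_der hx (w := (q + 1 + wdeg u, vfield (ev z) u) :: v).
  rewrite wdegS; apply; apply: hletters_cons => //.
  exact: vfield_deg (ev_op_deg hz) _ hu.
rewrite (_ : bracket_val _ _ _ _ w =
  (-1) *: unsh w (fun u v => ev a ((n + 1 + wdeg u, vfield (ev b) u) :: v))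
  + (sg ((m + 1) * (n + 1)) *:
       unsh w (fun u v => ev b ((m + 1 + wdeg u, vfield (ev a) u) :: v))
  + (- 1 *: unsh w (fun u v => sg ((n + 1) * wdeg u) *:
      gcomm (m + 1 + wdeg u) (n + 1 + wdeg v) (ev a u) (ev b v)) + 0))); last first.
  apply/funext => y; rewrite bracket_valE.
  rewrite -[RHS]/(-1 *: unsh w _ y + (sg _ *: unsh w _ y + (-1 *: unsh w _ y + 0))).
  by rewrite !unsh_fct addr0 !scaleN1r addrA.
have d1 := dins _ _ _ _ ha hb; have d2 := dins _ _ _ _ hb ha.
apply: der_in_lin => //; apply: der_in_lin.
  by rewrite (addrC m).
apply: der_in_lin; last exact: der_in0.
apply: (unsh_in (S := der_fam h)) => // u v hu hv ->.
rewrite -[_ *: _]addr0; apply: der_in_lin; last exact: der_in0.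
rewrite (_ : _ + (_ + _) = m + 1 + wdeg u + (n + 1 + wdeg v)); last by ring.
by apply: gcomm_der; apply: ev_der.
Qed.

(** A total choice function, as [gsum] extends functions that are defined
    everywhere. *)
Definition choose_cochain (Q : Cbar h -> Prop) : Cbar h :=
  if pselect (exists c, Q c) is left e then sval (cid e) else 0.

Lemma choose_cochainP (Q : Cbar h -> Prop) : (exists c, Q c) -> Q (choose_cochain Q).
Proof. by rewrite /choose_cochain; case: pselect => // e _; apply: svalP. Qed.

Lemma comb_linear k s (p p' q q' : h) :
  - (k *: p + p' - s *: (k *: q + q')) =
  k *: - (p - s *: q) + - (p' - s *: q').
Proof.
rewrite scalerN -opprD; congr (- _).
by rewrite !scalerDr opprD addrACA scalerN !scalerA (mulrC k).
Qed.

Lemma letter_linear_comb k (f g : word -> h) : letter_linear f -> letter_linear g ->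
  letter_linear (fun w => - (f w - k *: g w)).
Proof.
by move=> lf lg u t l x y w; rewrite lf lg; apply: comb_linear.
Qed.

Lemma letter_sym_comb k (f g : word -> h) : letter_sym f -> letter_sym g ->
  letter_sym (fun w => - (f w - k *: g w)).
Proof.
move=> sf sg' u x y w hx hy; rewrite (sf _ _ _ _ hx hy) (sg' _ _ _ _ hx hy).
by rewrite scalerN scalerBr !scalerA (mulrC k).
Qed.

Lemma ev_comb k (a b : Cbar h) :
  ev (k *: a + b) = fun u z => k *: ev a u z + 1 *: ev b u z.
Proof.
by apply/funext => u; apply/funext => z; rewrite ev_linear_c scale1r.
Qed.

(* made available to the side conditions of [act_linear] *)
Let evl := @ev_linear K h.
Let evh := @ev_head_lin K h.

Lemma bracket_val_linl M N k (a a' b : Cbar h) w y :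
  bracket_val M N (ev (k *: a + a')) (ev b) w y =
  k *: bracket_val M N (ev a) (ev b) w y + bracket_val M N (ev a') (ev b) w y.
Proof.
rewrite /bracket_val ev_comb act_linear_arg act_linear // !scale1r.
exact: comb_linear.
Qed.

Lemma bracket_val_linr M N k (a b b' : Cbar h) w y :
  bracket_val M N (ev a) (ev (k *: b + b')) w y =
  k *: bracket_val M N (ev a) (ev b) w y + bracket_val M N (ev a) (ev b') w y.
Proof.
rewrite /bracket_val ev_comb act_linear_arg act_linear // !scale1r.
exact: comb_linear.
Qed.

(** The bracket of homogeneous cochains is obtained from [cochain_exists];
    being unique by [ev_inj], it is bilinear, and it extends to sums of
    homogeneous cochains in each argument. *)
Lemma bracket_exists : exists bk : Cbar h -> Cbar h -> Cbar h, bracket_spec bk.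
Proof.
pose Q m n a b (c : Cbar h) := homog (m + n + 1) c /\ forall w y, hletters w ->
  ev c w y = bracket_val (m + 1) (n + 1) (ev a) (ev b) w y.
pose g m n a b := choose_cochain (Q m n a b).
have gP m n a b : homog m a -> homog n b -> Q m n a b (g m n a b).
  move=> ha hb; apply: choose_cochainP; apply: cochain_exists => [y|y|w hw].
  - apply: letter_linear_comb; apply: act_letter_linear => //;
      move=> z; exact: ev_letter_linear.
  - apply: letter_symW; apply: letter_sym_comb; apply: act_letter_sym => // z;
      by [exact: ev_letter_linear|exact: ev_letter_sym].
  - exact: bracket_val_der.
have glinl m n b : homog n b -> linear_on m (fun a => g m n a b).
  move=> hb k a a' ha ha'; apply: ev_inj => w y hw.
  have hk : homog m (k *: a + a') by exact: sf_lin.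
  rewrite ev_linear_c; have [_ ->] // := gP _ _ _ _ hk hb.
  have [_ ->] // := gP _ _ _ _ ha hb; have [_ ->] // := gP _ _ _ _ ha' hb.
  exact: bracket_val_linl.
have glinr m n a : homog m a -> linear_on n (g m n a).
  move=> ha k b b' hb hb'; apply: ev_inj => w y hw.
  have hk : homog n (k *: b + b') by exact: sf_lin.
  rewrite ev_linear_c; have [_ ->] // := gP _ _ _ _ ha hk.
  have [_ ->] // := gP _ _ _ _ ha hb; have [_ ->] // := gP _ _ _ _ ha hb'.
  exact: bracket_val_linr.
pose bk a b : Cbar h := gsum (fun m a' => gsum (fun n b' => g m n a' b') b) a.
have bklin b m : linear_on m (fun a' => gsum (fun n b' => g m n a' b') b).
  move=> k a a' ha ha'; rewrite -gsum_linear_fun; apply: eq_gsum => n b' hb'.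
  exact: glinl.
exists bk; split=> [b|a|m n a b ha hb].
- by apply: gsum_linear => m; apply: bklin.
- move=> k b b'; rewrite /bk -gsum_linear_fun; apply: eq_gsum => m a' ha'.
  by apply: gsum_linear => n; apply: glinr.
suff -> : bk a b = g m n a b by apply: gP.
rewrite /bk (gsum_homog _ ha) //.
by apply: (gsum_homog _ hb) => e; apply: glinr.
Qed.

Lemma partial_exists : exists D : Cbar h -> Cbar h, partial_spec D.
Proof.
pose Q n b (c : Cbar h) := homog (n + 1) c /\ forall w y, hletters w ->
  ev c w y = sg (n + 1) *: coder 1 (@quad _ h) w (fun u => ev b u y).
pose g n b := choose_cochain (Q n b).
have gP n b : homog n b -> Q n b (g n b).
  move=> hb; apply: choose_cochainP; apply: cochain_exists => [y|y|w hw].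
  - apply: letter_linearZ; apply: coder_letter_linear; first exact: quad_letter_linear.
    exact: ev_letter_linear.
  - apply: letter_symW; apply: letter_symZ; apply: coder_letter_sym => //.
      exact: quad_letter_sym.
    exact: ev_letter_sym.
  rewrite (_ : (fun y => _) = sg (n + 1) *: unsh w (fun u v =>
     ev b ((1 + wdeg u, quad u) :: v)) + 0); last first.
    apply/funext => y; rewrite addr0 -[RHS]/(sg _ *: unsh w _ y).
    by rewrite unsh_fct.
  apply: der_in_lin; last exact: der_in0.
  apply: (unsh_in (S := der_fam h)) => // u v hu hv ->.
  have := ev_der hb (w := (1 + wdeg u, quad u) :: v).
  rewrite wdegS /= (_ : n + 1 + (1 + _ + _) = n + 1 + 1 + (wdeg u + wdeg v)); last by ring.
  by apply; apply: hletters_cons => //; apply: quad_deg.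
have glin n : linear_on n (g n).
  move=> k b b' hb hb'; apply: ev_inj => w y hw.
  have hk : homog n (k *: b + b') by exact: sf_lin.
  rewrite ev_linear_c; have [_ ->] // := gP _ _ hk.
  have [_ ->] // := gP _ _ hb; have [_ ->] // := gP _ _ hb'.
  rewrite ev_comb coderD !coderZ scale1r scalerDr !scalerA; congr (_ *: _ + _).
  by rewrite mulrC.
exists (gsum g); split; first exact: gsum_linear.
by move=> n b hb; rewrite (gsum_homog glin hb); apply: gP.
Qed.

End Existence.

(** * Operator homotopy post-Lie structures as cochains *)

Section PostLie.
Context (K : fieldType) (h : sgLa K).
Local Notation letter := (int * h)%type.
Local Notation word := (seq (int * h)).
Local Notation sg := (sg K).
Local Notation br := (@sg_br K h).

Lemma letter_sym_move (M : lmodType K) (f : word -> M) u (x : letter) w :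
  letter_sym f -> hletters u -> homog x.1 x.2 ->
  f (u ++ x :: w) = sg (x.1 * wdeg u) *: f (x :: u ++ w).
Proof.
move=> sf hu hx; elim: u f sf hu => [|z u IH] f sf hu.
  by rewrite wdeg0 mulr0 sg0 scale1r.
have [hz h'] := hletters_consP hu.
rewrite /= (IH (fun v => f (z :: v)) (letter_sym_cons _ sf) h').
by rewrite (sf [::] z x) // wdegS; sgn.
Qed.

Lemma lift_perm_surj p (t : 'S_p.+1) : exists i (s : 'S_p), t = lift_perm i ord0 s.
Proof.
have := sum_lift_perm (fun t' => (t' == t : nat)).
rewrite (bigD1 t) //= eqxx => H.
apply: contrapT => nex; move: H; rewrite [X in _ = X]big1 // => i _.
by rewrite big1 // => s _; case: eqP => // E; case: nex; exists i, s.
Qed.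

(** Symmetry under exchange of neighbours implies symmetry with Koszul signs
    under all permutations: the first letter is moved to the front, and the
    other ones are put in order by induction. *)
Lemma letter_sym_koszul (M : lmodType K) (f : word -> M) p (v : 'I_p -> letter) s :
  letter_sym f -> hletters (letters v) ->
  f (permuted v s) = koszul K (fun k => (v k).1) s *: f (letters v).
Proof.
elim: p v s f => [|p IH] v s f sf hv.
  by rewrite /permuted !letters0 /koszul big_ord0 scale1r.
have [i [t ->]] := lift_perm_surj s.
move: hv; rewrite lettersS => /hletters_consP[hx hv].
rewrite permuted_lift koszul_lift.
set u := permuted _ t.
have hu : hletters u.
  by move=> x /mapP[k _ ->]; apply: hv; apply: map_f; rewrite mem_enum.
have htk : hletters (take i u) by move=> x /mem_take/hu.
rewrite (letter_sym_move _ sf htk hx) cat_take_drop.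
rewrite (IH _ t (fun w => f (v ord0 :: w)) (letter_sym_cons _ sf) hv).
by rewrite scalerA wdeg_take_letters.
Qed.

Lemma koszul1 p (d : 'I_p -> int) : koszul K d 1%g = 1.
Proof.
rewrite /koszul big1 // => i _; rewrite big1 // => j.
by rewrite !perm1 => /andP[ij ji]; move: (ltn_trans ij ji); rewrite ltnn.
Qed.

(** Conversely, the exchange of two neighbours is one of the permutations to
    which the symmetry of a post-Lie structure applies. *)
Lemma adjacent_swap u (x y : letter) w :
  exists p (v : 'I_p -> letter) (s : 'S_p),
    [/\ letters v = u ++ x :: y :: w, permuted v s = u ++ y :: x :: w
      & koszul K (fun k => (v k).1) s = sg (x.1 * y.1)].
Proof.
elim: u => [|z u [p [v [s [vE sE kE]]]]].
  pose l := [:: x, y & w]; pose v (k : 'I_(size w).+2) := nth x l k.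
  have vE : letters v = l by apply: letters_nth.
  have vE1 : letters (fun k => v (lift ord0 k)) = y :: w.
    by move: vE; rewrite lettersS => -[].
  (* the first letter goes to the second position *)
  exists _, v, (lift_perm (lift ord0 ord0) ord0 1%g); split=> //.
    rewrite permuted_lift /permuted.
    rewrite (_ : letters _ = y :: w) ?[in RHS]/= /=; first by rewrite take0 drop0.
    by apply: etrans vE1; rewrite /letters; apply: eq_map => k; rewrite perm1.
  rewrite koszul_lift koszul1 mulr1 (big_pred1 ord0) ?perm1 //.
  by move=> k /=; rewrite /bump leqn0 addn0 ltnS leqn0.
pose v' (k : 'I_p.+1) := if unlift ord0 k is Some k' then v k' else z.
have v'0 : v' ord0 = z by rewrite /v' unlift_none.
have v'l : (fun k => v' (lift ord0 k)) = v.
  by apply/funext => k; rewrite /v' liftK.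
exists p.+1, v', (lift_perm ord0 ord0 s); split.
- by rewrite lettersS v'0 v'l vE.
- by rewrite permuted_lift v'l sE take0 drop0 v'0.
rewrite koszul_lift big_pred0 // mulr0 sg0 mul1r -kE; congr koszul.
by apply/funext => k; rewrite -v'l.
Qed.

(** Letters are replaced one by one with homogeneous ones, which span. *)
Lemma multilinear_ext (M : lmodType K) (f g : seq h -> M) :
  multilinear_on f -> multilinear_on g ->
  (forall w, hletters w -> f (map snd w) = g (map snd w)) -> f = g.
Proof.
move=> lf lg fg; apply/funext => v.
suff H u : hletters u -> f (map snd u ++ v) = g (map snd u ++ v).
  by apply: (H [::]).
elim: v u => [|x v IH] u hu; first by rewrite !cats0 fg.
apply: (linear_ext (f := fun x => f (map snd u ++ x :: v))
  (g := fun x => g (map snd u ++ x :: v))) => [k y z|k y z|d y hy]; rewrite ?lf ?lg //.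
have := IH (rcons u (d, y)); rewrite map_rcons !cat_rcons /=; apply.
exact: hletters_rcons.
Qed.

Lemma theta_of_postLie (L : Cbar h) : homog 0 L ->
  theta_homotopy (theta_of L) -> operator_homotopy_postLie (theta_of L).
Proof.
move=> hL hom; split=> //.
- split=> [y u w k x z|w]; last exact: der_linear.
  have := ev_letter_linear L y [seq (0, t) | t <- u] 0 k x z [seq (0, t) | t <- w].
  by rewrite /ev !map_cat /= -!map_comp !map_id.
- move=> e d w y hw hy; have [w' [hw' <- <-]] := hword_hletters hw.
  rewrite (_ : _ + 1 = 0 + 1 + wdeg w' + d); last by ring.
  exact: (ev_op_deg hL hw' hy).
- move=> p x d hx f y hy s.
  have := letter_sym_koszul s (@ev_letter_sym _ _ L y) (hletters_tag hx).
  by rewrite /ev snd_permuted snd_tag.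
move=> c d e w y z hw hy hz; have [w' [hw' <- <-]] := hword_hletters hw.
have := ev_der_op hL hw' hy hz.
by rewrite /theta_of add0r (addrC 1).
Qed.

(** The symmetry and derivation conditions on a post-Lie structure say exactly
    that its maps are the values of a cochain: all the arguments but the last
    one are those of a symmetric family of operators, which are derivations of
    the last argument. *)
Lemma postLie_cochain (th : seq h -> h -> h) : operator_homotopy_postLie th ->
  exists! L : Cbar h, homog 0 L /\ theta_of L = th.
Proof.
move=> [[thl thl2] thd ths thder _].
pose f (w : word) y := th (map snd w) y.
have fsym y : hom_letter_sym (fun w => f w y).
  move=> u x z w hu hw hx hz.
  have [p [v [s [vE sE kE]]]] := adjacent_swap u z x w.
  apply: (linear_ext (f := f (u ++ x :: z :: w))
    (g := fun y => sg (x.1 * z.1) *: f (u ++ z :: x :: w) y)).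
  - exact: thl2.
  - move=> k a b; rewrite /f thl2 scalerDr !scalerA.
    by rewrite mulrC.
  move=> e {}y hy; rewrite mulrC -kE /f -vE -sE.
  rewrite /permuted !map_letters.
  apply: (ths p (fun k => (v k).2) (fun k => (v k).1) _ e y hy s).
  move=> k; have : hletters (letters v).
    rewrite vE; apply: hletters_cat => //; do 2![apply: hletters_cons => //].
  by apply; apply: map_f; rewrite mem_enum.
have fder w : hletters w -> der_in (0 + 1 + wdeg w) (f w).
  move=> hw; have hv := hletters_hword hw; split; first split.
  - exact: thl2.
  - by move=> d y hy; have := thd _ _ _ _ hv hy; rewrite add0r addrC addrA.
  move=> d e y z hy hz; rewrite /f (thder _ _ _ _ _ _ hv hy hz) add0r.
  by rewrite (addrC 1).
have flin y : letter_linear (fun w => f w y).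
  by move=> u t k a b w; rewrite /f !map_cat /=; apply: thl.
have [L [hL LE]] := cochain_exists flin fsym fder.
exists L; split=> [|L' [_ L'E]]; last first.
  by apply: ev_inj => w y hw; rewrite LE // -[RHS]/(theta_of L' _ _) L'E.
split=> //; apply: multilinear_ext => [u w k x z|u w k x z|w hw].
- apply/funext => y; have := ev_letter_linear L y
    [seq (0, t) | t <- u] 0 k x z [seq (0, t) | t <- w].
  by rewrite /ev !map_cat /= -!map_comp !map_id.
- by apply/funext => y; apply: thl.
by apply/funext => y; apply: LE.
Qed.

Lemma pchar0_two : [pchar K] =i pred0 -> (2%:R : K) != 0.
Proof. by move=> /(_ 2%N); rewrite !inE /= => ->. Qed.

End PostLie.

Theorem theorem3p6 (K : fieldType) (charK0 : [pchar K]%R =i pred0) (h : sgLa K) :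
  (exists (D : Cbar h -> Cbar h) (br : Cbar h -> Cbar h -> Cbar h),
     is_partial D /\ is_bracket br) /\
  forall (D : Cbar h -> Cbar h) (br : Cbar h -> Cbar h -> Cbar h),
    is_partial D -> is_bracket br ->
    [/\ @is_dgla K (susp (Cbar h)) br D,
        forall L : Cbar h, homog 0 L ->
          (@maurer_cartan K (susp (Cbar h)) br D L <->
           operator_homotopy_postLie (theta_of L))
      & forall theta : seq h -> h -> h, operator_homotopy_postLie theta ->
          exists! L : Cbar h, homog 0 L /\ theta_of L = theta].
Proof.
have nz2 := pchar0_two charK0; split.
  have [D hD] := partial_exists h; have [bk hbk] := bracket_exists h.
  by exists D, bk; split; [apply/is_partialE|apply/is_bracketE].
move=> D bk /is_partialE hD /is_bracketE hbk; split=> [|L hL|th].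
- exact: cochains_dgla.
- rewrite (maurer_cartanE hD hbk nz2 hL) -homotopyE; split=> [|[]] //.
  exact: theta_of_postLie.
exact: postLie_cochain.
Qed.
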